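(* Let $\mathcal{H}$ be a finite-dimensional real Hilbert space and let $F=f+g+h$ on $\mathcal{H}$, where: (1) $f\colon \mathcal{H}\to\mathbb{R}$ is a differentiable $\alpha$-convex function with $\kappa$-Lipschitz continuous gradient and $\alpha\ge-\kappa$; (2) $g\colon\mathcal{H}\to(-\infty,+\infty]$ is a proper lower semicontinuous function; (3) $h=\bar h-\underline h$, where $\bar h\colon\mathcal{H}\to\mathbb{R}$ is a differentiable function with $\ell$-Lipschitz continuous gradient and $\underline h\colon\mathcal{H}\to\mathbb{R}$ is a continuous convex function. Suppose that $F$ is coercive. Let $\gamma\in(0,+\infty)$, $\theta\in(0,1]$, $\eta\in(0,+\infty)$, and let $(x_n,y_n,z_n,y^*_{n-1})_{n\in\mathbb{N}^\ast}$ be a sequence generated by the DRFDR algorithm (described in the context) with these parameters. Suppose that either (a) $\kappa>0$, $\eta\in(0,2)$ if $\ell=0$, $\eta\in[1,2)$ if $\ell>0$, and $\gamma\in(0,\overline\gamma)$; or (b) $\kappa>0$, $\eta\in\left[2,\,2+\frac{2\kappa}{\theta(\kappa+\ell)}\right)$, $\alpha>\frac{(3\eta-2)\theta\ell+2\sqrt{2(\eta-2)\theta\kappa(\kappa+\ell)}}{\eta\theta+2-2\theta}$, and $\gamma\in(\underline\gamma,\overline\gamma)$; or (c) $\kappa=0$, $\eta\in(0,2)$, $\gamma\in\left(0,\frac{1}{\theta\ell}\right)$ if $\eta\le1$, and $\gamma\in\left(0,\frac{2-\eta}{(3\eta-2)\theta\ell}\right)$ if $\eta>1$ (with the convention $\frac{1}{\theta\ell}=\frac{2-\eta}{(3\eta-2)\theta\ell}=+\infty$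 when $\ell=0$), where $$\underline\gamma:=\frac{(\eta\theta+2-2\theta)\alpha-(3\eta-2)\theta\ell-\sqrt{\Delta}}{4\theta\kappa(\kappa+\ell)},\qquad \overline\gamma:=\frac{(\eta\theta+2-2\theta)\alpha-(3\eta-2)\theta\ell+\sqrt{\Delta}}{4\theta\kappa(\kappa+\ell)}$$ with $\Delta:=\left((\eta\theta+2-2\theta)\alpha-(3\eta-2)\theta\ell\right)^2-8(\eta-2)\theta\kappa(\kappa+\ell)$. Let $\mathcal{L}\colon\mathcal{H}^5\to(-\infty,+\infty]$ be defined by $$\mathcal{L}(x,y,z,u,v)=f(x)+g(y)+\bar h(x)+\langle u,y-x\rangle+\underline h^*(v)-\langle v,y\rangle+\frac1\gamma\langle z-x,y-x\rangle-\frac{2\eta\theta-1}{2\theta\gamma}\|y-x\|^2,$$ where $\underline h^*$ is the conjugate of $\underline h$, and suppose that $\mathcal{L}$ is a KL function. Then $$\sum_{n=1}^{+\infty}\|(x_{n+1},y_{n+1},z_{n+1})-(x_n,y_n,z_n)\|<+\infty$$ and the sequence $(x_n,y_n,z_n)_{n\in\mathbb{N}^\ast}$ converges to $(\tilde x,\tilde y,\tilde z)$ with $\tilde x=\tilde y$ and $$0\in\partial(f+g+\bar h)(\tilde y)-\partial\underline h(\tilde y).$$ Moreover, if $\mathcal{L}$ is a KL function with exponent $\lambda\in[0,1)$, then exactly one of the following alternatives holds: (i) (Finite convergence) $\lambda=0$ and there exists $n_0\in\mathbb{N}$ such that, for all $n\ge n_0$, $(x_n,y_n,z_n)=(\tilde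 x,\tilde y,\tilde z)$. (ii) (Linear convergence) $\lambda\le\frac12$ and there exist $\Gamma\in(0,+\infty)$ and $\rho\in(0,1)$ such that, for all $n\in\mathbb{N}^\ast$, $\|(x_n,y_n,z_n)-(\tilde x,\tilde y,\tilde z)\|\le\Gamma\rho^{\frac n2}$ and $|F(y_n)-F(\tilde y)|\le\Gamma\rho^{\frac n2}$. (iii) (Sublinear convergence) $\lambda>\frac12$ and there exists $\Gamma\in(0,+\infty)$ such that, for all $n\in\mathbb{N}^\ast$, $\|(x_n,y_n,z_n)-(\tilde x,\tilde y,\tilde z)\|\le\Gamma n^{-\frac{1-\lambda}{2\lambda-1}}$ and $|F(y_n)-F(\tilde y)|\le\Gamma n^{-\frac{1-\lambda}{2\lambda-1}}$.
   Context: $\mathbb{N}$ is the set of nonnegative integers and $\mathbb{N}^\ast$ the set of positive integers. The constants satisfy $\kappa,\ell\in[0,+\infty)$ and $\alpha\in\mathbb{R}$. A function $f\colon\mathcal{H}\to(-\infty,+\infty]$ is $\alpha$-convex ($\alpha\in\mathbb{R}$) if $f((1-\lambda)x+\lambda y)+\frac{\alpha}{2}\lambda(1-\lambda)\|x-y\|^2\le(1-\lambda)f(x)+\lambda f(y)$ for all $x,y\in\operatorname{dom}f=\{x:f(x)<+\infty\}$ and $\lambda\in(0,1)$. It is coercive if $f(x)\to+\infty$ as $\|x\|\to+\infty$. The conjugate of a proper function $p$ is $p^*(u)=\sup_{x\in\mathcal{H}}(\langle u,x\rangle-p(x))$. Subdifferentials: for a proper lower semicontinuous $f$ and $x\in\operatorname{dom}f$,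 the regular subdifferential is $\widehat\partial f(x)=\{x^*:\liminf_{y\to x}\frac{f(y)-f(x)-\langle x^*,y-x\rangle}{\|y-x\|}\ge0\}$, and $\partial f(x)$ is the limiting subdifferential, the set of $x^*$ for which there exist $x_n\to x$ and $x_n^*\in\widehat\partial f(x_n)$ with $f(x_n)\to f(x)$ and $x_n^*\to x^*$; both are empty if $x\notin\operatorname{dom}f$. For convex functions $\partial$ is the usual convex subdifferential. $\operatorname{dom}\partial f=\{x:\partial f(x)\ne\varnothing\}$. The difference of two sets is the Minkowski difference $A-B=\{a-b:a\in A,b\in B\}$. KL property: a proper lower semicontinuous function $f$ satisfies the Kurdyka–Łojasiewicz (KL) property at $\overline x\in\operatorname{dom}\partial f$ if there exist $\varepsilon\in(0,+\infty)$, $\delta\in(0,+\infty]$ and a continuous concave function $\varphi\colon[0,\delta)\to[0,+\infty)$ such that $\varphi$ is continuously differentiable with $\varphi'>0$ on $(0,\delta)$, $\varphi(0)=0$, and $\varphi'(f(x)-f(\overline x))\operatorname{dist}(0,\partial f(x))\ge1$ whenever $\|x-\overline x\|\le\varepsilon$ and $f(\overline x)<f(x)<f(\overline x)+\delta$. $f$ is a KL function if it satisfies the KL property at every $\overline x\in\operatorname{dom}\partial f$. It satisfies the KL property at $\overline x$ with exponent $\lambda\in[0,1)$ if $\varphi$ can be chosen as $\varphi(t)=ct^{1-\lambda}$ for some $c\in(0,+\infty)$. $f$ is a KL function with exponent $\lambda$ if it is a KL function and has the same exponent $\lambda$ at every point of $\operatorname{dom}\partial f$. Proximity operator (set-valued):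 $\operatorname{Prox}_{\gamma f}(x)=\operatorname{argmin}_{z\in\mathcal{H}}\left(f(z)+\frac{1}{2\gamma}\|z-x\|^2\right)$. DRFDR algorithm: given $y_0,z_0\in\mathcal{H}$, for each $n\in\mathbb{N}$ choose $y_n^*\in\partial\underline h(y_n)$ and find $$x_{n+1}\in\operatorname{Prox}_{\gamma f}(z_n),$$ $$y_{n+1}\in\operatorname{Prox}_{\theta\gamma g}\big((\theta+1)x_{n+1}-\theta z_n-\theta\gamma\nabla\bar h(x_{n+1})+\theta\gamma y_n^*\big),$$ $$z_{n+1}=z_n+\eta(y_{n+1}-x_{n+1}).$$
   Formalization: That alternatives (i) and (ii) exclude each other is asserted only when H has positive dimension; for H = {0} and λ = 0 the sequence is constant and both hold, so ''exactly one'' fails there. *)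

(* Defs.v *)
From HB Require Import structures.
From mathcomp Require Import all_boot all_order all_algebra.
From mathcomp Require Import all_classical all_reals all_analysis.

Set Implicit Arguments.
Unset Strict Implicit.
Unset Printing Implicit Defensive.

Import Order.TTheory GRing.Theory Num.Def Num.Theory.
Import numFieldNormedType.Exports.

Local Open Scope classical_set_scope.
Local Open Scope ring_scope.

(* Finite-dimensional normed modules. A finite-dimensional real Hilbert space
   is an [H : normedVectType R] with a dot product [ip : {dot H for idfun}] such
   that [ip x x = `|x| ^+ 2]; completeness is then automatic. *)
#[short(type="normedVectType")]
HB.structure Definition NormedVector (K : numFieldType) :=
  {V of NormedModule K V & Vector K V}.

Section Euclidean.
Context {R : realType}.

Definition ipnorm (E : lmodType R) (ip : E -> E -> R) (x : E) : R :=
  Num.sqrt (ip x x).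

(* The library norm of a product is the max norm; product Hilbert spaces are
   normed by [ipnorm] of the sum of the inner products instead. Both norms
   induce the library topology of the product. *)
Definition ip_prod (E1 E2 : lmodType R) (ip1 : E1 -> E1 -> R)
    (ip2 : E2 -> E2 -> R) (p q : E1 * E2) : R :=
  ip1 p.1 q.1 + ip2 p.2 q.2.

Definition ip3 (E : lmodType R) (ip : E -> E -> R) : E * E * E -> E * E * E -> R :=
  ip_prod (ip_prod ip ip) ip.

Definition ip5 (E : lmodType R) (ip : E -> E -> R) :
    E * E * E * E * E -> E * E * E * E * E -> R :=
  ip_prod (ip_prod (ip3 ip) ip) ip.

End Euclidean.

Section ExtendedRealFunctions.
Context {R : realType} {E : normedModType R}.
Implicit Types (f : E -> \bar R) (x : E).
Local Open Scope ereal_scope.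

Definition proper_function f := (forall x, -oo < f x) /\ exists x, f x < +oo.

Definition alpha_convex (alpha : R) f := forall (x y : E) (t : R),
  f x < +oo -> f y < +oo -> (0 < t < 1)%R ->
  f ((1 - t) *: x + t *: y)%R
    + (alpha / 2 * t * (1 - t) * `|x - y| ^+ 2)%:E
  <= (1 - t)%:E * f x + t%:E * f y.

Definition coercive f := forall M : R, exists B : R, forall x,
  (B < `|x|)%R -> M%:E < f x.

Definition argmin f : set E := [set z | forall w, f z <= f w].

Definition prox (gamma : R) f x : set E :=
  argmin (fun z => f z + ((2 * gamma)^-1 * `|z - x| ^+ 2)%:E).

Definition conjugate (ip : E -> E -> R) f : E -> \bar R :=
  fun u => ereal_sup [set (ip u x)%:E - f x | x in [set: E]].

End ExtendedRealFunctions.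

Section Subdifferentials.
Context {R : realType} {E : normedModType R}.
Variable ip : E -> E -> R.
Implicit Types (f : E -> \bar R) (x : E).
Local Open Scope ereal_scope.

Definition is_gradient (f : E -> R) (df : E -> E) := forall x,
  differentiable f x /\ forall v, 'd f x v = ip (df x) v.

Definition convex_subdiff (f : E -> R) x : set E :=
  [set u | forall y, (f x + ip u (y - x) <= f y)%R].

(* The limit inferior is taken over the punctured neighborhoods of [x]. *)
Definition regular_subdiff f x : set E :=
  [set u | f x < +oo /\
    0 <= limf_einf (fun y => (f y - f x - (ip u (y - x)%R)%:E)
                             * ((ipnorm ip (y - x)%R)^-1)%:E) x^'].

Definition limiting_subdiff f x : set E :=
  [set u | f x < +oo /\ exists (xs us : nat -> E),
    [/\ forall n, regular_subdiff f (xs n) (us n),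
        xs n @[n --> \oo] --> x,
        f (xs n) @[n --> \oo] --> f x
      & us n @[n --> \oo] --> u]].

Definition dom_subdiff f : set E := [set x | limiting_subdiff f x !=set0].

(* Equal to [+oo] on the empty set. *)
Definition dist_to x (A : set E) : \bar R :=
  ereal_inf [set (ipnorm ip (x - a)%R)%:E | a in A].

Definition desingularizing (delta : \bar R) (phi : R -> R) :=
  let D := [set t : R | (0 <= t)%R /\ t%:E < delta] in
  [/\ forall t, D t -> (0 <= phi t)%R,
      {within D, continuous phi},
      convex_function D (fun t => (- phi t)%R),
      phi 0%R = 0%R
    & forall t, (0 < t)%R -> t%:E < delta ->
        [/\ derivable phi t 1%R, {for t, continuous (derive1 phi)}
          & (0 < derive1 phi t)%R]].

Definition KL_with f x (phi : R -> R) :=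
  exists (eps : R) (delta : \bar R),
    [/\ (0 < eps)%R, 0 < delta, desingularizing delta phi
      & forall y, (ipnorm ip (y - x)%R <= eps)%R ->
          f x < f y -> f y < f x + delta ->
          1 <= (derive1 phi (fine (f y - f x)))%:E
               * dist_to 0%R (limiting_subdiff f y)].

Definition KL_at f x := exists phi, KL_with f x phi.

Definition KL_at_exponent (lambda : R) f x := exists2 c : R, (0 < c)%R &
  KL_with f x (fun t => (c * t `^ (1 - lambda))%R).

Definition KL_function f := forall x, dom_subdiff f x -> KL_at f x.

Definition KL_function_exponent (lambda : R) f :=
  KL_function f /\ forall x, dom_subdiff f x -> KL_at_exponent lambda f x.

End Subdifferentials.

Section DRFDR.
Context {R : realType} {H : normedVectType R}.
Variable ip : H -> H -> R.
Implicit Types (f g : H -> \bar R) (x y z ys : nat -> H).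

(* [ys n] is y_n^*; the value [x 0] plays no role. *)
Definition DRFDR f g (grad_hbar : H -> H) (hlow : H -> R)
    (gamma theta eta : R) x y z ys := forall n,
  [/\ convex_subdiff ip hlow (y n) (ys n),
      prox gamma f (z n) (x n.+1),
      prox (theta * gamma) g
        ((theta + 1) *: x n.+1 - theta *: z n
           - (theta * gamma) *: grad_hbar (x n.+1) + (theta * gamma) *: ys n)
        (y n.+1)
    & z n.+1 = z n + eta *: (y n.+1 - x n.+1)].

Definition lagrangian (f : H -> R) (g : H -> \bar R) (hbar hlow : H -> R)
    (gamma theta eta : R) (w : H * H * H * H * H) : \bar R :=
  let: (x, y, z, u, v) := w in
  ((f x)%:E + g y + (hbar x)%:E + (ip u (y - x))%:E
   + conjugate ip (EFin \o hlow) v - (ip v y)%:E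
   + (gamma^-1 * ip (z - x) (y - x))%:E
   - ((2 * eta * theta - 1) / (2 * theta * gamma) * `|y - x| ^+ 2)%:E)%E.

End DRFDR.

Section StepSizes.
Context {R : realType}.
Variables alpha kappa l theta eta : R.

Definition lin_coef : R :=
  (eta * theta + 2 - 2 * theta) * alpha - (3 * eta - 2) * theta * l.

Definition discr : R :=
  lin_coef ^+ 2 - 8 * (eta - 2) * theta * kappa * (kappa + l).

Definition gamma_low : R :=
  (lin_coef - Num.sqrt discr) / (4 * theta * kappa * (kappa + l)).

Definition gamma_up : R :=
  (lin_coef + Num.sqrt discr) / (4 * theta * kappa * (kappa + l)).

Definition condition_a (gamma : R) :=
  [/\ 0 < kappa, l = 0 -> 0 < eta < 2, 0 < l -> 1 <= eta < 2
    & 0 < gamma < gamma_up].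

Definition condition_b (gamma : R) :=
  [/\ 0 < kappa,
      2 <= eta < 2 + 2 * kappa / (theta * (kappa + l)),
      ((3 * eta - 2) * theta * l
         + 2 * Num.sqrt (2 * (eta - 2) * theta * kappa * (kappa + l)))
        / (eta * theta + 2 - 2 * theta) < alpha
    & gamma_low < gamma < gamma_up].

(* Division with the convention a / 0 = +oo. *)
Definition div_or_oo (a b : R) : \bar R := if b == 0 then +oo%E else (a / b)%:E.

Definition condition_c (gamma : R) :=
  [/\ kappa = 0, 0 < eta < 2, 0 < gamma,
      eta <= 1 -> (gamma%:E < div_or_oo 1 (theta * l))%E
    & 1 < eta ->
      (gamma%:E < div_or_oo (2 - eta) ((3 * eta - 2) * theta * l))%E].

End StepSizes.

Section Rates.
Context {R : realType} {E : lmodType R}.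
Variables (nrm : E -> R) (w : nat -> E) (wlim : E).
Variables (Fval : nat -> \bar R) (Flim : \bar R).

Definition rate_bound (r : nat -> R) := forall n, (1 <= n)%N ->
  nrm (w n - wlim) <= r n /\ (`|Fval n - Flim| <= (r n)%:E)%E.

(* For lambda = 0, finite convergence implies linear convergence (the [Fval n]
   being finite for n >= 1), so these two exclude each other only because a
   [lagrangian] on a space of positive dimension never has KL exponent 0: near a
   critical point, the bilinear term in [u] and [x] produces larger values with
   arbitrarily small subgradients. On the zero space every exponent occurs. *)
Definition finite_convergence (lambda : R) :=
  lambda = 0 /\ exists n0 : nat, forall n, (n0 <= n)%N -> w n = wlim.

Definition linear_convergence (lambda : R) :=
  lambda <= 1 / 2 /\ exists Gamma rho : R,
    [/\ 0 < Gamma, 0 < rho < 1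
      & rate_bound (fun n => Gamma * rho `^ (n%:R / 2))].

Definition sublinear_convergence (lambda : R) :=
  1 / 2 < lambda /\ exists2 Gamma : R, 0 < Gamma &
    rate_bound (fun n =>
      Gamma * n%:R `^ (- ((1 - lambda) / (2 * lambda - 1)))).

End Rates.

(* Main.v *)
Require Import Defs.
From HB Require Import structures.
From mathcomp Require Import all_boot all_order all_algebra.
From mathcomp Require Import all_classical all_reals all_analysis.
From mathcomp Require Import ring lra zify.

(** Along the algorithm put [w_n = (x_n, y_n, z_n, grad hbar(x_n), y*_(n-1))]. The
    value of [L] at [w_n] is the value at [y_n] of the model of [F] that [y_n]
    minimizes: [f] and [hbar] are linearized at [x_n], the concave part [- hlow] is
    linearized at [y_(n-1)] through [y*_(n-1)], and the proximal term is added
    ([lagrangian_iterate], [ell_le]). Comparing [y_(n+1)] with [y_n] in the next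
    model bounds [L(w_(n+1)) - L(w_n)] by a multiple of [|x_(n+1) - x_n|^2]
    ([ell_descent]). Up to a positive factor and a term that the hypotheses control,
    the coefficient is the quadratic polynomial in [gamma] whose roots are
    [gamma_low] and [gamma_up], so the step-size conditions make it negative
    ([stepsize_descent]). They also give [theta gamma (kappa + l) < 1] whenever
    [alpha <= kappa] ([stepsize_bound]), which puts [F(y_n)] below [L(w_n)]
    ([F_le_ell]); since [F] is coercive, the iterates stay bounded, the values
    [L(w_n)] converge and the steps [x_(n+1) - x_n] tend to [0].

    The function [g] enters only through its proximal step, which says that a
    downward paraboloid touches the graph of [g] from below at [y_n]
    ([g_prox_subgradient]). The other terms of [L] are smooth, except for the
    conjugate of [hlow], which is supported by an affine function; hence a quadratic
    minorant touches [L] at [w_n] and its slope is a subgradient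
    ([lagrangian_regular_subdiff]), of norm at most a constant times
    [|x_(n+1) - x_n| + |x_n - x_(n-1)|] ([iterate_subgradient_step]). The paraboloids
    pass to the limit, so each cluster point of [w_n] is a critical point of [L] at
    the limit value, of the form [(p, p, p + gamma grad f(p), grad hbar(p), v)] with
    [v] a subgradient of [hlow] at [p] ([cluster_iterate]); this structure yields the
    stationarity of [p] for [F] ([limit_stationary]).

    The rest is the Kurdyka-Lojasiewicz argument, written for abstract sequences
    with sufficient decrease and a relative error bound. Near one cluster point the
    gap [s_n] of the values and the steps [a_n] satisfy
    [a_(n+1)^2 <= C (phi(s_(n+1)) - phi(s_(n+2))) (a_(n+1) + a_n)]. By compactness
    finitely many functions [phi] suffice, and their sum serves everywhere
    ([cluster_induction]); the inequality of the means then telescopes the steps to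
    a finite sum ([finite_length], [KL_finite_length]). With exponent [lambda] also
    [s_(n+1)^lambda <= C (a_(n+1) + a_n)], so
    [s_(n+2)^(2 lambda) <= C (s_n - s_(n+2))] ([KL_gap_recursion]). This forces
    finite termination, geometric decay or the decay [n^(-1/(2 lambda - 1))],
    according to [lambda], and the tails of the sum of the steps, hence the
    distances to the limit, are controlled by a power of [s_n] ([KL_tail_le]).

    The ranges of [lambda] separate the three alternatives, except for (i) and (ii)
    when [lambda = 0]. Exponent [0] would keep the subgradients away from [0] at the
    slightly larger values near a critical point; but moving [x] by [t e] and [u] by
    [- K t e], with [e] a unit vector and [K] large, raises [L] by at least [t^2]
    with a subgradient of order [t] ([exponent0_absurd]). *)

Set Implicit Arguments.
Unset Strict Implicit.
Unset Printing Implicit Defensive.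

Import Order.TTheory GRing.Theory Num.Def Num.Theory.
Import numFieldNormedType.Exports.

Local Open Scope classical_set_scope.
Local Open Scope ring_scope.

(** * Real inner products *)

(** The order of the summands puts the increment [a - b] last, which is the shape
    that the quadratic expansions around [b - c] use. *)
Lemma subr_split (V : zmodType) (a b c : V) : a - c = (b - c) + (a - b).
Proof. by rewrite [RHS]addrC addrA subrK. Qed.

Section InnerProduct.
Context {R : realType} {H : normedModType R} {ip : {dot H for idfun}}.
Hypothesis ip_norm : forall x, ip x x = `|x| ^+ 2.
Implicit Types (a b u v w : H) (c : R).

Lemma ipC u v : ip u v = ip v u.
Proof. by rewrite hermC expr0 mul1r. Qed.

Lemma ipDl u v w : ip (u + v) w = ip u w + ip v w.
Proof. exact: linearDl. Qed.

Lemma ipDr u v w : ip u (v + w) = ip u v + ip u w.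
Proof. by rewrite ipC ipDl !(ipC _ u). Qed.

Lemma ipZl c u v : ip (c *: u) v = c * ip u v.
Proof. exact: linearZl_LR. Qed.

Lemma ipZr c u v : ip u (c *: v) = c * ip u v.
Proof. by rewrite ipC ipZl (ipC v). Qed.

Lemma ipNl u v : ip (- u) v = - ip u v.
Proof. by rewrite -scaleN1r ipZl mulN1r. Qed.

Lemma ipNr u v : ip u (- v) = - ip u v.
Proof. by rewrite ipC ipNl ipC. Qed.

Lemma ip0l u : ip 0 u = 0.
Proof. by rewrite -(scale0r 0) ipZl mul0r. Qed.

Lemma ip0r u : ip u 0 = 0.
Proof. by rewrite ipC ip0l. Qed.

Definition ipE := (ipDl, ipDr, ipNl, ipNr, ipZl, ipZr).

Lemma ip_ge0 u : 0 <= ip u u.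
Proof. by rewrite ip_norm sqr_ge0. Qed.

(** Vector identities are proved by testing them against every [w], which turns
    them into identities between real numbers. *)
Lemma ip_ext u v : (forall w, ip u w = ip v w) -> u = v.
Proof.
move=> uv; apply/eqP; rewrite -subr_eq0 -normr_eq0 -sqrf_eq0 -ip_norm.
by rewrite ipDl ipNl uv subrr.
Qed.

Lemma ipnormE u : ipnorm ip u = `|u|.
Proof. by rewrite /ipnorm ip_norm sqrtr_sqr normr_id. Qed.

Lemma sqr_normD u v : `|u + v| ^+ 2 = `|u| ^+ 2 + 2 * ip u v + `|v| ^+ 2.
Proof. by rewrite -!ip_norm !ipE (ipC v u); ring. Qed.

Lemma normr_ip_le u v : `|ip u v| <= `|u| * `|v|.
Proof.
have [->|v0] := eqVneq v 0; first by rewrite ip0r normr0 normr0 mulr0.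
have nv : 0 < `|v| by rewrite normr_gt0.
suff : ip u v ^+ 2 <= (`|u| * `|v|) ^+ 2.
  by move=> h; rewrite -(@ler_pXn2r _ 2) ?nnegrE ?mulr_ge0// real_normK ?num_real.
have := ip_ge0 (`|v| ^+ 2 *: u - ip u v *: v).
rewrite !ipE (ipC v u) !ip_norm -(pmulr_rge0 _ (exprn_gt0 2 nv)) => h.
have v2 : 0 < `|v| ^+ 2 by rewrite exprn_gt0.
have v4 : 0 < `|v| ^+ 2 * `|v| ^+ 2 by rewrite mulr_gt0.
rewrite -subr_ge0 -(pmulr_rge0 _ v4); apply: le_trans h _.
by rewrite le_eqVlt; apply/orP; left; apply/eqP; ring.
Qed.

Lemma ip_le u v : ip u v <= `|u| * `|v|.
Proof. exact: le_trans (ler_norm _) (normr_ip_le u v). Qed.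

(** Polarization reduces the continuity of the inner product to that of the norm. *)
Lemma cvg_ip (T : Type) (F : set_system T) (FF : Filter F) (s t : T -> H) u v :
  s @ F --> u -> t @ F --> v -> ip (s x) (t x) @[x --> F] --> ip u v.
Proof.
move=> su tv; have polar a b : ip a b = 4^-1 * (`|a + b| ^+ 2 - `|a - b| ^+ 2).
  by rewrite -!ip_norm !ipE (ipC b a); field.
rewrite polar; under eq_fun do rewrite polar.
apply: cvgM; first exact: cvg_cst.
apply: cvgB; (rewrite expr2; under eq_fun do rewrite expr2).
  by apply: cvgM; apply: cvg_norm; apply: cvgD.
by apply: cvgM; apply: cvg_norm; apply: cvgB.
Qed.

End InnerProduct.

(** * Gradients *)

Section Gradient.
Context {R : realType} {H : normedModType R} {ip : {dot H for idfun}}.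
Hypothesis ip_norm : forall x, ip x x = `|x| ^+ 2.
Variables (f : H -> R) (df : H -> H) (f_grad : is_gradient ip f df).
Implicit Types (x y v : H).

Lemma gradient_diff_quotient x v :
  h^-1 * (f (x + h *: v) - f x) @[h --> 0^'] --> ip (df x) v.
Proof.
have [dfx dv] := f_grad x; rewrite -dv -deriveE //.
have /cvg_ex[l hl] := @diff_derivable _ _ _ f x v dfx.
suff -> : (fun h : R => h^-1 * (f (x + h *: v) - f x)) =
  (fun h => h^-1 *: ((f \o shift x) (h *: v) - f x)) by exact: cvgP hl.
apply/funext => h /=; congr (_ * (f _ - _)); exact: addrC.
Qed.

Lemma is_derive_line x v (t : R) :
  is_derive t 1 (fun s => f (x + s *: v)) (ip (df (x + t *: v)) v).
Proof.
have [dfx dv] := f_grad (x + t *: v).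
have E : (fun h : R => h^-1 *: (((fun s => f (x + s *: v)) \o shift t) (h *: 1)
     - f (x + t *: v))) =
  (fun h => h^-1 *: ((f \o shift (x + t *: v)) (h *: v) - f (x + t *: v))).
  apply/funext => h /=; congr (_ *: (f _ - _)).
  by rewrite [h *: 1]mulr1 scalerDl addrCA.
apply: DeriveDef.
  by rewrite /derivable E; exact: diff_derivable.
by rewrite /derive E -dv -deriveE.
Qed.

End Gradient.

Section DescentLemma.
Context {R : realType}.

(** The mean value theorem for [psi] minus the parabola [dpsi 0 * t + k / 2 * t^2]. *)
Lemma derive_increment_le (psi dpsi : R -> R) (k : R) :
  (forall t : R, is_derive t (1 : R) psi (dpsi t)) ->
  (forall t : R, 0 < t < 1 -> dpsi t - dpsi 0 <= k * t) ->
  psi 1 - psi 0 - dpsi 0 <= k / 2.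
Proof.
move=> psiD dpsi_le.
pose chi t := psi t - (dpsi 0 * t + k / 2 * t ^+ 2).
have chiD (t : R) : is_derive t (1 : R) chi (dpsi t - (dpsi 0 + k * t)).
  rewrite /chi; apply: is_deriveB; apply: is_deriveD.
    by apply: is_derive_eq; rewrite scaler1.
  by apply: is_derive_eq; rewrite /GRing.scale/= !mulr1; field.
have chi_der (t : R) : t \in `[0, 1] -> derivable chi t 1.
  by move=> _; case: (chiD t).
have [c c01 /eqP] := MVT (@ltr01 R) (fun t _ => chiD t)
  (derivable_within_continuous chi_der).
rewrite subr0 mulr1 => /eqP E.
have := dpsi_le c; rewrite in_itv /= in c01; rewrite c01 => /(_ isT).
have -> : psi 1 - psi 0 - dpsi 0 = chi 1 - chi 0 + k / 2 by rewrite /chi; ring.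
by rewrite E; lra.
Qed.

Context {H : normedModType R} {ip : {dot H for idfun}}.
Hypothesis ip_norm : forall x, ip x x = `|x| ^+ 2.

Lemma lipschitzE (k : R) (G : H -> H) : k.-lipschitz G ->
  forall x y, `|G x - G y| <= k * `|x - y|.
Proof. by move=> kG x y; exact: (kG (x, y)). Qed.

Lemma lipschitz_continuous (k : R) (G : H -> H) : 0 <= k -> k.-lipschitz G -> continuous G.
Proof.
move=> k0 /lipschitzE G_lip p; apply/cvgrPdist_lt => e e0.
have k1 : 0 < k + 1 by rewrite ltr_wpDl.
near=> q; apply: le_lt_trans (G_lip p q) _.
apply: (@le_lt_trans _ _ ((k + 1) * `|p - q|)); first by rewrite ler_wpM2r // lerDl.
rewrite -ltr_pdivlMl // mulrC; near: q; apply: cvgr_dist_lt => //.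
by rewrite divr_gt0.
Unshelve. all: by end_near. Qed.

(** The one-dimensional estimate applies to [f] and to [- f] along the segment from
    [x] to [y], where the Lipschitz bound is linear in the parameter. *)
Lemma lipschitz_gradient_taylor (k : R) (f : H -> R) (df : H -> H) :
  is_gradient ip f df -> k.-lipschitz df ->
  forall x y, `|f y - f x - ip (df x) (y - x)| <= k / 2 * `|y - x| ^+ 2.
Proof.
move=> f_grad /lipschitzE df_lip x y; set v := y - x.
have bound (t : R) : 0 < t < 1 ->
    `|ip (df (x + t *: v)) v - ip (df (x + 0 *: v)) v| <= k * `|v| ^+ 2 * t.
  move=> /andP[t0 _]; rewrite -ipNl -ipDl.
  apply: le_trans (normr_ip_le ip_norm _ _) _.
  have := df_lip (x + t *: v) (x + 0 *: v).
  rewrite scale0r addr0 addrAC subrr add0r normrZ (gtr0_norm t0) => h.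
  have := ler_wpM2r (normr_ge0 v) h; nra.
have yE : y = x + 1 *: v by rewrite scale1r addrC subrK.
have xE : x = x + 0 *: v by rewrite scale0r addr0.
have D t := is_derive_line f_grad x v t.
rewrite {1}yE {2}xE {3}xE -mulrAC ler_norml; apply/andP; split; last first.
  apply: derive_increment_le D _ => t t01.
  exact: le_trans (ler_norm _) (bound t t01).
rewrite lerNl.
have := @derive_increment_le _ _ (k * `|v| ^+ 2) (fun t => is_deriveN (D t)).
rewrite /= !opprD !opprK; apply => t t01.
by have := bound t t01; rewrite ler_norml => /andP[]; lra.
Qed.

End DescentLemma.

(** * Convexity and proximal points *)

Section RightLimit.
Context {R : realType}.

(** One-sided information near [0] suffices, since the limit at [0] is also the
    limit from the right. *)
Lemma limit_le_at0 (q : R -> R) (l m c : R) : q h @[h --> 0^'] --> l ->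
  (forall h : R, 0 < h < 1 -> q h <= m + c * h) -> l <= m.
Proof.
move=> ql q_le.
have qr : q h @[h --> 0^'+] --> l by exact: cvg_dnbhs_at_right.
have mr : m + c * h @[h --> 0^'+] --> m.
  rewrite -[X in _ --> X]addr0 -[X in _ + X](mulr0 c).
  apply: cvgD; first exact: cvg_cst.
  apply: cvgM; first exact: cvg_cst.
  exact: cvg_at_right_filter (@cvg_id _ _).
apply: ler_cvg_to qr mr _.
near=> h; apply: q_le; apply/andP; split; near: h.
  exact: nbhs_right_gt.
exact: nbhs_right_lt.
Unshelve. all: by end_near. Qed.

End RightLimit.

Section Concavity.
Context {R : realType}.

(** The tangent of a concave function lies above its graph; at [t = 0], where [phi]
    need not be differentiable, only the tangent at [s] is used. *)
Lemma concave_derive_le (delta : \bar R) (phi : R -> R) :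
  desingularizing delta phi -> forall t s : R, 0 <= t -> t < s -> (s%:E < delta)%E ->
  derive1 phi s * (s - t) <= phi s - phi t.
Proof.
move=> [_ _ phi_conv _ phi_der] t s t0 ts sdelta.
have s0 := le_lt_trans t0 ts.
have [phi_s _ _] := phi_der s s0 sdelta.
have phi_diff : differentiable phi s by apply/derivable1_diffP.
have Dphi : 'D_(t - s) phi s = (t - s) * derive1 phi s.
  rewrite derive1E !deriveE // -[in LHS](mulr1 (t - s)).
  by rewrite -[_ * 1]/((t - s) *: (1 : R^o)) linearZ.
suff : - 'D_(t - s) phi s <= phi s - phi t by rewrite Dphi; lra.
have /cvg_ex[d dlim] := @diff_derivable _ _ _ phi s (t - s) phi_diff.
rewrite /derive (cvg_lim _ dlim) //.
apply: (@limit_le_at0 _ _ _ _ 0 (cvgN dlim)) => h /andP[h0 h1].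
have D_s : s \in [set t : R | 0 <= t /\ (t%:E < delta)%E].
  by rewrite inE; split => //; exact: ltW.
have D_t : t \in [set t : R | 0 <= t /\ (t%:E < delta)%E].
  by rewrite inE; split => //; apply: lt_trans sdelta; rewrite lte_fin.
have := phi_conv (Itv01 (ltW h0) (ltW h1)) t s D_t D_s.
rewrite !convRE /= /unstable.onem.
set c := conv _ _ _.
have -> : c = h * (t - s) + s by transitivity (h * t + (1 - h) * s); [|ring].
by rewrite mul0r addr0 /GRing.scale /= -mulrN ler_pdivrMl //; lra.
Qed.

End Concavity.

Section Convexity.
Context {R : realType}.
Context {H : normedModType R} {ip : {dot H for idfun}}.
Hypothesis ip_norm : forall x, ip x x = `|x| ^+ 2.
Variables (f : H -> R) (df : H -> H) (f_grad : is_gradient ip f df).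

(** The convexity inequality between [x] and [x + h *: v], divided by [h], in the
    limit [h -> 0]. *)
Lemma alpha_convex_gradient alpha : alpha_convex alpha (EFin \o f) ->
  forall x y, f x + ip (df x) (y - x) + alpha / 2 * `|y - x| ^+ 2 <= f y.
Proof.
move=> f_conv x y; set v := y - x.
suff : ip (df x) v <= f y - f x - alpha / 2 * `|v| ^+ 2 by lra.
apply: (@limit_le_at0 _ _ _ _ (alpha / 2 * `|v| ^+ 2)
  (@gradient_diff_quotient _ _ ip f df f_grad x v)).
move=> h /andP[h0 h1].
have := f_conv x y h (ltry _) (ltry _); rewrite h0 h1 => /(_ isT).
have -> : (1 - h) *: x + h *: y = x + h *: v.
  by rewrite scalerBl scale1r scalerBr addrAC addrA.
rewrite /= distrC -/v -!EFinM -!EFinD lee_fin => le_h.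
rewrite ler_pdivrMl //; nra.
Qed.

Lemma alpha_convex_monotone alpha : alpha_convex alpha (EFin \o f) ->
  forall x y, alpha * `|y - x| ^+ 2 <= ip (df y - df x) (y - x).
Proof.
move=> f_conv x y.
have := alpha_convex_gradient f_conv x y.
have := alpha_convex_gradient f_conv y x.
by rewrite distrC -(opprB y x) !ipE; lra.
Qed.

(** First-order optimality along every direction [v] gives an inequality between
    linear forms; it is tested on the difference of the two sides. *)
Lemma prox_gradient gamma z x : 0 < gamma -> prox gamma (EFin \o f) z x ->
  df x = gamma^-1 *: (z - x).
Proof.
move=> gamma0 xprox.
have le_v v : - ip (df x) v <= gamma^-1 * ip (x - z) v.
  apply: (@limit_le_at0 _ (fun h => - (h^-1 * (f (x + h *: v) - f x))) _ _
    ((2 * gamma)^-1 * `|v| ^+ 2)).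
    exact: cvgN (@gradient_diff_quotient _ _ ip f df f_grad x v).
  move=> h /andP[h0 h1].
  have := xprox (x + h *: v); rewrite /= -!EFinD lee_fin.
  rewrite [x + _ - z]addrAC (sqr_normD ip_norm (x - z)) ipZr normrZ exprMn real_normK ?num_real //.
  rewrite -mulrN ler_pdivrMl // invfM.
  have -> : gamma^-1 = 2 * (2^-1 * gamma^-1) by field; rewrite gt_eqF.
  by set g1 := 2^-1 * gamma^-1; lra.
apply/eqP; rewrite -subr_eq0 -normr_eq0 -sqrf_eq0 eq_le sqr_ge0 andbT -ip_norm.
have := le_v (gamma^-1 *: (z - x) - df x).
rewrite !ipE; rewrite !(ipC (df x)) !(ipC x z); lra.
Qed.

End Convexity.

(** * Compactness *)

Section CompactInduction.
Context {T : topologicalType}.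

(** An alternative to finite subcovers: the sets [A] with [Q (K `\` A)] form a
    filter, proper if [Q K] fails, and it would have a cluster point in [K], where
    [Q] holds locally. *)
Lemma compact_induction (K : set T) (Q : set T -> Prop) : compact K ->
  Q set0 -> (forall A B, A `<=` B -> Q B -> Q A) ->
  (forall A B, Q A -> Q B -> Q (A `|` B)) ->
  (forall p, K p -> exists2 U, nbhs p U & Q U) -> Q K.
Proof.
move=> Kcomp Q0 Qsub QU Qloc; apply: contrapT => nQK.
pose F : set_system T := fun A => Q (K `\` A).
have FF : ProperFilter F.
  split; first by rewrite /F setD0.
  split; first by rewrite /F setDT.
    by move=> A B QA QB; rewrite /F setDIr; exact: QU.
  by move=> A B AB; apply: Qsub; exact: setDS.
have FK : F K by rewrite /F setDv.
have [p [Kp clp]] := Kcomp F FF FK.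
have [U pU QU'] := Qloc p Kp.
have FU : F (~` U).
  by apply: Qsub QU' => x [_] /=; exact: contrapT.
by have [x []] := clp _ _ FU pU.
Qed.

End CompactInduction.

Section FiniteDimension.
Context {R : realType} {H : normedVectType R} {ip : {dot H for idfun}}.
Hypothesis ip_norm : forall x, ip x x = `|x| ^+ 2.

Lemma linear_rV_continuous n (S : {linear 'rV[R]_n -> H}) : continuous S.
Proof.
suff -> : (S : _ -> H) = \sum_(j < n) (fun c : 'rV[R]_n => c ord0 j *: S (delta_mx ord0 j)).
  elim/big_ind : _ => [|a b ha hb c|j _ c].
  - exact: (@cst_continuous _ _ (0 : H)).
  - exact: cvgD (ha c) (hb c).
  - exact: (cvgZr_tmp (@coord_continuous R 1 n ord0 j c)).
apply/funext => c; rewrite fct_sumE {1}(row_sum_delta c) linear_sum.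
by apply: eq_bigr => j _; rewrite linearZ.
Qed.

Lemma closed_ball0_closed (M : R) : closed [set x : H | `|x| <= M].
Proof.
apply: (@closed_comp _ _ (fun x : H => `|x|) [set r | r <= M]) => //.
by move=> x _; exact: norm_continuous.
Qed.

(** The inner products with the vectors of a basis embed [H] linearly in a space of
    row vectors and send the ball into a box; the ball is a closed subset of the image
    of this box under a linear left inverse. *)
Lemma compact_closed_ball0 (M : R) : compact [set x : H | `|x| <= M].
Proof.
pose X := vbasis {:H}.
pose G (x : H) : 'rV[R]_(\dim {:H}) := \row_j ip x X`_j.
have G_lin : linear G.
  by move=> c u v; apply/rowP => j; rewrite !mxE ipDl ipZl.
pose GL : {linear H -> 'rV[R]_(\dim {:H})} :=
  HB.pack G (GRing.isLinear.Build _ _ _ _ G G_lin).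
pose g := linfun GL.
have gE x : g x = G x by rewrite lfunE.
have g_inj : lker g == 0%VS.
  apply/eqP/vspaceP => x; rewrite memv0 memv_ker gE; apply/eqP/eqP => [Gx0|->].
    suff : ip x x = 0 by rewrite ip_norm => /eqP; rewrite sqrf_eq0 normr_eq0 => /eqP.
    rewrite {2}(coord_vbasis (memvf x)).
    elim/big_ind : _ => [|a b ha hb|j _]; first exact: ip0r.
      by rewrite ipDr ha hb addr0.
    by rewrite ipZr; have /rowP/(_ j) := Gx0; rewrite !mxE => ->; rewrite mulr0.
  by apply/rowP => j; rewrite !mxE ip0l.
pose B := [set c : 'rV[R]_(\dim {:H}) |
  forall j, c ord0 j \in `[- (M * `|X`_j|), M * `|X`_j|]].
have Bcomp : compact B.
  apply: (@rV_compact _ _ (fun j => `[- (M * `|X`_j|), M * `|X`_j|]%classic)).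
  by move=> j; exact: segment_compact.
have ginv_cont : continuous ((g^-1)%VF : 'rV[R]_(\dim {:H}) -> H).
  exact: linear_rV_continuous.
have imB := continuous_compact (continuous_subspaceT ginv_cont) Bcomp.
apply: (subclosed_compact (@closed_ball0_closed M) imB).
move=> x /= xM; exists (g x); last by rewrite lker0_lfunK.
move=> j; rewrite gE mxE in_itv /= -ler_norml.
by apply: le_trans (normr_ip_le ip_norm _ _) _; rewrite ler_wpM2r.
Qed.

End FiniteDimension.

(** * Proximal subgradients *)

Section Subgradients.
Context {R : realType} {E : normedModType R} (ip : E -> E -> R).

Lemma regular_limiting_subdiff (f : E -> \bar R) x u :
  regular_subdiff ip f x u -> limiting_subdiff ip f x u.
Proof.
move=> fxu; split; first by case: fxu.
by exists (fun=> x), (fun=> u); split => //; exact: cvg_cst.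
Qed.

(** The quadratic error is negligible against [ipnorm ip (y - x)]. The constant [K]
    lets the neighborhoods be those of a norm other than [ipnorm ip], as on a product. *)
Lemma proximal_regular_subdiff (K C : R) (f : E -> \bar R) (x u : E) (a : R) :
  0 <= K -> 0 <= C -> (forall v, ipnorm ip v <= K * `|v|) -> f x = a%:E ->
  (forall y, (a + ip u (y - x) - C * ipnorm ip (y - x) ^+ 2)%:E <= f y)%E ->
  regular_subdiff ip f x u.
Proof.
move=> K0 C0 ipK fxa le_f; split; first by rewrite fxa ltry.
rewrite limf_einfE; apply/lee_addgt0Pr => e e0.
set S := ereal_sup _; suff : ((- e)%:E <= S)%E.
  by move=> /(leeD2r e%:E); rewrite -EFinD addNr.
pose d := e / (C * K + 1).
have CK1 : 0 < C * K + 1 by rewrite ltr_wpDl // mulr_ge0.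
have d0 : 0 < d by rewrite divr_gt0.
pose V := ball x d `\ x.
apply: le_ereal_sup_tmp; eexists.
  by exists V; [exact: dnbhs_ball | reflexivity].
apply: le_ereal_inf_tmp => _ [y [xy _] <-].
set r := ipnorm ip (y - x).
have r0 : 0 <= r by exact: sqrtr_ge0.
have rK : r <= K * d.
  apply: le_trans (ipK _) _; rewrite ler_wpM2l // ltW //.
  by move: xy; rewrite -ball_normE /= distrC.
have Cr : C * r <= e.
  apply: (@le_trans _ _ (C * (K * d))); first by rewrite ler_wpM2l.
  rewrite mulrA /d mulrA ler_pdivrMr //; nra.
have rV : 0 <= r^-1 by rewrite invr_ge0.
have [r00|rn0] := eqVneq r 0; first by rewrite r00 invr0 mule0 lee_fin; lra.
apply: (@le_trans _ _ ((- (C * r ^+ 2))%:E * r^-1%:E)%E); last first.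
  apply: lee_wpmul2r; first by rewrite lee_fin.
  have := le_f y; rewrite fxa; case: (f y) => [b| |] //=.
    by rewrite -!EFinD !lee_fin -/r; lra.
  by rewrite !addye // !leey.
rewrite -EFinM lee_fin expr2 mulNr -!mulrA mulfV // mulr1; lra.
Qed.

End Subgradients.

(** * Recursive inequalities for real sequences *)

Section Sequences.
Context {R : realType}.
Implicit Types (a b s e r : nat -> R).

(** The inequality of arithmetic and geometric means turns the hypothesis into
    [a k.+1 <= (a k.+1 + a k) / 4 + (b k.+1 - b k.+2)]; summation absorbs the first
    term on the right and telescopes the second one. *)
Lemma finite_length a b (n : nat) : (forall k, 0 <= a k) ->
  (forall k, (n <= k)%N -> b k.+2 <= b k.+1) ->
  (forall k, (n <= k)%N ->
     a k.+1 ^+ 2 <= (b k.+1 - b k.+2) * (a k.+1 + a k)) ->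
  forall m, \sum_(k < m) a (n.+1 + k)%N <=
    (a n - a (n + m)%N) / 2 + 2 * (b n.+1 - b (n.+1 + m)%N).
Proof.
move=> a0 b_noninc a_le; elim=> [|m IH].
  by rewrite big_ord0 !addn0; lra.
rewrite big_ord_recr /= !addSn !addnS.
have nm : (n <= n + m)%N by rewrite leq_addr.
have := a_le _ nm; have := b_noninc _ nm; have := a0 (n + m)%N.
have := a0 (n + m).+1; move: IH; rewrite addSn.
set A := a (n + m)%N; set A' := a (n + m).+1.
set B := b (n + m).+1; set B' := b (n + m).+2.
move=> IH A'0 A0 BB' sq_le.
suff : A' <= (A' + A) / 4 + (B - B') by move=> ?; lra.
rewrite -(@ler_pXn2r _ 2) ?nnegrE //; last lra.
apply: le_trans sq_le _.
have := sqr_ge0 ((A' + A) / 4 - (B - B')); lra.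
Qed.

(** Solving for [s n.+2] gives the factor [C / (1 + C)] every two steps; [rho] is its
    square root. *)
Lemma linear_decay s (C : R) (N : nat) : 0 < C ->
  (forall n, 0 <= s n) -> (forall n, s n.+1 <= s n) ->
  (forall n, (N <= n)%N -> s n.+2 <= C * (s n - s n.+2)) ->
  exists G rho : R, [/\ 0 < G, 0 < rho < 1 &
    forall n, (N <= n)%N -> s n <= G * rho ^+ n].
Proof.
move=> C0 s0 s_noninc s_le.
pose q := C / (1 + C).
have q01 : 0 < q < 1 by rewrite divr_gt0 ?addr_gt0 //= ltr_pdivrMr ?addr_gt0 //; lra.
move: (q01) => /andP[q0 q1].
pose rho := Num.sqrt q.
have rho0 : 0 < rho by rewrite sqrtr_gt0.
have rho2 : rho ^+ 2 = q by rewrite sqr_sqrtr // ltW.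
have rho1 : rho < 1 by rewrite -(@ltr_pXn2r _ 2) ?nnegrE ?ltW // rho2 expr1n.
have stepq n : (N <= n)%N -> s n.+2 <= q * s n.
  by move=> /s_le h; rewrite /q mulrAC ler_pdivlMr ?addr_gt0 //; lra.
pose G := (s N + 1) / rho ^+ N.+1.
have G0 : 0 < G by rewrite divr_gt0 ?exprn_gt0 // ltr_wpDl.
have GN : s N <= G * rho ^+ N.+1.
  by rewrite divfK ?lerDl // expf_neq0 // gt_eqF.
exists G, rho; split; rewrite ?rho0 //.
suff two m : s (N + m)%N <= G * rho ^+ (N + m) /\
             s (N + m).+1 <= G * rho ^+ (N + m).+1.
  by move=> n /subnKC <-; case: (two (n - N)%N).
elim: m => [|m [IH1 IH2]].
  rewrite addn0; split; last exact: le_trans GN.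
  apply: le_trans GN _; rewrite ler_pM2l // exprS ler_piMl ?exprn_ge0 ?ltW //.
rewrite !addnS; split => //.
apply: le_trans (stepq _ (leq_addr _ _)) _.
by rewrite -addn2 exprD rho2 mulrA mulrC ler_pM2r.
Qed.

(** A discrete form of [dt <= - t^(1 + tau) / C], along which [t^(- tau)] grows at a
    constant rate. If [t' >= t / 2], the bound [r^(- tau) >= 1 + tau (1 - r)] for the
    ratio [r = t' / t] gives the growth; otherwise [t^(- tau)] is multiplied by at
    least [2^tau]. *)
Lemma powR_decay_step (t t' C tau : R) : 0 < C -> 0 < tau -> 0 < t' -> t' <= t ->
  t <= 1 -> t' `^ (1 + tau) <= C * (t - t') ->
  t `^ (- tau) + Num.min (tau / C * 2^-1 `^ (1 + tau)) (2 `^ tau - 1) <= t' `^ (- tau).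
Proof.
move=> C0 tau0 t'0 tt' t1 le_t'.
have t0 : 0 < t := lt_le_trans t'0 tt'.
pose r := t' / t.
have r0 : 0 < r by rewrite divr_gt0.
have r1 : r <= 1 by rewrite ler_pdivrMr // mul1r.
have t'E : t' = r * t by rewrite divfK // gt_eqF.
have ttau : 1 <= t `^ (- tau).
  by rewrite -(powRr0 t); apply: ger_powR; [rewrite t0|lra].
rewrite t'E (powRM _ (ltW r0) (ltW t0)).
have rtau : 1 + tau * (1 - r) <= r `^ (- tau).
  rewrite /powR gt_eqF // mulNr.
  apply: le_trans (expR_ge1Dx _); rewrite lerD2l -mulrN ler_pM2l //.
  by have := le_ln1Dx (x := r - 1); rewrite subrKC; lra.
have /orP[r2|r2] := le_total 2^-1 r.
  apply: (@le_trans _ _ (t `^ (- tau) + tau / C * 2^-1 `^ (1 + tau))).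
    by rewrite lerD2l ge_min lexx.
  have hr : r `^ (1 + tau) * t `^ tau <= C * (1 - r).
    move: le_t'; rewrite t'E (powRM _ (ltW r0) (ltW t0)) (@powRD _ t 1); last first.
      by rewrite (gt_eqF t0) implybT.
    rewrite (powRr1 (ltW t0)) => h; rewrite -(ler_pM2l t0); lra.
  have : 2^-1 `^ (1 + tau) <= r `^ (1 + tau).
    by apply: ge0_ler_powR; rewrite ?nnegrE //; lra.
  move=> h2.
  have : t `^ (- tau) * t `^ tau = 1 by rewrite -powRD ?addNr ?powRr0 // (gt_eqF t0) implybT.
  move: hr h2 ttau rtau; set p := r `^ (1 + tau); set h := 2^-1 `^ (1 + tau).
  set T := t `^ (- tau); set T' := t `^ tau; set q := r `^ (- tau).
  move=> hr h2 ttau rtau TT'.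
  have : p <= C * (1 - r) * T.
    have T_ge0 : 0 <= T by lra.
    have pE : p = p * T' * T by rewrite -[LHS]mulr1 -TT'; ring.
    by rewrite pE ler_wpM2r.
  move=> hp.
  have hh : tau / C * h <= tau * (1 - r) * T.
    rewrite mulrAC ler_pdivrMr //.
    by apply: (@le_trans _ _ (tau * p)); [rewrite ler_pM2l|rewrite -!mulrA ler_pM2l //; lra].
  have := ler_wpM2r (le_trans ler01 ttau) rtau; lra.
apply: (@le_trans _ _ (t `^ (- tau) + (2 `^ tau - 1))).
  by rewrite lerD2l ge_min lexx orbT.
have h2 : 2 `^ tau <= r `^ (- tau).
  rewrite -mulN1r powRrM (powR_inv1 (ltW r0)).
  apply: ge0_ler_powR; rewrite ?nnegrE ?invr_ge0 //; try lra.
  by rewrite -[leLHS]invrK lef_pV2 ?posrE ?invr_gt0.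
have : (2 : R) `^ 0 <= 2 `^ tau by apply: ler_powR; lra.
rewrite powRr0 => h3.
nra.
Qed.

(** The powers [s^(- tau)] gain at least [mu] every two steps, hence grow at least
    linearly as long as [s] is positive. *)
Lemma sublinear_decay s (C tau : R) (N : nat) : 0 < C -> 0 < tau ->
  (forall n, 0 <= s n) -> (forall n, s n.+1 <= s n) ->
  (forall n, (N <= n)%N -> s n <= 1) ->
  (forall n, (N <= n)%N -> s n.+2 `^ (1 + tau) <= C * (s n - s n.+2)) ->
  exists (G : R) (N' : nat), [/\ 0 < G &
    forall n, (N' <= n)%N -> (0 < n)%N -> s n <= G * n%:R `^ (- tau^-1)].
Proof.
move=> C0 tau0 s0 s_noninc s1 s_le.
pose mu : R := Num.min (tau / C * 2^-1 `^ (1 + tau)) (2 `^ tau - 1).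
have mu0 : 0 < mu.
  rewrite lt_min mulr_gt0 ?divr_gt0 ?powR_gt0 ?invr_gt0 //= subr_gt0.
  by rewrite /powR gt_eqF // expR_gt1 mulr_gt0 // ln_gt0 // ltr1n.
have two m : 0 < s (N + m.*2)%N -> m%:R * mu <= s (N + m.*2)%N `^ (- tau).
  elim: m => [|m IH]; first by rewrite mul0r powR_ge0.
  rewrite doubleS !addnS => s'0.
  have ss' : s (N + m.*2).+2 <= s (N + m.*2)%N by exact: le_trans (s_noninc _).
  have Nm : (N <= N + m.*2)%N by rewrite leq_addr.
  have := powR_decay_step C0 tau0 s'0 ss' (s1 _ Nm) (s_le _ Nm).
  have := IH (lt_le_trans s'0 ss').
  rewrite -/mu -natr1; lra.
have s_anti k n : (k <= n)%N -> s n <= s k.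
  by move=> /subnKC <-; elim: (n - k)%N => [|i IHi]; rewrite ?addn0 ?addnS //; exact: le_trans IHi.
exists ((mu / 4) `^ (- tau^-1)), N.*2.+2; split; first by rewrite powR_gt0 // divr_gt0.
move=> n Nn n0; rewrite -powRM ?ler0n //; last by rewrite divr_ge0 // ltW.
pose m := (n - N)./2.
have mn : (N + m.*2 <= n)%N.
  by rewrite /m; have := odd_double_half (n - N); lia.
have nm4 : (n <= 4 * m)%N.
  by rewrite /m; have := odd_double_half (n - N); case: (odd _); lia.
apply: le_trans (s_anti _ _ mn) _.
have [s00|s_gt0] := leP (s (N + m.*2)%N) 0; first exact: le_trans s00 (powR_ge0 _ _).
have sE : s (N + m.*2)%N = (s (N + m.*2)%N `^ (- tau)) `^ (- tau^-1).
  by rewrite -powRrM mulrNN divff ?gt_eqF // powRr1 // ltW.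
rewrite sE !powRN lef_pV2 ?posrE ?powR_gt0 ?invr_gt0 //; last first.
  by rewrite mulr_gt0 ?ltr0n // divr_gt0.
  exact: powR_gt0.
apply: ge0_ler_powR; rewrite ?nnegrE ?invr_ge0 ?powR_ge0 //; first exact: ltW.
  by rewrite mulr_ge0 ?ler0n // divr_ge0 // ltW.
rewrite -powRN; apply: le_trans (two _ s_gt0).
have : n%:R <= 4 * m%:R :> R by rewrite -natrM ler_nat.
nra.
Qed.

(** The finitely many terms before [N] are absorbed in the constant. *)
Lemma rate_extend e r (G : R) (N : nat) : (forall n, (0 < n)%N -> 0 < r n) ->
  (forall n, (N <= n)%N -> (0 < n)%N -> e n <= G * r n) ->
  exists2 Gamma : R, 0 < Gamma & forall n, (0 < n)%N -> e n <= Gamma * r n.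
Proof.
move=> r0; elim: N => [|N IH] in G *.
  move=> h; exists (Num.max 1 G); first by rewrite lt_max ltr01.
  move=> n n0; apply: le_trans (h n _ n0) _ => //.
  by rewrite ler_pM2r ?r0 // le_max lexx orbT.
move=> h; apply: (IH (Num.max G (e N / r N))) => n.
rewrite leq_eqVlt => /predU1P[<- N0|Nn n0].
  by rewrite -ler_pdivrMr ?r0 // le_max lexx orbT.
apply: le_trans (h n Nn n0) _.
by rewrite ler_pM2r ?r0 // le_max lexx.
Qed.

End Sequences.

(** * Step sizes *)

Section StepSizes.
Context {R : realType} (alpha kappa l theta eta gamma : R).
Hypotheses (kappa_ge0 : 0 <= kappa) (l_ge0 : 0 <= l) (alpha_ge : - kappa <= alpha).
Hypotheses (gamma_gt0 : 0 < gamma) (theta_in : 0 < theta <= 1) (eta_gt0 : 0 < eta).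

Let P (t : R) := 2 * theta * kappa * (kappa + l) * t ^+ 2
  - lin_coef alpha l theta eta * t + (eta - 2).

(** The coefficient of [|x_(n+1) - x_n|^2] in the variation of the Lagrangian, in the
    form in which the separate estimates of [f], [hbar] and the proximal term produce
    it. *)
Definition descent_coef : R :=
  - (alpha / 2) + eta^-1 * gamma * kappa ^+ 2 + (eta^-1 - (theta * eta)^-1) * alpha
  + l / 2 + l * (`|eta^-1 - 1| + eta^-1 * gamma * kappa)
  + (2 * theta * gamma)^-1 - (theta * gamma * eta)^-1.

Let theta_gt0 : 0 < theta. Proof. by case/andP: theta_in. Qed.

Let kl_gt0 : 0 < kappa -> 0 < kappa + l.
Proof. by move: l_ge0 => ? ?; lra. Qed.

(** The roots of [P] are [gamma_low] and [gamma_up]. The last term, which comes from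
    the increment of the gradient of [hbar], vanishes if [l = 0] or [1 <= eta]. *)
Lemma descent_coefE : 2 * theta * gamma * eta * descent_coef =
  P gamma + l * theta * gamma * 2 * (`|1 - eta| - (eta - 1)).
Proof.
have -> : `|1 - eta| = eta * `|eta^-1 - 1|.
  rewrite -{2}(gtr0_norm eta_gt0) -normrM mulrBr mulr1 divff ?gt_eqF //.
rewrite /descent_coef /P /lin_coef.
field; rewrite ?gt_eqF //.
Qed.

(** With [A = theta kappa (kappa + l)], completing the square writes [P t] as
    [((4 A t - lin_coef)^2 - discr) / (8 A)]. *)
Lemma quadratic_lt0 (t : R) : 0 < kappa -> 
  gamma_low alpha kappa l theta eta < t < gamma_up alpha kappa l theta eta ->
  P t < 0.
Proof.
move=> kappa0; rewrite /gamma_low /gamma_up /P /discr.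
set B := lin_coef _ _ _ _; set D := B ^+ 2 - _.
set A := theta * kappa * (kappa + l).
have kl0 := kl_gt0 kappa0.
have A0 : 0 < A by rewrite !mulr_gt0.
have -> : 4 * theta * kappa * (kappa + l) = 4 * A by rewrite /A; ring.
rewrite ltr_pdivrMr ?ltr_pdivlMr ?mulr_gt0 // => /andP[lo up].
have s_gt0 : 0 < Num.sqrt D by lra.
have D0 : 0 < D by rewrite -sqrtr_gt0.
have DE : Num.sqrt D ^+ 2 = D by rewrite sqr_sqrtr // ltW.
have h : (4 * A * t - B) ^+ 2 < D by rewrite -DE; nra.
have -> : 2 * theta * kappa * (kappa + l) * t ^+ 2 - B * t + (eta - 2) =
   ((4 * A * t - B) ^+ 2 - D) / (8 * A).
  rewrite /D /A; field; rewrite !gt_eqF //.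
by rewrite pmulr_llt0 ?invr_gt0 ?mulr_gt0 // subr_lt0.
Qed.

(** For [eta < 2] the product of the roots of [P] is negative, so the lower root lies
    on the left of [gamma]. *)
Lemma condition_a_quadratic : condition_a alpha kappa l theta eta gamma ->
  [/\ 0 < kappa, 0 < eta < 2, l = 0 \/ 1 <= eta, P gamma < 0 &
      gamma_low alpha kappa l theta eta <= 0].
Proof.
case=> kappa0 eta_l0 eta_l /andP[_ gup].
have eta2 : 0 < eta < 2 /\ (l = 0 \/ 1 <= eta).
  have [l0|ln0] := eqVneq l 0; first by split; [exact: eta_l0|left].
  have /andP[e1 e2] : 1 <= eta < 2 by apply: eta_l; rewrite lt_neqAle eq_sym ln0.
  by split; [rewrite e2 andbT|right].
have [eta02 leta] := eta2; have /andP[_ eta_lt2] := eta02.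
have A0 : 0 < 4 * theta * kappa * (kappa + l).
  by rewrite !mulr_gt0 // kl_gt0.
have low : gamma_low alpha kappa l theta eta <= 0.
  rewrite /gamma_low ler_pdivrMr // mul0r subr_le0 /discr.
  set B := lin_coef _ _ _ _.
  apply: le_trans (ler_norm _) _; rewrite -sqrtr_sqr ler_wsqrtr // -subr_ge0.
  have : 0 <= (2 - eta) * (4 * theta * kappa * (kappa + l)).
    by rewrite mulr_ge0 // ?subr_ge0 ltW.
  by rewrite -(pmulr_rge0 _ (ltr0n R 2)); lra.
by split => //; apply: quadratic_lt0 => //; rewrite gup andbT; apply: le_lt_trans gamma_gt0.
Qed.

Lemma stepsize_descent :
  [\/ condition_a alpha kappa l theta eta gamma,
      condition_b alpha kappa l theta eta gamma
    | condition_c kappa l theta eta gamma] -> descent_coef < 0.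
Proof.
have M0 : 0 < 2 * theta * gamma * eta by rewrite !mulr_gt0.
case=> [/condition_a_quadratic[_ _ leta Pg _]|[kappa0 /andP[eta2 _] _ gin]|].
- rewrite -(pmulr_rlt0 _ M0) descent_coefE.
  case: leta => [l0|eta1]; first by rewrite [in X in _ + X]l0 !mul0r addr0.
  by rewrite ler0_norm ?subr_le0 // opprB subrr mulr0 addr0.
- rewrite -(pmulr_rlt0 _ M0) descent_coefE ler0_norm; last lra.
  by rewrite opprB subrr mulr0 addr0; exact: quadratic_lt0.
- case=> k0 /andP[_ eta2] _ c1 c2.
  have alpha0 : 0 <= alpha by move: alpha_ge; rewrite k0 oppr0.
  rewrite -(pmulr_rlt0 _ M0) descent_coefE /P /lin_coef k0 !(mulr0, mul0r) add0r.
  have h1 : 0 <= (eta * theta + 2 - 2 * theta) * alpha * gamma.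
    rewrite mulr_ge0 ?(ltW gamma_gt0) // mulr_ge0 //.
    by have /andP[_ t1] := theta_in; have := mulr_gt0 eta_gt0 theta_gt0; lra.
  have lg : 0 <= l * theta * gamma by rewrite !mulr_ge0 // ltW.
  have [e1|e1] := leP eta 1.
    rewrite ger0_norm ?subr_ge0 //.
    have lg1 : l * theta * gamma < 1.
      have := c1 e1; rewrite /div_or_oo; case: ifPn => [/eqP E _|n0].
        by rewrite [l * theta]mulrC E mul0r.
      rewrite lte_fin ltr_pdivlMr; first by lra.
      by rewrite lt_neqAle eq_sym n0 mulr_ge0 // ltW.
    nra.
  rewrite ltr0_norm ?subr_lt0 //.
  have := c2 e1; rewrite /div_or_oo; case: ifPn => [/eqP E _|n0].
    have : (3 * eta - 2) * theta * l * gamma = 0 by rewrite E mul0r.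
    lra.
  rewrite lte_fin ltr_pdivlMr; first by lra.
  by rewrite lt_neqAle eq_sym n0 !mulr_ge0 ?(ltW theta_gt0) //; lra.
Qed.

(** The point [t0 = 1 / (theta (kappa + l))] satisfies [0 <= P t0] as soon as
    [alpha <= kappa], hence does not lie between the roots of [P]. It lies on the right
    of the smaller root: that one is nonpositive if [eta < 2], and if [2 <= eta] the
    upper bound on [eta] makes the product of the roots smaller than [t0^2]. So it
    lies on the right of [gamma_up], and of [gamma]. *)
Lemma stepsize_bound :
  [\/ condition_a alpha kappa l theta eta gamma,
      condition_b alpha kappa l theta eta gamma
    | condition_c kappa l theta eta gamma] -> alpha <= kappa ->
  theta * gamma * (kappa + l) < 1.
Proof.
move=> params alpha_le.
have kl_ge0 : 0 <= kappa + l by rewrite addr_ge0.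
have /andP[_ theta1] := theta_in.
(* The interval between the roots of [P] lies on the left of [t0]. *)
have far : 0 < kappa -> l = 0 \/ 1 <= eta ->
    gamma < gamma_up alpha kappa l theta eta ->
    gamma_low alpha kappa l theta eta < (theta * (kappa + l))^-1 ->
    theta * gamma * (kappa + l) < 1.
  move=> kappa0 leta gup low; set t0 := (theta * (kappa + l))^-1 in low.
  have kl0 := kl_gt0 kappa0.
  have tkl0 : 0 < theta * (kappa + l) by rewrite mulr_gt0.
  have t00 : 0 < t0 by rewrite invr_gt0.
  rewrite mulrAC -ltr_pdivlMl // mulr1 -/t0 ltNge; apply/negP => t0gamma.
  have /quadratic_lt0 : gamma_low alpha kappa l theta eta < t0
      < gamma_up alpha kappa l theta eta by rewrite low (le_lt_trans t0gamma).
  move=> /(_ kappa0); apply/negP; rewrite -leNgt.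
  have -> : P t0 = t0 * ((eta * theta + 2 - 2 * theta) * (kappa - alpha)
      + 4 * ((eta - 1) * (theta * l))).
    by rewrite /P /lin_coef /t0; field; rewrite !gt_eqF.
  rewrite mulr_ge0 ?(ltW t00) // addr_ge0 //.
    rewrite mulr_ge0 ?subr_ge0 //.
    by have := mulr_gt0 eta_gt0 theta_gt0; lra.
  case: leta => [->|eta1]; first by rewrite !mulr0.
  by rewrite !mulr_ge0 // ?subr_ge0 // ltW.
case: params => [ca|cb|[k0 /andP[_ eta2] _ c1 c2]].
- have [kappa0 _ leta _ low] := condition_a_quadratic ca.
  case: ca => _ _ _ /andP[_ gup]; apply: far => //.
  by apply: le_lt_trans low _; rewrite invr_gt0 mulr_gt0 // kl_gt0.
- case: cb => kappa0 /andP[eta2 eta_up] _ /andP[glow gup].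
  apply: far => //; first by right; lra.
  have kl0 := kl_gt0 kappa0.
  rewrite ltNge; apply/negP => h.
  set t0 := (theta * (kappa + l))^-1 in h.
  have tkl0 : 0 < theta * (kappa + l) by rewrite mulr_gt0.
  have t00 : 0 < t0 by rewrite invr_gt0.
  have lowup := lt_trans glow gup.
  have prod : gamma_low alpha kappa l theta eta * gamma_up alpha kappa l theta eta
      = (eta - 2) / (2 * (theta * kappa * (kappa + l))).
    move: lowup; rewrite /gamma_low /gamma_up; set D := discr _ _ _ _ _.
    set B := lin_coef _ _ _ _; set A4 := 4 * theta * kappa * (kappa + l).
    have A40 : 0 < A4 by rewrite !mulr_gt0.
    rewrite ltr_pM2r ?invr_gt0 // => lowup.
    have s_gt0 : 0 < Num.sqrt D by lra.
    have DE : Num.sqrt D ^+ 2 = D by rewrite sqr_sqrtr // ltW // -sqrtr_gt0.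
    have -> : (B - Num.sqrt D) / A4 * ((B + Num.sqrt D) / A4) =
       (B ^+ 2 - Num.sqrt D ^+ 2) / (A4 ^+ 2) by field; rewrite gt_eqF.
    rewrite DE /D /discr -/B /A4; field; rewrite !gt_eqF //.
  have : t0 ^+ 2 < t0 ^+ 2; last by rewrite ltxx.
  apply: (@le_lt_trans _ _ (gamma_low alpha kappa l theta eta * gamma_up alpha kappa l theta eta)).
    by rewrite expr2; apply: ler_pM => //; try exact: ltW; lra.
  rewrite prod ltr_pdivrMr ?mulr_gt0 //.
  have -> : t0 ^+ 2 * (2 * (theta * kappa * (kappa + l))) =
     2 * kappa / (theta * (kappa + l)).
    by rewrite /t0; field; rewrite !gt_eqF //.
  lra.
- rewrite k0 add0r.
  have lg : 0 <= theta * gamma * l by rewrite !mulr_ge0 // ltW.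
  have [e1|e1] := leP eta 1.
    have := c1 e1; rewrite /div_or_oo; case: ifPn => [/eqP E _|n0].
      by rewrite mulrAC E mul0r.
    rewrite lte_fin ltr_pdivlMr; first by lra.
    by rewrite lt_neqAle eq_sym n0 mulr_ge0 // ltW.
  have := c2 e1; rewrite /div_or_oo; case: ifPn => [/eqP E _|n0].
    have e3 : 0 < 3 * eta - 2 by lra.
    move/eqP: E; rewrite -mulrA mulf_eq0 gt_eqF //= => /eqP E.
    by rewrite mulrAC E mul0r.
  rewrite lte_fin ltr_pdivlMr; first by nra.
  by rewrite lt_neqAle eq_sym n0 !mulr_ge0 ?(ltW theta_gt0) //; lra.
Qed.

End StepSizes.

(** * Conjugates and the descent estimate *)

Lemma conjugate_ge (R : realType) (H : normedModType R) (ip : H -> H -> R) (h : H -> R) p v :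
  ((ip v p - h p)%:E <= conjugate ip (EFin \o h) v)%E.
Proof. by apply: ereal_sup_ubound; exists p. Qed.

(** The supremum that defines the conjugate is attained at [p]. *)
Lemma conjugate_subgradient (R : realType) (H : normedModType R)
    (ip : {dot H for idfun}) (h : H -> R) p v :
  convex_subdiff ip h p v -> conjugate ip (EFin \o h) v = (ip v p - h p)%:E.
Proof.
move=> hpv; apply/eqP; rewrite eq_le conjugate_ge andbT.
apply: ge_ereal_sup => _ [q _ <-] /=; rewrite -EFinB lee_fin.
by have := hpv q; rewrite !ipE; lra.
Qed.

(** With [a = x], [b] the gradient of [f] at [x] and [z = x + t *: b], the center of
    the second proximal step is a gradient step from [x] for the linearized function. *)
Lemma prox_center (K : pzRingType) (V : lmodType K) (s t : K) (a b c d : V) :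
  (s + 1) *: a - s *: (a + t *: b) - (s * t) *: c + (s * t) *: d =
  a - (s * t) *: (b + c - d).
Proof.
rewrite scalerDl scale1r !scalerDr scalerA scalerN !opprD opprK !addrA.
by rewrite [s *: a + a]addrC addrK.
Qed.

(** Here [d], [e] and [eb] stand for the increments of [x] and of the gradients of [f]
    and [hbar], and [r] for [y - x] at the earlier iterate. The monotonicity
    inequality [mono] can replace [ip e d] by [alpha * `|d| ^+ 2] because [ip e d] has
    the coefficient [eta^-1 * (1 - theta^-1)], which is nonpositive. *)
Lemma descent_estimate {R : realType} {H : normedModType R} {ip : {dot H for idfun}}
    (alpha kappa l gamma theta eta : R) (d e eb r : H) :
  (forall x, ip x x = `|x| ^+ 2) -> 0 <= kappa -> 0 <= l -> 0 < gamma ->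
  0 < theta <= 1 -> 0 < eta ->
  `|e| <= kappa * `|d| -> `|eb| <= l * `|d| -> alpha * `|d| ^+ 2 <= ip e d ->
  r = eta^-1 *: (d + gamma *: e) ->
  ip e r - alpha / 2 * `|d| ^+ 2 + (l / 2 * `|d| ^+ 2 + ip eb (r - d))
    + (2 * theta * gamma)^-1 * (`|r - d| ^+ 2 - `|r| ^+ 2)
    <= descent_coef alpha kappa l theta eta gamma * `|d| ^+ 2.
Proof.
move=> ip_norm kappa0 l0 gamma0 /andP[theta0 theta1] eta0 e_le eb_le mono rE.
have i0 : 0 < eta^-1 by rewrite invr_gt0.
have rdE : r - d = (eta^-1 - 1) *: d + (eta^-1 * gamma) *: e.
  by rewrite rE scalerDr scalerA scalerBl scale1r addrAC.
have rd_le : `|r - d| <= (`|eta^-1 - 1| + eta^-1 * gamma * kappa) * `|d|.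
  rewrite rdE; apply: le_trans (ler_normD _ _) _.
  rewrite (normrZ _ d) (normrZ _ e) (gtr0_norm (mulr_gt0 i0 gamma0)) mulrDl lerD2l.
  by rewrite -[leRHS]mulrA ler_pM2l // mulr_gt0.
have eb_ip : ip eb (r - d) <= l * (`|eta^-1 - 1| + eta^-1 * gamma * kappa) * `|d| ^+ 2.
  apply: le_trans (ip_le ip_norm _ _) _.
  have -> : l * (`|eta^-1 - 1| + eta^-1 * gamma * kappa) * `|d| ^+ 2 =
    (l * `|d|) * ((`|eta^-1 - 1| + eta^-1 * gamma * kappa) * `|d|) by ring.
  exact: ler_pM.
have ee : `|e| ^+ 2 <= kappa ^+ 2 * `|d| ^+ 2.
  by rewrite -exprMn ler_pXn2r ?nnegrE // mulr_ge0.
have ipr : ip e r = eta^-1 * (ip e d + gamma * `|e| ^+ 2).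
  by rewrite rE ipZr ipDr ipZr ip_norm.
have iprd : ip r d = eta^-1 * (`|d| ^+ 2 + gamma * ip e d).
  by rewrite rE ipZl ipDl ipZl ip_norm.
rewrite (sqr_normD ip_norm r (- d)) normrN ipNr iprd ipr /descent_coef.
set i := eta^-1 in i0 eb_ip *; set p := ip e d in mono *; set N := `|d| ^+ 2 in mono ee eb_ip *.
have u1 : 1 <= theta^-1 by rewrite invf_ge1.
have -> : (theta * eta)^-1 = theta^-1 * i by rewrite invfM.
have -> : (theta * gamma * eta)^-1 = 2 * (2 * theta * gamma)^-1 * i.
  by rewrite /i; field; rewrite !gt_eqF.
have cg : 2 * (2 * theta * gamma)^-1 * gamma = theta^-1.
  by field; rewrite !gt_eqF.
set c := (2 * theta * gamma)^-1 in cg *; set u := theta^-1 in u1 cg *.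
have -> : c * (`|r| ^+ 2 + 2 * - (i * (N + gamma * p)) + N - `|r| ^+ 2) =
  c * N - 2 * c * i * N - u * i * p by rewrite -cg; ring.
have h1 : 0 <= i * (u - 1) * (p - alpha * N).
  by rewrite !mulr_ge0 // ?subr_ge0 // ltW.
have h2 : 0 <= i * gamma * (kappa ^+ 2 * N - `|e| ^+ 2).
  by rewrite !mulr_ge0 // ?subr_ge0 // ltW.
lra.
Qed.

(** * Subgradients of the Lagrangian *)

Lemma ip_prod_ge0 {R : realType} {E1 E2 : lmodType R} {ip1 : E1 -> E1 -> R}
    {ip2 : E2 -> E2 -> R} :
  (forall v, 0 <= ip1 v v) -> (forall v, 0 <= ip2 v v) ->
  forall w, 0 <= ip_prod ip1 ip2 w w.
Proof. by move=> h1 h2 w; rewrite addr_ge0. Qed.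

Lemma ipnorm_prod_le {R : realType} {E1 E2 : lmodType R} {ip1 : E1 -> E1 -> R}
    {ip2 : E2 -> E2 -> R} :
  (forall v, 0 <= ip1 v v) -> (forall v, 0 <= ip2 v v) ->
  forall w, ipnorm (ip_prod ip1 ip2) w <= ipnorm ip1 w.1 + ipnorm ip2 w.2.
Proof.
move=> h1 h2 w; rewrite /ipnorm /ip_prod.
rewrite -(@ler_pXn2r _ 2) // ?nnegrE ?sqrtr_ge0 ?addr_ge0 ?sqrtr_ge0 //.
rewrite sqr_sqrtr ?addr_ge0 // sqrrD !sqr_sqrtr //.
by rewrite addrAC lerDl mulrn_wge0 // mulr_ge0 ?sqrtr_ge0.
Qed.

Section Products.
Context {R : realType} {H : normedModType R} {ip : {dot H for idfun}}.
Hypothesis ip_norm : forall x, ip x x = `|x| ^+ 2.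

Lemma ip5_sqr (w : H * H * H * H * H) : ip5 ip w w =
  `|w.1.1.1.1| ^+ 2 + `|w.1.1.1.2| ^+ 2 + `|w.1.1.2| ^+ 2 + `|w.1.2| ^+ 2 + `|w.2| ^+ 2.
Proof. by rewrite /ip5 /ip3 /ip_prod !ip_norm. Qed.

Lemma ipnorm5_sqr (w : H * H * H * H * H) : ipnorm (ip5 ip) w ^+ 2 =
  `|w.1.1.1.1| ^+ 2 + `|w.1.1.1.2| ^+ 2 + `|w.1.1.2| ^+ 2 + `|w.1.2| ^+ 2 + `|w.2| ^+ 2.
Proof. by rewrite sqr_sqrtr ip5_sqr // !addr_ge0 // sqr_ge0. Qed.

Lemma ipnorm3_le_sum (w : H * H * H) : ipnorm (ip3 ip) w <= `|w.1.1| + `|w.1.2| + `|w.2|.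
Proof.
have ge1 := ip_ge0 ip_norm; have ge2 := ip_prod_ge0 ge1 ge1.
have := ipnorm_prod_le ge1 ge1 w.1; have := ipnorm_prod_le ge2 ge1 w.
by rewrite !(ipnormE ip_norm) /ip3; lra.
Qed.

Lemma ipnorm5_le_sum (w : H * H * H * H * H) : ipnorm (ip5 ip) w <=
  `|w.1.1.1.1| + `|w.1.1.1.2| + `|w.1.1.2| + `|w.1.2| + `|w.2|.
Proof.
have ge1 := ip_ge0 ip_norm; have ge2 := ip_prod_ge0 ge1 ge1.
have ge3 := ip_prod_ge0 ge2 ge1; have ge4 := ip_prod_ge0 ge3 ge1.
have := ipnorm_prod_le ge3 ge1 w.1; have := ipnorm_prod_le ge4 ge1 w.
have := ipnorm3_le_sum w.1.1.
by rewrite !(ipnormE ip_norm) /ip5 /ip3; lra.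
Qed.

Lemma ipnorm5_le (w : H * H * H * H * H) : ipnorm (ip5 ip) w <= 5 * `|w|.
Proof.
have maxl (E1 E2 : normedModType R) (v : E1 * E2) : `|v.1| <= `|v|.
  by rewrite prod_normE le_max lexx.
have maxr (E1 E2 : normedModType R) (v : E1 * E2) : `|v.2| <= `|v|.
  by rewrite prod_normE le_max lexx orbT.
have := maxr _ _ w; have := maxl _ _ w; have := maxl _ _ w.1; have := maxr _ _ w.1.
have := maxl _ _ w.1.1; have := maxr _ _ w.1.1.
have := maxl _ _ w.1.1.1; have := maxr _ _ w.1.1.1.
have := ipnorm5_le_sum w; lra.
Qed.

Lemma ip_le_sqr (u v : H) : ip u v <= (`|u| ^+ 2 + `|v| ^+ 2) / 2.
Proof.
have := sqr_ge0 `|u - v|; rewrite (sqr_normD ip_norm) ipNr normrN; lra.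
Qed.

Lemma ip_ge_sqr (u v : H) : - ((`|u| ^+ 2 + `|v| ^+ 2) / 2) <= ip u v.
Proof. by have := ip_le_sqr (- u) v; rewrite normrN ipNl; lra. Qed.

Lemma sqr_normB_le (u v : H) : `|u - v| ^+ 2 <= 2 * (`|u| ^+ 2 + `|v| ^+ 2).
Proof.
rewrite (sqr_normD ip_norm) ipNr normrN; have := ip_ge_sqr u v; lra.
Qed.

(** The part of the Lagrangian that couples the five variables, with [c] in place of
    the coefficient [(2 eta theta - 1) / (2 theta gamma)]. *)
Definition coupling (gamma c : R) (x y z u v : H) : R :=
  ip u (y - x) - ip v y + gamma^-1 * ip (z - x) (y - x) - c * `|y - x| ^+ 2.

(** The function is quadratic, so its expansion is exact; the second-order part is
    bounded below by pairing each product with two squares. *)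
Lemma coupling_ge (gamma c : R) (x y z u v dx dy dz du dv : H) : 0 < gamma ->
  coupling gamma c x y z u v
  + (ip (- u - gamma^-1 *: (y - x) - gamma^-1 *: (z - x) + (2 * c) *: (y - x)) dx
     + ip (u - v + gamma^-1 *: (z - x) - (2 * c) *: (y - x)) dy
     + ip (gamma^-1 *: (y - x)) dz + ip (y - x) du - ip y dv)
  - (2 + 2 * gamma^-1 + 2 * `|c|)
    * (`|dx| ^+ 2 + `|dy| ^+ 2 + `|dz| ^+ 2 + `|du| ^+ 2 + `|dv| ^+ 2)
  <= coupling gamma c (x + dx) (y + dy) (z + dz) (u + du) (v + dv).
Proof.
move=> gamma0; rewrite /coupling.
have -> : y + dy - (x + dx) = (y - x) + (dy - dx) by rewrite opprD addrACA.
have -> : z + dz - (x + dx) = (z - x) + (dz - dx) by rewrite opprD addrACA.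
move: (y - x) (z - x) => r s.
have hq := sqr_normB_le dy dx; have ht := sqr_normB_le dz dx.
have h1 := ip_ge_sqr du (dy - dx); have h2 := ip_le_sqr dv dy.
have h3 := ip_ge_sqr (dz - dx) (dy - dx).
have rq : ip r (dy - dx) = ip r dy - ip r dx by rewrite !ipE.
have sq : ip s (dy - dx) = ip s dy - ip s dx by rewrite !ipE.
have uq : ip u (dy - dx) = ip u dy - ip u dx by rewrite !ipE.
have rt : ip r (dz - dx) = ip r dz - ip r dx by rewrite !ipE.
move: (dy - dx) (dz - dx) hq ht h1 h3 rq sq uq rt => q t hq ht h1 h3 rq sq uq rt.
rewrite (sqr_normD ip_norm r q) !ipE (ipC y dv) (ipC r du) (ipC t r) rq sq uq rt.
have g0 : 0 < gamma^-1 by rewrite invr_gt0.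
set g1 := gamma^-1 in g0 *.
have nx := sqr_ge0 `|dx|; have ny := sqr_ge0 `|dy|; have nz := sqr_ge0 `|dz|.
have nu := sqr_ge0 `|du|; have nv := sqr_ge0 `|dv|; have nq := sqr_ge0 `|q|.
set Nx := `|dx| ^+ 2 in nx hq ht *; set Ny := `|dy| ^+ 2 in ny hq h2 *.
set Nz := `|dz| ^+ 2 in nz ht *; set Nu := `|du| ^+ 2 in nu h1 *.
set Nv := `|dv| ^+ 2 in nv h2 *; set Nq := `|q| ^+ 2 in nq hq h1 h3 *.
set Nt := `|t| ^+ 2 in ht h3.
have hc : c * Nq <= 2 * `|c| * (Nx + Ny + Nz + Nu + Nv).
  apply: (@le_trans _ _ (`|c| * Nq)); first by rewrite ler_wpM2r // ler_norm.
  rewrite mulrAC [leRHS]mulrC ler_wpM2l //; lra.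
have hg : - (2 * g1 * (Nx + Ny + Nz + Nu + Nv)) <= g1 * ip t q.
  rewrite mulrAC mulrC -mulrN ler_pM2l //; lra.
lra.
Qed.

End Products.

Section LagrangianSubdifferential.
Context {R : realType} {H : normedVectType R} {ip : {dot H for idfun}}.
Hypothesis ip_norm : forall x, ip x x = `|x| ^+ 2.
Context {kappa l : R}.
Context {f : H -> R} {grad_f : H -> H} {g : H -> \bar R}
  {hbar : H -> R} {grad_hbar : H -> H} {hlow : H -> R}.
Hypotheses (kappa_ge0 : 0 <= kappa) (l_ge0 : 0 <= l).
Hypotheses (f_grad : is_gradient ip f grad_f) (f_lip : kappa.-lipschitz grad_f).
Hypotheses (hbar_grad : is_gradient ip hbar grad_hbar)
  (hbar_lip : l.-lipschitz grad_hbar).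
Context {gamma theta eta : R}.
Hypothesis gamma_gt0 : 0 < gamma.

Let c : R := (2 * eta * theta - 1) / (2 * theta * gamma).

(** Partial gradients in [x], [y], [z], [u], [v], with [zeta] in the role of the
    derivative of [g] at [y] and [p] in that of the derivative of the conjugate at [v]. *)
Definition lagrangian_subgradient (x y z u v p zeta : H) : H * H * H * H * H :=
  (grad_f x + grad_hbar x + (- u - gamma^-1 *: (y - x) - gamma^-1 *: (z - x)
     + (2 * c) *: (y - x)),
   zeta + (u - v + gamma^-1 *: (z - x) - (2 * c) *: (y - x)),
   gamma^-1 *: (y - x), y - x, p - y).

Lemma lagrangian_finite (x y z u v p : H) (G : R) : g y = G%:E ->
  convex_subdiff ip hlow p v ->
  lagrangian ip f g hbar hlow gamma theta eta (x, y, z, u, v) =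
  (f x + G + hbar x + (ip v p - hlow p) + coupling (ip := ip) gamma c x y z u v)%:E.
Proof.
move=> gy sub; rewrite /lagrangian gy (conjugate_subgradient sub) -!EFinD.
by congr EFin; rewrite /coupling -/c; ring.
Qed.

(** Each term of the Lagrangian has a minorant that touches it: quadratic for [f],
    [hbar] and the coupling, the given paraboloid for [g], an affine function for the
    conjugate. Their sum touches the Lagrangian from below at the given point. *)
Lemma lagrangian_regular_subdiff (x y z u v p zeta : H) (G C : R) :
  g y = G%:E -> 0 <= C ->
  (forall w, (G + ip zeta (w - y) - C * `|w - y| ^+ 2)%:E <= g w)%E ->
  convex_subdiff ip hlow p v ->
  regular_subdiff (ip5 ip) (lagrangian ip f g hbar hlow gamma theta eta)
    (x, y, z, u, v) (lagrangian_subgradient x y z u v p zeta).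
Proof.
move=> gy C0 gprox sub.
pose C' := kappa / 2 + l / 2 + C + (2 + 2 * gamma^-1 + 2 * `|c|).
have C'0 : 0 <= C'.
  have k0 := kappa_ge0; have l0 := l_ge0; have nc := normr_ge0 c.
  have g0 : 0 < gamma^-1 by rewrite invr_gt0.
  by rewrite /C'; lra.
apply: (@proximal_regular_subdiff _ _ _ 5 C' _ _ _ _ _ C'0 _
  (lagrangian_finite x z u gy sub)) => //.
  exact (ipnorm5_le ip_norm).
move=> [[[[x' y'] z'] u'] v'].
have split a b : b = a + (b - a) :> H by rewrite addrC subrK.
have hf := lipschitz_gradient_taylor ip_norm f_grad f_lip x x'.
have hh := lipschitz_gradient_taylor ip_norm hbar_grad hbar_lip x x'.
have hgy := gprox y'.
have hconj := conjugate_ge ip hlow p v'.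
have hcoup := coupling_ge ip_norm c x y z u v (x' - x) (y' - y) (z' - z) (u' - u)
  (v' - v) gamma_gt0.
rewrite -!split in hcoup.
rewrite (ipnorm5_sqr ip_norm) /=.
rewrite /lagrangian /ip5 /ip3 /ip_prod /=.
move: hgy hconj; case: (g y') => [b| |] //; last first.
  by move=> _; case: (conjugate _ _ _) => [s| |] // _; rewrite !(addey, addye) ?leey.
case: (conjugate _ _ _) => [s| |] //; last by move=> _ _; rewrite !(addey, addye) ?leey.
rewrite -!EFinD !lee_fin => hgy hconj.
move: hcoup; rewrite /coupling -/c.
move: hf hh; rewrite !ler_norml => /andP[hf _] /andP[hh _].
have hvp : ip p (v' - v) = ip v' p - ip v p by rewrite ipC !ipE.
rewrite (ipDl (grad_f x + grad_hbar x)) (ipDl (grad_f x)) (ipDl zeta).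
rewrite (ipDl p) (ipNl y) hvp /C'.
have nx := sqr_ge0 `|x' - x|; have ny := sqr_ge0 `|y' - y|.
have nz := sqr_ge0 `|z' - z|; have nu := sqr_ge0 `|u' - u|.
have nv := sqr_ge0 `|v' - v|.
set Nx := `|x' - x| ^+ 2 in nx hf hh *; set Ny := `|y' - y| ^+ 2 in ny hgy *.
set Nz := `|z' - z| ^+ 2 in nz *; set Nu := `|u' - u| ^+ 2 in nu *.
set Nv := `|v' - v| ^+ 2 in nv *.
have rx : 0 <= (kappa + l) * (Ny + Nz + Nu + Nv) by rewrite mulr_ge0 ?addr_ge0.
have ry : 0 <= C * (Nx + Nz + Nu + Nv) by rewrite mulr_ge0 ?addr_ge0.
lra.
Qed.

End LagrangianSubdifferential.

(** * Descent sequences under the Kurdyka-Lojasiewicz property *)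

Lemma derive1_scaled_powR {R : realType} (c lambda t : R) : 0 < t ->
  derive1 (fun u => c * u `^ (1 - lambda)) t = c * ((1 - lambda) * t `^ (- lambda)).
Proof.
move=> t0; rewrite derive1E; apply: derive_val.
have := is_derive1_powR (1 - lambda) t0.
rewrite (_ : 1 - lambda - 1 = - lambda); last by ring.
by move=> D; exact: is_deriveZ.
Qed.

Lemma cvg_dominated {R : realType} {E : normedModType R} (u : nat -> E) (b : nat -> R)
    (C : R) (lim : E) :
  (forall n, `|u n - lim| <= C * b n) -> b @ \oo --> 0 -> u @ \oo --> lim.
Proof.
move=> u_le b0; have Cb : C * b n @[n --> \oo] --> 0.
  by rewrite -[X in _ --> X](mulr0 C); apply: cvgM b0; exact: cvg_cst.
apply/cvgrPdist_lt => e e0.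
have : \forall n \near \oo, C * b n < e by apply: (cvgr_lt 0).
by apply: filterS => n; apply: le_lt_trans; rewrite distrC.
Qed.

Lemma cvg_subsequence {T : topologicalType} (u : nat -> T) (sigma : nat -> nat) (lim : T) :
  (forall k, (k <= sigma k)%N) -> u @ \oo --> lim -> u (sigma k) @[k --> \oo] --> lim.
Proof.
move=> sigma_ge u_lim; apply: (cvg_comp sigma u _ u_lim) => A [N _ NA].
by exists N => // k /= Nk; apply: NA => /=; exact: leq_trans (sigma_ge k).
Qed.

Lemma cluster_subsequence {R : realType} {E : normedModType R} (u : nat -> E) (p : E) :
  cluster (u @ \oo) p ->
  exists2 sigma : nat -> nat, (forall k, (k <= sigma k)%N) &
    u (sigma k) @[k --> \oo] --> p.
Proof.
move=> up.
(* A sequence of indices with [k <= sigma k] converges along [\oo], whether or not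
   it increases. *)
have /choice[sigma sigmaP] : forall k : nat, exists n : nat,
    (k <= n)%N /\ `|u n - p| <= 1 * k.+1%:R^-1.
  move=> k; have k0 : 0 < k.+1%:R^-1 :> R by rewrite invr_gt0.
  have [_ [[n kn <-]] pn] := up (u @` [set n | (k <= n)%N]) (ball p k.+1%:R^-1)
    (ex_intro2 _ _ k I (fun n kn => ex_intro2 _ _ n kn erefl)) (nbhsx_ballx _ _ k0).
  by exists n; split => //; move: pn; rewrite -ball_normE /= distrC mul1r => /ltW.
exists sigma => [k|]; first by case: (sigmaP k).
apply: (@cvg_dominated _ _ _ (fun k => k.+1%:R^-1) 1) => [k|]; first by case: (sigmaP k).
exact: cvg_harmonic.
Qed.

Lemma cvg_proj {K : numFieldType} {E1 E2 : normedModType K} {T : Type} (F : set_system T)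
    (s : T -> E1 * E2) (p : E1 * E2) : Filter F -> s @ F --> p ->
  ((s k).1 @[k --> F] --> p.1) /\ ((s k).2 @[k --> F] --> p.2).
Proof.
by move=> FF sp; split; [exact: (cvg_comp s _ sp cvg_fst)|exact: (cvg_comp s _ sp cvg_snd)].
Qed.

Lemma cvg_image {T : Type} {U V : topologicalType} (F : set_system T) (s : T -> U)
    (phi : U -> V) (p : U) : Filter F -> continuous phi -> s @ F --> p ->
  phi (s k) @[k --> F] --> phi p.
Proof. by move=> FF phi_cont sp; apply: (cvg_comp s phi sp); exact: phi_cont. Qed.

Section KLDescent.
Context {R : realType} {E : normedModType R} {ip : E -> E -> R} {K : R}.
Hypothesis ipK : forall u, ipnorm ip u <= K * `|u|.
Context {L : E -> \bar R} {w : nat -> E} {v : nat -> R} {vlim : R} {a : nat -> R}.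
Context {delta C : R}.
Hypotheses (delta_gt0 : 0 < delta) (C_gt0 : 0 < C) (a_ge0 : forall n, 0 <= a n).
Hypothesis L_w : forall n, L (w n) = (v n)%:E.
Hypothesis v_descent : forall n, delta * a n ^+ 2 <= v n - v n.+1.
Hypothesis v_cvg : v @ \oo --> vlim.
Hypothesis subgrad : forall n, exists2 u, limiting_subdiff ip L (w n.+1) u &
  ipnorm ip (0 - u) <= C * (a n.+1 + a n).
Context {A : set E}.
Hypotheses (A_compact : compact A) (w_A : forall n, A (w n)).
Hypothesis cluster_critical : forall p, cluster (w @ \oo) p ->
  L p = vlim%:E /\ dom_subdiff ip L p.

Let s n : R := v n - vlim.

Lemma gap_noninc n : s n.+1 <= s n.
Proof.
have := v_descent n; have : 0 <= delta * a n ^+ 2 by rewrite mulr_ge0 ?sqr_ge0 // ltW.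
by rewrite /s; lra.
Qed.

Lemma gap_anti k n : (k <= n)%N -> s n <= s k.
Proof.
move=> /subnKC <-; elim: (n - k)%N => [|i IHi]; first by rewrite addn0.
by rewrite addnS; apply: le_trans IHi; exact: gap_noninc.
Qed.

Lemma gap_cvg0 : s @ \oo --> 0.
Proof. by rewrite -(subrr vlim); apply: cvgB v_cvg _; exact: cvg_cst. Qed.

Lemma gap_ge0 n : 0 <= s n.
Proof.
apply: (@ler_cvg_to _ _ _ _ s (cst (s n)) _ _ gap_cvg0 (cvg_cst _)).
by exists n => // k /= nk; exact: gap_anti.
Qed.

Lemma gap_lt (e : R) : 0 < e -> exists N, forall n, (N <= n)%N -> s n < e.
Proof.
move=> e0; have /cvgr_lt/(_ e) := gap_cvg0.
by rewrite e0 => /(_ isT)[N _ hN]; exists N => n Nn; exact: hN.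
Qed.

Lemma step_le_gap n : delta * a n ^+ 2 <= s n - s n.+1.
Proof. by have := v_descent n; rewrite /s; lra. Qed.

(** The tangent inequality for the concave [phi] turns the Kurdyka-Lojasiewicz
    inequality into bounds between consecutive gaps. The first two conclusions do not
    mention [U], so that the functions [phi] of several cluster points can be added. *)
Lemma KL_near_cluster p phi : cluster (w @ \oo) p -> KL_with ip L p phi ->
  exists2 U, nbhs p U & exists N, forall n, (N <= n)%N ->
    [/\ 0 <= phi (s n.+1), phi (s n.+2) <= phi (s n.+1) &
      U (w n.+1) -> 0 < s n.+1 ->
      1 <= derive1 phi (s n.+1) * (C * (a n.+1 + a n)) /\
      derive1 phi (s n.+1) * (s n.+1 - s n.+2) <= phi (s n.+1) - phi (s n.+2)].
Proof.
move=> wp [eps [del [eps0 del0 phiD KLp]]].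
have [Lp _] := cluster_critical wp.
have K0 : 0 < `|K| + 1 by rewrite ltr_wpDl.
exists (ball p (eps / (`|K| + 1))); first by apply: nbhsx_ballx; rewrite divr_gt0.
have [N sN] : exists N, forall n, (N <= n)%N -> ((s n)%:E < del)%E.
  case: del del0 {phiD KLp} => [d| |] // d0; last by exists 0%N => n _; rewrite ltry.
  by have [N hN] := gap_lt d0; exists N => n Nn; rewrite lte_fin hN.
exists N => n Nn.
have sd : ((s n.+1)%:E < del)%E by apply: sN; exact: leqW.
have decr := concave_derive_le phiD (gap_ge0 n.+2).
split.
- by case: phiD => phi0 _ _ _ _; apply: phi0; split => //; exact: gap_ge0.
- have := gap_noninc n.+1; rewrite le_eqVlt => /predU1P[->//|lt_s].
  case: phiD => _ _ _ _ /(_ _ (le_lt_trans (gap_ge0 _) lt_s) sd)[_ _ dphi].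
  have := decr _ lt_s sd.
  have : 0 <= derive1 phi (s n.+1) * (s n.+1 - s n.+2).
    by rewrite mulr_ge0 ?subr_ge0 // ltW.
  by lra.
- move=> wU s0; split; last first.
    have := gap_noninc n.+1; rewrite le_eqVlt => /predU1P[<-|lt_s].
      by rewrite !subrr mulr0.
    exact: decr.
  have [u Lu u_le] := subgrad n.
  have wp_eps : ipnorm ip (w n.+1 - p) <= eps.
    apply: le_trans (ipK _) _.
    move: wU; rewrite -ball_normE /= ltr_pdivlMr // distrC mulrC => h.
    apply: ltW; apply: le_lt_trans h; rewrite ler_wpM2r //.
    by have := ler_norm K; lra.
  have := KLp (w n.+1) wp_eps; rewrite Lp L_w lte_fin.
  have -> : vlim < v n.+1 by move: s0; rewrite /s subr_gt0.
  have -> : ((v n.+1)%:E < vlim%:E + del)%E.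
    move: sd; rewrite /s; case: (del) => [d| |].
    - by rewrite -EFinD !lte_fin; lra.
    - by rewrite addey // !ltry.
    - by rewrite ltNge leNye.
  move=> /(_ isT isT); rewrite -EFinB /= -/(s n.+1) => KLn.
  case: phiD => _ _ _ _ /(_ _ s0 sd)[_ _ dphi].
  rewrite -lee_fin; apply: le_trans KLn _; rewrite EFinM.
  apply: lee_wpmul2l; first by rewrite lee_fin ltW.
  apply: ge_ereal_inf; exists (ipnorm ip (0 - u))%:E; first by exists u.
  by rewrite lee_fin.
Qed.

(** A property that holds near every cluster point holds on all of [A]: a point that
    is not a cluster point has a neighborhood that the sequence finally avoids. *)
Lemma cluster_induction (Q : set E -> Prop) :
  (forall U V, U `<=` V -> Q V -> Q U) -> (forall U V, Q U -> Q V -> Q (U `|` V)) ->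
  (forall U N, (forall n, (N <= n)%N -> ~ U (w n)) -> Q U) ->
  (forall p, cluster (w @ \oo) p -> exists2 U, nbhs p U & Q U) -> Q A.
Proof.
move=> Qsub QU Qfar Qclu; apply: compact_induction => //.
  by apply: (Qfar _ 0%N) => n _.
move=> p _; have [wp|nwp] := pselect (cluster (w @ \oo) p); first exact: Qclu.
have [B [V [[N _ hN] pV BV]]] : exists B V, [/\ (w @ \oo) B, nbhs p V & B `&` V = set0].
  apply: contrapT => h; apply: nwp => B V wB pV.
  by apply/set0P/eqP => BV; apply: h; exists B, V.
exists V => //; apply: (Qfar _ N) => n Nn Vn.
have : (B `&` V) (w n) by split => //; exact: hN.
by rewrite BV.
Qed.

(** The bounds near the cluster points are glued with [b] the sum of the functions
    [C / delta * phi (s n)], and [finite_length] is applied to [b]. *)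
Lemma KL_finite_length : KL_function ip L ->
  exists M, forall m, \sum_(k < m) a k <= M.
Proof.
move=> L_KL.
pose Q (U : set E) := exists (b : nat -> R) (N : nat),
  [/\ forall n, (N <= n)%N -> 0 <= b n.+1,
      forall n, (N <= n)%N -> b n.+2 <= b n.+1 &
      forall n, (N <= n)%N -> U (w n.+1) ->
        a n.+1 ^+ 2 <= (b n.+1 - b n.+2) * (a n.+1 + a n)].
have : Q A.
  apply: cluster_induction.
  - by move=> U V UV [b [N [b0 b1 b2]]]; exists b, N; split => // n Nn /UV; exact: b2.
  - move=> U V [b [N [b0 b1 b2]]] [b' [N' [b0' b1' b2']]].
    exists (fun n => b n + b' n), (maxn N N'); split => n; rewrite geq_max => /andP[Nn Nn'].
    + by rewrite addr_ge0 ?b0 ?b0'.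
    + by rewrite lerD ?b1 ?b1'.
    + have A0 : 0 <= a n.+1 + a n by rewrite addr_ge0.
      have d1 : 0 <= (b n.+1 - b n.+2) * (a n.+1 + a n).
        by rewrite mulr_ge0 ?subr_ge0 ?b1.
      have d2 : 0 <= (b' n.+1 - b' n.+2) * (a n.+1 + a n).
        by rewrite mulr_ge0 ?subr_ge0 ?b1'.
      by move=> [/(b2 n Nn)|/(b2' n Nn')]; lra.
  - move=> U N far; exists (cst 0), N; split=> // n Nn Uw.
    by case: (far n.+1 (leqW Nn) Uw).
  - move=> p wp; have [_ /L_KL[phi KLp]] := cluster_critical wp.
    have [U pU [N hN]] := KL_near_cluster wp KLp.
    exists U => //; exists (fun n => C / delta * phi (s n)), N.
    have Cd : 0 <= C / delta by rewrite divr_ge0 // ltW.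
    split => n Nn; have [phi0 phi_le KLn] := hN n Nn.
    + by rewrite mulr_ge0.
    + by rewrite ler_wpM2l.
    + move=> Uw; rewrite -mulrBr -mulrA.
      have A0 : 0 <= a n.+1 + a n by rewrite addr_ge0.
      have st := step_le_gap n.+1.
      have [s0|s0] := leP (s n.+1) 0.
        apply: (@le_trans _ _ 0); last by rewrite mulr_ge0 // mulr_ge0 // subr_ge0.
        rewrite -(pmulr_rle0 _ delta_gt0); apply: le_trans st _.
        by have := gap_ge0 n.+2; lra.
      have [one_le le_phi] := KLn Uw s0.
      rewrite -[leRHS]mulrA mulrCA ler_pdivlMl //; apply: le_trans st _.
      have ds : 0 <= s n.+1 - s n.+2 by rewrite subr_ge0; exact: gap_noninc.
      apply: (@le_trans _ _ (derive1 phi (s n.+1) * (C * (a n.+1 + a n)) * (s n.+1 - s n.+2))).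
        by rewrite ler_peMl.
      rewrite mulrAC [leRHS]mulrCA [leRHS]mulrC; apply: le_trans (ler_wpM2r _ le_phi) _.
        by rewrite mulr_ge0 // ltW.
      by rewrite le_eqVlt; apply/orP; left; apply/eqP; ring.
move=> [b [N [b0 b1 b2]]].
have len := finite_length a_ge0 b1 (fun n Nn => b2 n Nn (w_A _)).
exists (\sum_(k < N.+1) a k + (a N / 2 + 2 * b N.+1)) => m.
have sum_mono i j : (i <= j)%N -> \sum_(k < i) a k <= \sum_(k < j) a k.
  by move=> /subnKC <-; rewrite big_split_ord /= lerDl sumr_ge0.
apply: le_trans (sum_mono m (N.+1 + m)%N (leq_addl _ _)) _.
rewrite big_split_ord /= lerD2l; apply: le_trans (len m) _.
by have := a_ge0 (N + m)%N; have := b0 _ (leq_addr m N); rewrite addSn; lra.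
Qed.

Section Exponent.
Context {lambda : R}.
Hypotheses (lambda_ge0 : 0 <= lambda) (lambda_lt1 : lambda < 1).

(** The functions [c * t `^ (1 - lambda)] differ only by the factor [c], so gluing the
    local bounds amounts to enlarging one constant. *)
Lemma KL_exponent_uniform : KL_function_exponent ip lambda L ->
  exists (c : R) (N : nat), 0 < c /\ forall n, (N <= n)%N ->
    (0 < s n.+1 -> s n.+1 `^ lambda <= c * (a n.+1 + a n)) /\
    a n.+1 ^+ 2 <= c * (s n.+1 `^ (1 - lambda) - s n.+2 `^ (1 - lambda))
      * (a n.+1 + a n).
Proof.
move=> [_ L_KL].
have p0 : 0 < 1 - lambda by rewrite subr_gt0.
have pow_noninc n : s n.+1 `^ (1 - lambda) <= s n `^ (1 - lambda).
  by apply: ge0_ler_powR; rewrite ?nnegrE ?gap_ge0 ?gap_noninc // ltW.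
have A0 n : 0 <= a n.+1 + a n by rewrite addr_ge0.
pose Q (U : set E) := exists (c : R) (N : nat), 0 < c /\ forall n, (N <= n)%N ->
    U (w n.+1) -> (0 < s n.+1 -> s n.+1 `^ lambda <= c * (a n.+1 + a n)) /\
    a n.+1 ^+ 2 <= c * (s n.+1 `^ (1 - lambda) - s n.+2 `^ (1 - lambda))
      * (a n.+1 + a n).
have Qmono (c c' : R) n : c <= c' ->
    (0 < s n.+1 -> s n.+1 `^ lambda <= c * (a n.+1 + a n)) /\
    a n.+1 ^+ 2 <= c * (s n.+1 `^ (1 - lambda) - s n.+2 `^ (1 - lambda))
      * (a n.+1 + a n) ->
    (0 < s n.+1 -> s n.+1 `^ lambda <= c' * (a n.+1 + a n)) /\
    a n.+1 ^+ 2 <= c' * (s n.+1 `^ (1 - lambda) - s n.+2 `^ (1 - lambda))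
      * (a n.+1 + a n).
  move=> cc' [h1 h2]; split => [s0|].
    by apply: le_trans (h1 s0) _; rewrite ler_wpM2r.
  by apply: le_trans h2 _; rewrite ler_wpM2r // ler_wpM2r // subr_ge0.
suff [c [N [c0 hN]]] : Q A by exists c, N; split => // n Nn; exact: hN.
apply: cluster_induction.
- by move=> U V UV [c [N [c0 hN]]]; exists c, N; split => // n Nn /UV; exact: hN.
- move=> U V [c [N [c0 hN]]] [c' [N' [c'0 hN']]].
  exists (c + c'), (maxn N N'); split; first exact: addr_gt0.
  move=> n; rewrite geq_max => /andP[Nn Nn'] [Un|Vn].
    by apply: Qmono (hN n Nn Un); rewrite lerDl ltW.
  by apply: Qmono (hN' n Nn' Vn); rewrite lerDr ltW.
- move=> U N far; exists 1, N; split => // n Nn Uw.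
  by case: (far n.+1 (leqW Nn) Uw).
- move=> p wp; have [_ /L_KL[c c0 KLp]] := cluster_critical wp.
  have [U pU [N hN]] := KL_near_cluster wp KLp.
  exists U => //; exists (c * C * (1 + delta^-1)), N.
  have cC : 0 < c * C by rewrite mulr_gt0.
  have d0 : 0 < delta^-1 by rewrite invr_gt0.
  split; first by rewrite mulr_gt0 // addr_gt0.
  move=> n Nn Uw; have [_ _ KLn] := hN n Nn.
  have st := step_le_gap n.+1.
  have [s0|s0] := leP (s n.+1) 0.
    split => //; apply: (@le_trans _ _ 0).
      rewrite -(pmulr_rle0 _ delta_gt0); apply: le_trans st _.
      by have := gap_ge0 n.+2; lra.
    by rewrite mulr_ge0 // mulr_ge0 ?subr_ge0 // ltW // mulr_gt0 // addr_gt0.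
  have [one_le le_phi] := KLn Uw s0.
  rewrite derive1_scaled_powR // in one_le le_phi.
  have slam : s n.+1 `^ (- lambda) * s n.+1 `^ lambda = 1.
    by rewrite -powRD ?addNr ?powRr0 // (gt_eqF s0) implybT.
  have lam0 : 0 < s n.+1 `^ lambda by rewrite powR_gt0.
  have sN0 : 0 < s n.+1 `^ (- lambda) by rewrite powR_gt0.
  have An := A0 n; have cCA : 0 <= c * C * (a n.+1 + a n) by rewrite mulr_ge0 // ltW.
  split => [_|].
    have := ler_wpM2r (ltW lam0) one_le; rewrite mul1r => h.
    apply: le_trans h _.
    have -> : c * ((1 - lambda) * s n.+1 `^ (- lambda)) * (C * (a n.+1 + a n))
        * s n.+1 `^ lambda = c * C * (a n.+1 + a n) * (1 - lambda)
        * (s n.+1 `^ (- lambda) * s n.+1 `^ lambda) by ring.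
    rewrite slam mulr1 -subr_ge0.
    have : 0 <= c * C * (a n.+1 + a n) * (lambda + delta^-1).
      by rewrite mulr_ge0 // addr_ge0 // ltW.
    by lra.
  have ds : 0 <= s n.+1 - s n.+2 by rewrite subr_ge0; exact: gap_noninc.
  have CA : 0 <= C * (a n.+1 + a n) by rewrite mulr_ge0 // ltW.
  have h1 := ler_peMl ds one_le; have h2 := ler_wpM2r CA le_phi.
  have h3 : delta * a n.+1 ^+ 2 <= c * C * (s n.+1 `^ (1 - lambda)
      - s n.+2 `^ (1 - lambda)) * (a n.+1 + a n) by lra.
  have h4 : 0 <= c * C * (s n.+1 `^ (1 - lambda) - s n.+2 `^ (1 - lambda))
      * (a n.+1 + a n).
    by rewrite mulr_ge0 // mulr_ge0 ?subr_ge0 // ltW.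
  have := ler_wpM2l (ltW d0) h3; rewrite mulrA mulVf ?gt_eqF // mul1r.
  by lra.
Qed.

Lemma step_le_sqrt_gap n : a n <= Num.sqrt delta^-1 * s n `^ 2^-1.
Proof.
have d0 : 0 < delta^-1 by rewrite invr_gt0.
rewrite -(@ler_pXn2r _ 2) ?nnegrE // ?mulr_ge0 ?sqrtr_ge0 ?powR_ge0 //.
rewrite exprMn (sqr_sqrtr (ltW d0)) powR12_sqrt ?gap_ge0 // sqr_sqrtr ?gap_ge0 //.
have st := step_le_gap n; have s1 := gap_ge0 n.+1.
by rewrite ler_pdivlMl //; lra.
Qed.

(** [finite_length] bounds the tail by [a n] and [s n `^ (1 - lambda)], and the decrease
    bounds [a n] by the square root of [s n]; for [s n <= 1] the smaller exponent
    dominates. *)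
Lemma KL_tail_le mu : 0 < mu -> mu <= 2^-1 -> mu <= 1 - lambda ->
  KL_function_exponent ip lambda L ->
  exists (c : R) (N : nat), 0 < c /\ forall n, (N <= n)%N ->
    s n <= c * s n `^ mu /\ forall m, \sum_(k < m) a (n + k)%N <= c * s n `^ mu.
Proof.
move=> mu0 mu2 mul L_KL.
have [c [N [c0 hN]]] := KL_exponent_uniform L_KL.
have [N' hN'] := gap_lt ltr01.
set q := Num.sqrt delta^-1.
have q0 : 0 <= q by exact: sqrtr_ge0.
exists (1 + 2 * q + 2 * c), (maxn N N'); split; first lra.
move=> n; rewrite geq_max => /andP[Nn N'n].
have s1 := hN' n N'n; have P0 : 0 <= s n `^ mu by rewrite powR_ge0.
have pow_le p : mu <= p -> s n `^ p <= s n `^ mu.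
  move=> mup; have := gap_ge0 n; rewrite le_eqVlt => /predU1P[<-|s0].
    by rewrite !powR0 // gt_eqF //; lra.
  by apply: ger_powR => //; rewrite s0 ltW.
have s_le : s n <= s n `^ mu.
  by have := pow_le 1; rewrite powRr1 ?gap_ge0 //; apply; lra.
have := step_le_sqrt_gap n; rewrite -/q => a_le; have h2 := ler_wpM2l q0 (pow_le _ mu2).
have cP : 0 <= c * s n `^ mu by rewrite mulr_ge0 // ltW.
have qP : 0 <= q * s n `^ mu by rewrite mulr_ge0.
split; first by lra.
case=> [|m]; first by rewrite big_ord0; lra.
rewrite big_ord_recl addn0.
have pow_noninc k : s k.+1 `^ (1 - lambda) <= s k `^ (1 - lambda).
  by apply: ge0_ler_powR; rewrite ?nnegrE ?gap_ge0 ?gap_noninc // subr_ge0 ltW.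
have len := @finite_length _ a (fun k => c * s k `^ (1 - lambda)) n a_ge0 _ _ m.
have {}len : \sum_(k < m) a (n.+1 + k)%N <= (a n - a (n + m)%N) / 2 +
   2 * (c * s n.+1 `^ (1 - lambda) - c * s (n.+1 + m)%N `^ (1 - lambda)).
  apply: len => k nk; first by rewrite ler_wpM2l // ltW.
  by have [_] := hN k (leq_trans Nn nk); rewrite mulrBr.
have -> : \sum_(i < m) a (n + lift ord0 i)%N = \sum_(i < m) a (n.+1 + i)%N.
  by apply: eq_bigr => i _; rewrite /lift /= addnS.
have := a_ge0 (n + m)%N; have := ler_wpM2l (ltW c0) (pow_noninc n).
have : 0 <= c * s (n.+1 + m)%N `^ (1 - lambda) by rewrite mulr_ge0 ?powR_ge0 // ltW.
have := ler_wpM2l (ltW c0) (pow_le _ mul).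
by lra.
Qed.

(** The sum [a n.+1 + a n] bounds [s n.+1 `^ lambda] from above, and the decrease over
    two steps bounds its square by [s n - s n.+2]. *)
Lemma KL_gap_recursion : 0 < lambda -> KL_function_exponent ip lambda L ->
  exists (c : R) (N : nat), 0 < c /\ forall n, (N <= n)%N ->
    s n.+2 `^ (2 * lambda) <= c * (s n - s n.+2).
Proof.
move=> lam0 L_KL; have [c [N [c0 hN]]] := KL_exponent_uniform L_KL.
exists (2 * c ^+ 2 / delta), N; split; first by rewrite divr_gt0 // mulr_gt0 // exprn_gt0.
move=> n Nn; have [KLn _] := hN n Nn.
have An : 0 <= a n.+1 + a n by rewrite addr_ge0.
have slam : s n.+1 `^ lambda <= c * (a n.+1 + a n).
  have := gap_ge0 n.+1; rewrite le_eqVlt => /predU1P[s0|/KLn//].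
  by rewrite -s0 powR0 ?gt_eqF // mulr_ge0 // ltW.
have : s n.+2 `^ (2 * lambda) <= s n.+1 `^ (2 * lambda).
  by apply: ge0_ler_powR; rewrite ?nnegrE ?gap_ge0 ?gap_noninc // mulr_ge0.
have -> : s n.+1 `^ (2 * lambda) = (s n.+1 `^ lambda) ^+ 2.
  by rewrite mulrC powRrM powR_mulrn // powR_ge0.
move=> h.
apply: le_trans h _.
apply: (@le_trans _ _ ((c * (a n.+1 + a n)) ^+ 2)).
  by rewrite ler_pXn2r ?nnegrE ?powR_ge0 // mulr_ge0 // ltW.
have st := step_le_gap n; have st1 := step_le_gap n.+1.
have sq : delta * (a n.+1 + a n) ^+ 2 <= 2 * (s n - s n.+2).
  have : 0 <= delta * (a n.+1 - a n) ^+ 2 by rewrite mulr_ge0 ?sqr_ge0 // ltW.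
  by lra.
have -> : 2 * c ^+ 2 / delta * (s n - s n.+2) =
  delta^-1 * (c ^+ 2 * (2 * (s n - s n.+2))) by ring.
rewrite ler_pdivlMl // exprMn.
by have := ler_wpM2l (ltW (exprn_gt0 2 c0)) sq; lra.
Qed.

(** For exponent [0] the sum [a n.+1 + a n] is bounded below while the gap is
    positive, although the steps tend to [0]; so the gap reaches [0], and the steps
    vanish from then on. *)
Lemma KL_finite : lambda = 0 -> KL_function_exponent ip lambda L ->
  exists N, forall n, (N <= n)%N -> a n = 0.
Proof.
move=> lam0 L_KL; have [c [N [c0 hN]]] := KL_exponent_uniform L_KL.
have e0 : 0 < delta / (2 * c ^+ 2) by rewrite divr_gt0 // mulr_gt0 // exprn_gt0.
have [N' hN'] := gap_lt e0.
exists (maxn N N').+1 => -[//|n]; rewrite ltnS geq_max => /andP[Nn N'n].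
have [KLn _] := hN n Nn; have st := step_le_gap n; have st1 := step_le_gap n.+1.
have [s0|s0] := leP (s n.+1) 0.
  have h : delta * a n.+1 ^+ 2 <= 0 by have := gap_ge0 n.+2; lra.
  apply/eqP; rewrite -sqrf_eq0 eq_le sqr_ge0 andbT.
  by rewrite -(pmulr_rle0 _ delta_gt0).
have := KLn s0; rewrite lam0 powRr0 => one_le.
have : 1 <= (c * (a n.+1 + a n)) ^+ 2 by rewrite exprn_ege1.
have := hN' n N'n; rewrite ltr_pdivlMr ?mulr_gt0 ?exprn_gt0 // => s_lt.
have sq : delta * (a n.+1 + a n) ^+ 2 <= 2 * (s n - s n.+2).
  have : 0 <= delta * (a n.+1 - a n) ^+ 2 by rewrite mulr_ge0 ?sqr_ge0 // ltW.
  by lra.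
have c2 : 0 < c ^+ 2 by rewrite exprn_gt0.
have := ler_wpM2l (ltW c2) sq; rewrite exprMn mulrCA.
have := mulr_ge0 (ltW c2) (gap_ge0 n.+2).
move=> h1 h2 h3; have := ler_wpM2l (ltW delta_gt0) h3; lra.
Qed.

Lemma KL_decay_transfer mu (c d : R) (n : nat) : 0 < mu -> 0 < c -> s n <= d ->
  s n <= c * s n `^ mu /\ (forall m, \sum_(k < m) a (n + k)%N <= c * s n `^ mu) ->
  s n <= c * d `^ mu /\ forall m, \sum_(k < m) a (n + k)%N <= c * d `^ mu.
Proof.
move=> mu0 c0 s_le [h1 h2].
have h : c * s n `^ mu <= c * d `^ mu.
  rewrite ler_pM2l //; apply: ge0_ler_powR; rewrite ?nnegrE ?gap_ge0 //; first exact: ltW.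
  exact: le_trans (gap_ge0 n) s_le.
by split => [|m]; [apply: le_trans h1 h|apply: le_trans (h2 m) h].
Qed.

(** Since [2 lambda <= 1] and [s n.+2 <= 1], the power [s n.+2 `^ (2 * lambda)] is at
    least [s n.+2], which leaves a linear recursion. *)
Lemma KL_linear : 0 < lambda -> lambda <= 1 / 2 -> KL_function_exponent ip lambda L ->
  exists (G rho : R) (N : nat), [/\ 0 < G, 0 < rho < 1 &
    forall n, (N <= n)%N -> s n <= G * rho `^ (n%:R / 2) /\
      forall m, \sum_(k < m) a (n + k)%N <= G * rho `^ (n%:R / 2)].
Proof.
move=> lam0 lam2 L_KL.
have [c [N [c0 hN]]] := KL_gap_recursion lam0 L_KL.
have [N' hN'] := gap_lt ltr01.
have mu0 : 0 < 2^-1 :> R by rewrite invr_gt0.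
have [c' [N'' [c'0 tail]]] : exists (c : R) (N : nat), 0 < c /\ forall n, (N <= n)%N ->
    s n <= c * s n `^ 2^-1 /\ forall m, \sum_(k < m) a (n + k)%N <= c * s n `^ 2^-1.
  by apply: KL_tail_le => //; lra.
have rec n : (maxn N N' <= n)%N -> s n.+2 <= c * (s n - s n.+2).
  rewrite geq_max => /andP[Nn N'n]; apply: le_trans (hN n Nn).
  have s1 := hN' _ (leqW (leqW N'n)).
  have := gap_ge0 n.+2; rewrite le_eqVlt => /predU1P[<-|s0]; first exact: powR_ge0.
  by apply: ger1_powR; [rewrite s0 ltW|lra].
have [G [rho [G0 rho01 dec]]] := linear_decay c0 gap_ge0 gap_noninc rec.
have /andP[rho0 rho1] := rho01.
exists (c' * G `^ 2^-1), rho, (maxn (maxn N N') N''); split => //.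
  by rewrite mulr_gt0 // powR_gt0.
have powE n : c' * G `^ 2^-1 * rho `^ (n%:R / 2) = c' * (G * rho ^+ n) `^ 2^-1.
  rewrite powRM ?exprn_ge0 ?(ltW G0) ?(ltW rho0) // powRrM powR_mulrn ?(ltW rho0) //.
  by rewrite mulrA.
move=> n; rewrite powE geq_max => /andP[Nn N''n].
exact: KL_decay_transfer mu0 c'0 (dec n Nn) (tail n N''n).
Qed.

(** The recursion is that of [sublinear_decay] with [tau = 2 lambda - 1]; the tails
    decay like [s n `^ (1 - lambda)], which gives the exponent. *)
Lemma KL_sublinear : 1 / 2 < lambda -> KL_function_exponent ip lambda L ->
  exists (G : R) (N : nat), 0 < G /\
    forall n, (N <= n)%N -> (0 < n)%N ->
      s n <= G * n%:R `^ (- ((1 - lambda) / (2 * lambda - 1))) /\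
      forall m, \sum_(k < m) a (n + k)%N
        <= G * n%:R `^ (- ((1 - lambda) / (2 * lambda - 1))).
Proof.
move=> lam2 L_KL; have lam0 : 0 < lambda by lra.
have [c [N [c0 hN]]] := KL_gap_recursion lam0 L_KL.
have [N' hN'] := gap_lt ltr01.
have mu0 : 0 < 1 - lambda by rewrite subr_gt0.
have [c' [N'' [c'0 tail]]] : exists (c : R) (N : nat), 0 < c /\ forall n, (N <= n)%N ->
    s n <= c * s n `^ (1 - lambda) /\
    forall m, \sum_(k < m) a (n + k)%N <= c * s n `^ (1 - lambda).
  by apply: KL_tail_le => //; lra.
have tau0 : 0 < 2 * lambda - 1 by lra.
have [G [M [G0 dec]]] : exists (G : R) (M : nat), [/\ 0 < G &
    forall n, (M <= n)%N -> (0 < n)%N -> s n <= G * n%:R `^ (- (2 * lambda - 1)^-1)].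
  apply: (sublinear_decay (N := maxn N N') c0 tau0 gap_ge0 gap_noninc) => n.
    by rewrite geq_max => /andP[_ /hN' /ltW].
  by rewrite geq_max subrKC => /andP[/hN].
exists (c' * G `^ (1 - lambda)), (maxn M N''); split.
  by rewrite mulr_gt0 // powR_gt0.
have powE n : c' * G `^ (1 - lambda) * n%:R `^ (- ((1 - lambda) / (2 * lambda - 1)))
    = c' * (G * n%:R `^ (- (2 * lambda - 1)^-1)) `^ (1 - lambda).
  rewrite powRM ?powR_ge0 ?(ltW G0) // -powRrM mulNr mulrA.
  by rewrite [_^-1 * (1 - lambda)]mulrC.
move=> n; rewrite powE geq_max => /andP[Mn N''n] n0.
exact: KL_decay_transfer mu0 c'0 (dec n Mn n0) (tail n N''n).
Qed.

End Exponent.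

End KLDescent.

(** * The iterates of the algorithm *)

Section Algorithm.
Context {R : realType} {H : normedVectType R} {ip : {dot H for idfun}}.
Hypothesis ip_norm : forall x, ip x x = `|x| ^+ 2.
Context {alpha kappa l : R}.
Hypotheses (kappa_ge0 : 0 <= kappa) (l_ge0 : 0 <= l).
Context {f : H -> R} {grad_f : H -> H} {g : H -> \bar R}
  {hbar : H -> R} {grad_hbar : H -> H} {hlow : H -> R}.
Hypotheses (f_grad : is_gradient ip f grad_f)
  (f_convex : alpha_convex alpha (EFin \o f)) (f_lip : kappa.-lipschitz grad_f).
Hypothesis g_proper : proper_function g.
Hypotheses (hbar_grad : is_gradient ip hbar grad_hbar)
  (hbar_lip : l.-lipschitz grad_hbar).
Context {gamma theta eta : R}.
Hypotheses (gamma_gt0 : 0 < gamma) (theta_in : 0 < theta <= 1) (eta_gt0 : 0 < eta).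
Context {x y z ys : nat -> H}.
Hypothesis algo : DRFDR ip (EFin \o f) g grad_hbar hlow gamma theta eta x y z ys.

Let theta_gt0 : 0 < theta. Proof. by case/andP: theta_in. Qed.

Lemma grad_f_iterate n : grad_f (x n.+1) = gamma^-1 *: (z n - x n.+1).
Proof. by have [_ px _ _] := algo n; exact (prox_gradient ip_norm f_grad gamma_gt0 px). Qed.

Lemma z_iterate n : z n = x n.+1 + gamma *: grad_f (x n.+1).
Proof.
by rewrite grad_f_iterate scalerA divff ?gt_eqF // scale1r addrC subrK.
Qed.

Definition g_subgradient n : H := ys n - grad_f (x n.+1) - grad_hbar (x n.+1)
  - (theta * gamma)^-1 *: (y n.+1 - x n.+1).

Definition g_value n : R := fine (g (y n.+1)).

Lemma g_iterate n : g (y n.+1) = (g_value n)%:E.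
Proof.
have [gNy [w gw]] := g_proper; have [_ _ py _] := algo n.
rewrite /g_value fineK // fin_numE gt_eqF ?gNy //=.
apply/negP => /eqP gy; have := py w; rewrite gy addye // leye_eq.
by have := gNy w; case: (g w) gw.
Qed.

(** Minimality of [y n.+1] in the proximal problem, expanded around [y n.+1]. *)
Lemma g_prox_subgradient n w :
  ((g_value n + ip (g_subgradient n) (w - y n.+1)
     - (2 * theta * gamma)^-1 * `|w - y n.+1| ^+ 2)%:E <= g w)%E.
Proof.
have [gNy _] := g_proper; have [_ _ py _] := algo n.
set p : H := (theta + 1) *: x n.+1 - theta *: z n
  - (theta * gamma) *: grad_hbar (x n.+1) + (theta * gamma) *: ys n in py.
have py_w : (g (y n.+1) + ((2 * (theta * gamma))^-1 * `|y n.+1 - p| ^+ 2)%:E <=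
  g w + ((2 * (theta * gamma))^-1 * `|w - p| ^+ 2)%:E)%E := py w.
move: py_w (gNy w); rewrite g_iterate.
case: (g w) => [b| |] //=; last by move=> _ _; rewrite leey.
move=> + _; rewrite -!EFinD !lee_fin.
rewrite (subr_split w (y n.+1) p).
move: (w - y n.+1) => q; rewrite (sqr_normD ip_norm (y n.+1 - p) q).
have pE : y n.+1 - p = (y n.+1 - x n.+1)
    + (theta * gamma) *: (grad_f (x n.+1) + grad_hbar (x n.+1) - ys n).
  by rewrite /p z_iterate prox_center opprD opprK addrA.
rewrite pE [ip (_ + _) q]ipDl ipZl /g_subgradient !ipE.
have -> : (2 * theta * gamma)^-1 = (2 * (theta * gamma))^-1 by rewrite mulrA.
have -> : (theta * gamma)^-1 = 2 * (2 * (theta * gamma))^-1.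
  by field; rewrite !gt_eqF.
have tg : 2 * ((2 * (theta * gamma))^-1 * (theta * gamma)) = 1.
  by field; rewrite !gt_eqF.
set c := (2 * (theta * gamma))^-1 in tg *; set A := `|_ + _| ^+ 2.
set T := theta * gamma in tg *.
have cancelT u k Q : c * (A + 2 * (u + T * k) + Q) = c * (A + 2 * u + Q) + k.
  by transitivity (c * (A + 2 * u + Q) + 2 * (c * T) * k); [ring|rewrite tg mul1r].
by rewrite cancelT; lra.
Qed.

(** The value at [y n.+1] of the model that [y n.+1] minimizes. *)
Definition ell n : R :=
  f (x n.+1) + ip (grad_f (x n.+1)) (y n.+1 - x n.+1)
  + (hbar (x n.+1) + ip (grad_hbar (x n.+1)) (y n.+1 - x n.+1))
  + g_value n + (2 * theta * gamma)^-1 * `|y n.+1 - x n.+1| ^+ 2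
  - hlow (y n) - ip (ys n) (y n.+1 - y n).

(** The shift of the index starts the sequence at the first iterate that the proximal
    steps produce. *)
Definition iterate n : H * H * H * H * H :=
  (x n.+1, y n.+1, z n.+1, grad_hbar (x n.+1), ys n).

(** The choice [u = grad_hbar (x n.+1)] makes the linear terms of the Lagrangian those
    of the model, and [z n.+1 - x n.+1] is a combination of the gradient of [f] and of
    [y n.+1 - x n.+1]; the coefficient of the squared norm in the Lagrangian is the one
    that leaves [(2 * theta * gamma)^-1]. *)
Lemma lagrangian_iterate n :
  lagrangian ip f g hbar hlow gamma theta eta (iterate n) = (ell n)%:E.
Proof.
have [sub _ _ zE] := algo n.
rewrite /lagrangian /iterate g_iterate (conjugate_subgradient sub).
rewrite -!EFinD /ell; congr EFin.
rewrite zE z_iterate.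
set d := y n.+1 - x n.+1.
have -> : x n.+1 + gamma *: grad_f (x n.+1) + eta *: d - x n.+1 =
  gamma *: grad_f (x n.+1) + eta *: d by rewrite addrAC [x n.+1 + _]addrC addrK.
rewrite ipDl !ipZl (ip_norm d) !ipDr !ipNr.
by field; rewrite !gt_eqF.
Qed.

(** The model attains its minimum at [y n.+1]. *)
Lemma ell_le n w (b : R) : g w = b%:E ->
  ell n <= f (x n.+1) + ip (grad_f (x n.+1)) (w - x n.+1)
  + (hbar (x n.+1) + ip (grad_hbar (x n.+1)) (w - x n.+1))
  + b + (2 * theta * gamma)^-1 * `|w - x n.+1| ^+ 2
  - hlow (y n) - ip (ys n) (w - y n).
Proof.
move=> gw; have := g_prox_subgradient n w; rewrite gw lee_fin /ell /g_subgradient.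
rewrite (subr_split w (y n.+1) (x n.+1)) (subr_split w (y n.+1) (y n)).
move: (w - y n.+1) (y n.+1 - x n.+1) (y n.+1 - y n) => q r s.
rewrite (sqr_normD ip_norm r q) !ipE.
have -> : (theta * gamma)^-1 = 2 * (2 * theta * gamma)^-1.
  by field; rewrite !gt_eqF.
lra.
Qed.

(** The update of [z] expresses [y - x] through the increment of [z], and [z] is
    [x + gamma *: grad_f x]. *)
Lemma y_minus_x n : y n.+1 - x n.+1 = eta^-1 *: ((x n.+2 - x n.+1)
  + gamma *: (grad_f (x n.+2) - grad_f (x n.+1))).
Proof.
have [_ _ _ zE] := algo n.
have : z n.+1 - z n = eta *: (y n.+1 - x n.+1) by rewrite zE addrC addKr.
rewrite !z_iterate => /(congr1 (fun v => eta^-1 *: v)).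
rewrite scalerA mulVf ?gt_eqF // scale1r => <-; congr (_ *: _).
by rewrite scalerBr opprD addrACA.
Qed.

Lemma f_taylor a b :
  - (kappa / 2 * `|b - a| ^+ 2) <= f b - f a - ip (grad_f a) (b - a)
    <= kappa / 2 * `|b - a| ^+ 2.
Proof. by rewrite -ler_norml; exact (lipschitz_gradient_taylor ip_norm f_grad f_lip a b). Qed.

Lemma hbar_taylor a b :
  - (l / 2 * `|b - a| ^+ 2) <= hbar b - hbar a - ip (grad_hbar a) (b - a)
    <= l / 2 * `|b - a| ^+ 2.
Proof. by rewrite -ler_norml; exact (lipschitz_gradient_taylor ip_norm hbar_grad hbar_lip a b). Qed.

Lemma grad_f_lip a b : `|grad_f a - grad_f b| <= kappa * `|a - b|.
Proof. exact (lipschitzE f_lip a b). Qed.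

Lemma grad_hbar_lip a b : `|grad_hbar a - grad_hbar b| <= l * `|a - b|.
Proof. exact (lipschitzE hbar_lip a b). Qed.

(** The model of index [n.+1] is evaluated at [y n.+1], which is the minimizer of the
    model of index [n], and the two models are compared. *)
Lemma ell_descent n : ell n.+1 <= ell n
  + descent_coef alpha kappa l theta eta gamma * `|x n.+2 - x n.+1| ^+ 2.
Proof.
have [sub _ _ _] := algo n; have := sub (y n.+1); rewrite -/(ip _ _) => subY.
have := ell_le n.+1 (g_iterate n).
rewrite subrr ip0r subr0 => maj.
have fconv := alpha_convex_gradient f_grad f_convex (x n.+2) (x n.+1).
have /andP[_ hup] := hbar_taylor (x n.+1) (x n.+2).
have mono := alpha_convex_monotone f_grad f_convex (x n.+1) (x n.+2).
have e_le := grad_f_lip (x n.+2) (x n.+1).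
have eb_le := grad_hbar_lip (x n.+2) (x n.+1).
have rE := y_minus_x n.
set d := x n.+2 - x n.+1 in fconv hup mono e_le eb_le rE *.
set e := grad_f (x n.+2) - grad_f (x n.+1) in mono e_le rE.
set eb := grad_hbar (x n.+2) - grad_hbar (x n.+1) in eb_le.
set r := y n.+1 - x n.+1 in rE.
have yxE : y n.+1 - x n.+2 = r - d by rewrite /r /d opprB addrA subrK.
have := descent_estimate ip_norm kappa_ge0 l_ge0 gamma_gt0 theta_in eta_gt0
  e_le eb_le mono rE.
move: maj fconv hup; rewrite yxE -[x n.+1 - x n.+2]opprB -/d normrN /ell -/r /e /eb.
clearbody d r; rewrite !ipE; lra.
Qed.

Definition F_value n : R := f (y n.+1) + g_value n + (hbar (y n.+1) - hlow (y n.+1)).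

Lemma ell_ge_F n :
  F_value n + ((theta * gamma)^-1 - kappa - l) / 2 * `|y n.+1 - x n.+1| ^+ 2 <= ell n.
Proof.
have [sub _ _ _] := algo n; have subY := sub (y n.+1).
have /andP[_ hf] := f_taylor (x n.+1) (y n.+1).
have /andP[_ hh] := hbar_taylor (x n.+1) (y n.+1).
rewrite /ell /F_value.
have -> : (theta * gamma)^-1 = 2 * (2 * theta * gamma)^-1.
  by field; rewrite !gt_eqF.
lra.
Qed.

Lemma F_ge_ell n : ell n.+1 <= F_value n
  + (kappa / 2 + l / 2 + (2 * theta * gamma)^-1) * `|y n.+1 - x n.+2| ^+ 2.
Proof.
have := ell_le n.+1 (g_iterate n); rewrite subrr ip0r subr0 => maj.
have /andP[hf _] := f_taylor (x n.+2) (y n.+1).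
have /andP[hh _] := hbar_taylor (x n.+2) (y n.+1).
rewrite /F_value; lra.
Qed.

Definition step n : R := `|x n.+2 - x n.+1|.

Lemma step_ge0 n : 0 <= step n. Proof. exact: normr_ge0. Qed.

Let r0 : R := eta^-1 * (1 + gamma * kappa).

Let r0_ge0 : 0 <= r0.
Proof. by rewrite mulr_ge0 ?invr_ge0 ?addr_ge0 ?mulr_ge0 ?(ltW eta_gt0) ?(ltW gamma_gt0). Qed.

Lemma resolvent_lip a b :
  `|(a + gamma *: grad_f a) - (b + gamma *: grad_f b)| <= (1 + gamma * kappa) * `|a - b|.
Proof.
rewrite opprD addrACA -scalerBr mulrDl mul1r; apply: le_trans (ler_normD _ _) _.
by rewrite lerD2l normrZ (gtr0_norm gamma_gt0) -mulrA ler_pM2l // grad_f_lip.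
Qed.

Lemma y_minus_x_le n : `|y n.+1 - x n.+1| <= r0 * step n.
Proof.
rewrite y_minus_x normrZ gtr0_norm ?invr_gt0 // /r0 -mulrA ler_pM2l ?invr_gt0 //.
by have := resolvent_lip (x n.+2) (x n.+1); rewrite opprD addrACA -scalerBr.
Qed.

Lemma z_step_le n : `|z n.+1 - z n| <= (1 + gamma * kappa) * step n.
Proof. by rewrite !z_iterate resolvent_lip. Qed.

Lemma y_step_le n : `|y n.+2 - y n.+1| <= (1 + r0) * (step n.+1 + step n).
Proof.
have -> : y n.+2 - y n.+1 = (y n.+2 - x n.+2) + ((x n.+2 - x n.+1) - (y n.+1 - x n.+1)).
  by rewrite addrA subrKA opprB addrA subrK.
have h1 := y_minus_x_le n.+1; have h2 := y_minus_x_le n.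
have h3 := ler_normD (y n.+2 - x n.+2) ((x n.+2 - x n.+1) - (y n.+1 - x n.+1)).
have h4 := ler_normB (x n.+2 - x n.+1) (y n.+1 - x n.+1).
have := step_ge0 n.+1; rewrite /step in h1 h2 *; lra.
Qed.

Lemma z_minus_x n : z n.+1 - x n.+1 = gamma *: grad_f (x n.+1) + eta *: (y n.+1 - x n.+1).
Proof.
have [_ _ _ ->] := algo n; rewrite {1}z_iterate.
by rewrite addrAC [x n.+1 + _]addrC addrK.
Qed.

Let c : R := (2 * eta * theta - 1) / (2 * theta * gamma).

(** All components of the subgradient are multiples of [y n.+1 - x n.+1], except for
    [y n - y n.+1]: the gradients cancel by the choice of [u] and [v]. *)
Lemma iterate_subgradient n : exists2 u,
  limiting_subdiff (ip5 ip) (lagrangian ip f g hbar hlow gamma theta eta) (iterate n) u &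
  ipnorm (ip5 ip) (0 - u) <= (`|2 * c - gamma^-1 * (1 + eta)|
    + `|gamma^-1 * eta - (theta * gamma)^-1 - 2 * c| + gamma^-1 + 1)
    * `|y n.+1 - x n.+1| + `|y n.+1 - y n|.
Proof.
have [sub _ _ _] := algo n.
have t0 : 0 <= (2 * theta * gamma)^-1 by rewrite invr_ge0 !mulr_ge0 // ltW.
exists (lagrangian_subgradient (grad_f := grad_f) (grad_hbar := grad_hbar)
  (gamma := gamma) (theta := theta) (eta := eta) (x n.+1) (y n.+1) (z n.+1)
  (grad_hbar (x n.+1)) (ys n) (y n) (g_subgradient n)).
  apply: regular_limiting_subdiff.
  refine (lagrangian_regular_subdiff ip_norm kappa_ge0 l_ge0 f_grad f_lip hbar_grad
    hbar_lip gamma_gt0 _ _ _ (g_iterate n) t0 (g_prox_subgradient n) sub).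
rewrite /lagrangian_subgradient -/c z_minus_x /g_subgradient.
set r := y n.+1 - x n.+1.
have -> : grad_f (x n.+1) + grad_hbar (x n.+1) + (- grad_hbar (x n.+1) - gamma^-1 *: r
     - gamma^-1 *: (gamma *: grad_f (x n.+1) + eta *: r) + (2 * c) *: r) =
   (2 * c - gamma^-1 * (1 + eta)) *: r.
  by clearbody r; apply: (ip_ext ip_norm) => w; rewrite !ipE; field; rewrite gt_eqF.
have -> : ys n - grad_f (x n.+1) - grad_hbar (x n.+1) - (theta * gamma)^-1 *: r
   + (grad_hbar (x n.+1) - ys n + gamma^-1 *: (gamma *: grad_f (x n.+1) + eta *: r)
     - (2 * c) *: r) = (gamma^-1 * eta - (theta * gamma)^-1 - 2 * c) *: r.
  by clearbody r; apply: (ip_ext ip_norm) => w; rewrite !ipE; field; rewrite !gt_eqF.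
apply: le_trans (ipnorm5_le_sum ip_norm _) _ => /=.
rewrite !sub0r !normrN !normrZ (gtr0_norm (x := gamma^-1)) ?invr_gt0 //.
rewrite [`|y n - y n.+1|]distrC; lra.
Qed.

Hypotheses (alpha_ge : - kappa <= alpha)
  (params : [\/ condition_a alpha kappa l theta eta gamma,
                condition_b alpha kappa l theta eta gamma
              | condition_c kappa l theta eta gamma]).
Hypotheses (g_lsc : lower_semicontinuous g) (hlow_cont : continuous hlow).
Context {F : H -> \bar R}.
Hypothesis F_def : forall p, F p = ((f p)%:E + g p + (hbar p - hlow p)%:E)%E.
Hypothesis F_coercive : coercive F.

Let delta : R := - descent_coef alpha kappa l theta eta gamma.

Let delta_gt0 : 0 < delta.
Proof. by rewrite oppr_gt0; apply: stepsize_descent. Qed.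

Lemma ell_decrease n : delta * step n ^+ 2 <= ell n - ell n.+1.
Proof. by have := ell_descent n; rewrite /delta /step; lra. Qed.

Lemma ell_noninc n : ell n.+1 <= ell n.
Proof.
have := ell_decrease n; have : 0 <= delta * step n ^+ 2.
  by rewrite mulr_ge0 ?sqr_ge0 // ltW.
lra.
Qed.

(** If [alpha > kappa], strong monotonicity contradicts the Lipschitz bound unless
    all points coincide; otherwise [stepsize_bound] applies. *)
Lemma proximal_gap_ge0 (a b : H) :
  0 <= ((theta * gamma)^-1 - kappa - l) / 2 * `|b - a| ^+ 2.
Proof.
have [ak|ka] := leP alpha kappa.
  have tg : 0 < theta * gamma by rewrite mulr_gt0.
  have := stepsize_bound kappa_ge0 l_ge0 gamma_gt0 theta_in eta_gt0 params ak.
  rewrite mulrC -ltr_pdivlMr // div1r => h.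
  by rewrite mulr_ge0 ?sqr_ge0 // divr_ge0 // -addrA -opprD subr_ge0 ltW.
suff -> : `|b - a| ^+ 2 = 0 by rewrite mulr0.
have mono := alpha_convex_monotone f_grad f_convex a b.
have := ip_le ip_norm (grad_f b - grad_f a) (b - a).
have := ler_wpM2r (normr_ge0 (b - a)) (grad_f_lip b a).
have N0 := sqr_ge0 `|b - a|.
rewrite -mulrA -expr2 => h1 h2.
apply/eqP; rewrite eq_le N0 andbT -(pmulr_rle0 _ (x := alpha - kappa)) ?subr_gt0 //.
lra.
Qed.

Lemma F_iterate n : F (y n.+1) = (F_value n)%:E.
Proof. by rewrite F_def g_iterate -!EFinD. Qed.

Lemma F_le_ell n : F_value n <= ell n.
Proof. by have := ell_ge_F n; have := proximal_gap_ge0 (x n.+1) (y n.+1); lra. Qed.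

Lemma f_continuous : continuous f.
Proof. by move=> p; apply: differentiable_continuous; have [] := f_grad p. Qed.

Lemma hbar_continuous : continuous hbar.
Proof. by move=> p; apply: differentiable_continuous; have [] := hbar_grad p. Qed.

(** Coercivity outside a ball; inside, lower semicontinuity and compactness. *)
Lemma F_bounded_below : exists m : R, forall p, (m%:E <= F p)%E.
Proof.
have [B FB] := F_coercive 0.
have [m1 Fm1] : exists m : R, forall p : H, `|p| <= B -> (m%:E <= F p)%E.
  have [gNy _] := g_proper.
  apply: (compact_induction (@compact_closed_ball0 _ _ _ ip_norm B)
    (Q := fun U : set H => exists m : R, forall p, U p -> (m%:E <= F p)%E)).
  - by exists 0.
  - by move=> U V UV [m Fm]; exists m => p /UV /Fm.
  - move=> U V [m Fm] [m' Fm']; exists (Num.min m m') => p [Up|Vp].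
      by apply: le_trans (Fm _ Up); rewrite lee_fin ge_min lexx.
    by apply: le_trans (Fm' _ Vp); rewrite lee_fin ge_min lexx orbT.
  - move=> p _.
    have [b bg] : exists b : R, (b%:E < g p)%E.
      have := gNy p; case: (g p) => [b| |] // _; last by exists 0; rewrite ltry.
      by exists (b - 1); rewrite lte_fin; lra.
    have [V pV gV] := g_lsc bg.
    pose q t := f t + (hbar t - hlow t).
    have q_cont : {for p, continuous q}.
      apply: continuousD; first exact: f_continuous.
      by apply: continuousB; [exact: hbar_continuous|exact: hlow_cont].
    have qV : \forall t \near p, q p - 1 < q t.
      by apply: (cvgr_gt (q p)) => //; lra.
    exists [set t | V t /\ q p - 1 < q t]; first by apply: filterI.
    exists (b + (q p - 1)) => t [/gV bt qt]; rewrite F_def.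
    have -> : ((f t)%:E + g t + (hbar t - hlow t)%:E = g t + (q t)%:E)%E.
      by rewrite /q (EFinD (f t)) addeA (addeC (g t)).
    by rewrite EFinD; apply: leeD; [exact: ltW|rewrite lee_fin ltW].
exists (Num.min m1 0) => p; have [pB|Bp] := leP `|p| B.
  by apply: le_trans (Fm1 _ pB); rewrite lee_fin ge_min lexx.
by apply: le_trans (ltW (FB _ Bp)); rewrite lee_fin ge_min lexx orbT.
Qed.

Lemma ell_le0 n : ell n <= ell 0%N.
Proof. by elim: n => [//|n IH]; apply: le_trans IH; exact: ell_noninc. Qed.

Lemma ell_bounded_below : exists m : R, forall n, m <= ell n.
Proof.
have [m Fm] := F_bounded_below; exists m => n.
by have := Fm (y n.+1); rewrite F_iterate lee_fin => h; apply: le_trans (F_le_ell n).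
Qed.

Lemma ell_is_cvg : exists vlim : R, ell @ \oo --> vlim.
Proof.
have [m hm] := ell_bounded_below; exists (limn ell).
apply: nonincreasing_is_cvgn.
  by apply/nonincreasing_seqP => n; exact: ell_noninc.
by exists m => _ [n _ <-]; exact: hm.
Qed.

Lemma step_cvg0 : step @ \oo --> 0.
Proof.
have [vlim ell_v] := ell_is_cvg.
have diff0 : ell n - ell n.+1 @[n --> \oo] --> 0.
  by rewrite -(subrr vlim); apply: (cvgB ell_v); rewrite (cvg_shiftS ell).
apply/cvgrPdist_lt => e e0.
have : \forall n \near \oo, ell n - ell n.+1 < delta * e ^+ 2.
  by apply: (cvgr_lt 0) => //; rewrite mulr_gt0 // exprn_gt0.
apply: filterS => n /(le_lt_trans (ell_decrease n)).
rewrite ltr_pM2l // sub0r normrN ger0_norm ?step_ge0 //.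
by rewrite ltr_pXn2r ?nnegrE ?step_ge0 // ltW.
Qed.

(** Coercivity bounds [y], and the other sequences follow by Lipschitz estimates,
    except for the subgradients [ys], which the oscillation of [hlow] on a slightly
    larger ball bounds. *)
Lemma iterate_bounded : exists M : R, forall n,
  [/\ `|x n.+1| <= M, `|y n.+1| <= M, `|z n.+1| <= M, `|grad_hbar (x n.+1)| <= M
    & `|ys n| <= M].
Proof.
have [m ell_m] := ell_bounded_below.
have [B FB] := F_coercive (ell 0%N).
have yB n : `|y n.+1| <= B.
  rewrite leNgt; apply/negP => /FB; rewrite F_iterate lte_fin.
  by have := le_trans (F_le_ell n) (ell_le0 n); lra.
have [S stepS] : exists S, forall n, step n <= S.
  exists (Num.sqrt ((ell 0%N - m) / delta)) => n.
  have e0 : 0 <= (ell 0%N - m) / delta by rewrite divr_ge0 ?subr_ge0 // ltW.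
  rewrite -(@ler_pXn2r _ 2) ?nnegrE ?sqrtr_ge0 ?step_ge0 // sqr_sqrtr //.
  rewrite ler_pdivlMr // mulrC; apply: le_trans (ell_decrease n) _.
  by rewrite lerB // ell_le0.
have S0 : 0 <= S by apply: le_trans (stepS 0%N); exact: step_ge0.
pose Mx := B + r0 * S.
have xM n : `|x n.+1| <= Mx.
  have -> : x n.+1 = y n.+1 - (y n.+1 - x n.+1) by rewrite subKr.
  apply: le_trans (ler_normB _ _) _; apply: lerD => //.
  by apply: le_trans (y_minus_x_le n) _; rewrite ler_wpM2l.
have Mx0 : 0 <= Mx by apply: le_trans (xM 0%N).
have lip_bound (G : H -> H) (k : R) : 0 <= k ->
    (forall a b, `|G a - G b| <= k * `|a - b|) ->
    forall n, `|G (x n.+1)| <= `|G 0| + k * Mx.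
  move=> k0 Glip n.
  have -> : G (x n.+1) = G 0 + (G (x n.+1) - G 0) by rewrite addrC subrK.
  apply: le_trans (ler_normD _ _) _; rewrite lerD2l.
  by apply: le_trans (Glip _ _) _; rewrite subr0 ler_wpM2l.
have gfM := lip_bound _ _ kappa_ge0 grad_f_lip.
have ghM := lip_bound _ _ l_ge0 grad_hbar_lip.
pose Mz := Mx + gamma * (`|grad_f 0| + kappa * Mx).
have zM n : `|z n.+1| <= Mz.
  rewrite z_iterate; apply: le_trans (ler_normD _ _) _.
  by apply: lerD => //; rewrite normrZ gtr0_norm // ler_wpM2l // ltW.
pose By := Num.max B `|y 0%N|.
have yBy n : `|y n| <= By.
  by case: n => [|n]; rewrite /By le_max ?lexx ?orbT // yB.
have [h1 [h2 hh]] : exists h1 h2 : R, forall p : H, `|p| <= By + 1 -> h1 <= hlow p <= h2.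
  apply: (compact_induction (@compact_closed_ball0 _ _ _ ip_norm (By + 1))
    (Q := fun U : set H => exists h1 h2 : R, forall p, U p -> h1 <= hlow p <= h2)).
  - by exists 0, 0.
  - by move=> U V UV [a [b h]]; exists a, b => p /UV /h.
  - move=> U V [a [b h]] [a' [b' h']]; exists (Num.min a a'), (Num.max b b') => p.
    by rewrite ge_min le_max => -[/h|/h'] /andP[-> ->]; rewrite ?orbT.
  - move=> p _; exists [set q | hlow p - 1 < hlow q /\ hlow q < hlow p + 1].
      apply: filterI; first by apply: (cvgr_gt (hlow p)); [exact: hlow_cont|lra].
      by apply: (cvgr_lt (hlow p)); [exact: hlow_cont|lra].
    by exists (hlow p - 1), (hlow p + 1) => q [/ltW -> /ltW ->].
have vM n : `|ys n| <= h2 - h1.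
  have [sub _ _ _] := algo n.
  have := hh (y n); rewrite (le_trans (yBy n)) ?lerDl // => /(_ isT)/andP[lo up].
  have [v0|v0] := eqVneq (ys n) 0; first by rewrite v0 normr0 subr_ge0; lra.
  have nv : 0 < `|ys n| by rewrite normr_gt0.
  pose e := `|ys n|^-1 *: ys n.
  have ne : `|e| = 1 by rewrite /e normrZ gtr0_norm ?invr_gt0 // mulVf ?gt_eqF.
  have ipe : ip (ys n) e = `|ys n|.
    by rewrite /e ipZr ip_norm expr2 mulrA mulVf ?gt_eqF // mul1r.
  have := sub (y n + e); rewrite addrAC subrr add0r ipe => h.
  have := hh (y n + e); rewrite (le_trans (ler_normD _ _)) ?ne ?lerD2r //.
  by move=> /(_ isT)/andP[_]; lra.
exists (Num.max Mx (Num.max B (Num.max Mz (Num.max (`|grad_hbar 0| + l * Mx) (h2 - h1))))).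
by move=> n; rewrite !le_max xM yB zM ghM vM !orbT.
Qed.

Lemma cvg_y_minus_x : (fun n => y n.+1 - x n.+1) @ \oo --> (0 : H).
Proof.
by apply: cvg_dominated step_cvg0 => n; rewrite subr0; exact: y_minus_x_le.
Qed.

Lemma cvg_y_step : (fun n => y n.+1 - y n) @ \oo --> (0 : H).
Proof.
rewrite -cvg_shiftS.
apply: (@cvg_dominated _ _ _ (fun n => step n.+1 + step n) (1 + r0)) => [n|].
  by rewrite subr0; exact: y_step_le.
by rewrite -[X in _ --> X](addr0 0); apply: cvgD step_cvg0; rewrite cvg_shiftS; exact: step_cvg0.
Qed.

Lemma grad_f_continuous : continuous grad_f.
Proof. exact (lipschitz_continuous kappa_ge0 f_lip). Qed.

Lemma grad_hbar_continuous : continuous grad_hbar.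
Proof. exact (lipschitz_continuous l_ge0 hbar_lip). Qed.

(** What the limit of the iterates retains: [pv] is a subgradient of [hlow], and a
    paraboloid with slope [pv - grad_f pt - grad_hbar pt] touches [g] from below at
    [pt]. *)
Definition critical_data (vlim : R) (pt pv : H) (G : R) :=
  [/\ g pt = G%:E, vlim = f pt + hbar pt + G - hlow pt, convex_subdiff ip hlow pt pv
    & forall w, ((G + ip (pv - grad_f pt - grad_hbar pt) (w - pt)
        - (2 * theta * gamma)^-1 * `|w - pt| ^+ 2)%:E <= g w)%E].

(** The minimality of [y n.+1] passes to the limit. Compared with [w = py] it bounds
    [g py] below by the limit [G] of the values of [g]; lower semicontinuity gives the
    other inequality. *)
Lemma cluster_iterate (vlim : R) p : ell @ \oo --> vlim -> cluster (iterate @ \oo) p ->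
  exists (pt pv : H) (G : R), p = (pt, pt, pt + gamma *: grad_f pt, grad_hbar pt, pv)
    /\ critical_data vlim pt pv G.
Proof.
move=> ell_v /cluster_subsequence[sigma sigma_ge].
case: p => [[[[px py] pz] pu] pv] wp.
have [/= wp4 vp] := cvg_proj _ wp; have [/= wp3 up] := cvg_proj _ wp4.
have [/= wp2 zp] := cvg_proj _ wp3; have [/= xp yp] := cvg_proj _ wp2.
have rp : y (sigma k).+1 - x (sigma k).+1 @[k --> \oo] --> (0 : H).
  exact: (cvg_subsequence sigma_ge cvg_y_minus_x).
have dp : y (sigma k).+1 - y (sigma k) @[k --> \oo] --> (0 : H).
  exact: (cvg_subsequence sigma_ge cvg_y_step).
have pyx : py = px.
  have : y (sigma k).+1 - (y (sigma k).+1 - x (sigma k).+1) @[k --> \oo] --> py - 0.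
    exact: cvgB.
  under eq_fun do rewrite subKr; rewrite subr0 => h.
  exact: (cvg_unique _ h xp).
subst px.
have yp' : y (sigma k) @[k --> \oo] --> py.
  have : y (sigma k).+1 - (y (sigma k).+1 - y (sigma k)) @[k --> \oo] --> py - 0.
    exact: cvgB.
  by under eq_fun do rewrite subKr; rewrite subr0.
have gfp : grad_f (x (sigma k).+1) @[k --> \oo] --> grad_f py.
  exact (cvg_image _ grad_f_continuous xp).
have ghp : grad_hbar (x (sigma k).+1) @[k --> \oo] --> grad_hbar py.
  exact (cvg_image _ grad_hbar_continuous xp).
have puE : pu = grad_hbar py by exact: (cvg_unique _ up ghp).
have pzE : pz = py + gamma *: grad_f py.
  have : x (sigma k).+1 + (gamma *: grad_f (x (sigma k).+1)
      + eta *: (y (sigma k).+1 - x (sigma k).+1)) @[k --> \oo]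
      --> py + (gamma *: grad_f py + eta *: 0).
    by apply: cvgD => //; apply: cvgD; apply: cvgZl_tmp.
  under eq_fun do rewrite -z_minus_x addrC subrK.
  by rewrite scaler0 addr0 => h; exact: (cvg_unique _ zp h).
have fp : f (x (sigma k).+1) @[k --> \oo] --> f py.
  exact (cvg_image _ f_continuous xp).
have hp : hbar (x (sigma k).+1) @[k --> \oo] --> hbar py.
  exact (cvg_image _ hbar_continuous xp).
have hlp : hlow (y (sigma k)) @[k --> \oo] --> hlow py.
  exact (cvg_image _ hlow_cont yp').
have ellp : ell (sigma k) @[k --> \oo] --> vlim by exact: cvg_subsequence.
(* [ell n] is [g (y n.+1)] plus a model built from smooth data only, so the
   convergence of [ell] forces that of the values of [g] along the subsequence. *)
pose model w n := f (x n.+1) + ip (grad_f (x n.+1)) (w n - x n.+1)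
  + (hbar (x n.+1) + ip (grad_hbar (x n.+1)) (w n - x n.+1))
  + (2 * theta * gamma)^-1 * `|w n - x n.+1| ^+ 2
  - hlow (y n) - ip (ys n) (w n - y n).
have model_cvg (w : nat -> H) (q : H) : w (sigma k) @[k --> \oo] --> q ->
    model w (sigma k) @[k --> \oo] --> f py + ip (grad_f py) (q - py)
      + (hbar py + ip (grad_hbar py) (q - py)) + (2 * theta * gamma)^-1 * `|q - py| ^+ 2
      - hlow py - ip pv (q - py).
  move=> wq.
  have wx : w (sigma k) - x (sigma k).+1 @[k --> \oo] --> q - py by exact: cvgB.
  have wy : w (sigma k) - y (sigma k) @[k --> \oo] --> q - py by exact: cvgB.
  apply: cvgB; last exact: (cvg_ip ip_norm).
  apply: cvgB => //; apply: cvgD.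
    by apply: cvgD; apply: cvgD => //; exact: (cvg_ip ip_norm).
  apply: cvgM; first exact: cvg_cst.
  by rewrite expr2; under eq_fun do rewrite expr2; apply: cvgM; exact: cvg_norm.
have ell_model n : ell n = g_value n + model (fun n => y n.+1) n by rewrite /ell /model; ring.
pose G := vlim - (f py + hbar py - hlow py).
have g_cvg : g_value (sigma k) @[k --> \oo] --> G.
  have := cvgB ellp (model_cvg (fun n => y n.+1) py yp).
  rewrite subrr !ip0r normr0 expr0n /= !(mulr0, addr0, subr0) => h.
  have -> : (fun k => g_value (sigma k)) =
      (fun k => ell (sigma k) - model (fun n => y n.+1) (sigma k)).
    by apply/funext => k; rewrite ell_model addrK.
  exact: h.
have subv : convex_subdiff ip hlow py pv.
  move=> q.
  have lim_q : hlow (y (sigma k)) + ip (ys (sigma k)) (q - y (sigma k)) @[k --> \oo]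
      --> hlow py + ip pv (q - py).
    by apply: cvgD => //; apply: (cvg_ip ip_norm) => //; apply: cvgB => //; exact: cvg_cst.
  apply: (ler_cvg_to lim_q (cvg_cst (hlow q))).
  by apply: nearW => k; have [sub _ _ _] := algo (sigma k); exact: sub.
have g_model (w : H) (b : R) : g w = b%:E -> vlim <= b + (f py + ip (grad_f py) (w - py)
      + (hbar py + ip (grad_hbar py) (w - py)) + (2 * theta * gamma)^-1 * `|w - py| ^+ 2
      - hlow py - ip pv (w - py)).
  move=> gw; apply: (ler_cvg_to ellp (cvgD (cvg_cst b) (model_cvg (cst w) w (cvg_cst _)))).
  apply: nearW => k; change (ell (sigma k) <= b + model (cst w) (sigma k)).
  by have := ell_le (sigma k) gw; rewrite /model /=; lra.
have g_le : (g py <= G%:E)%E.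
  rewrite leNgt; apply/negP => Gg.
  have [b [Gb bg]] : exists b : R, G < b /\ (b%:E < g py)%E.
    case: (g py) Gg => [b| |] //; last by exists (G + 1); rewrite ltry; split => //; lra.
    by rewrite lte_fin => Gb; exists ((G + b) / 2); rewrite lte_fin; split; lra.
  have [V pV gV] := g_lsc bg.
  have [k [Vk bk]] : exists k, V (y (sigma k).+1) /\ g_value (sigma k) < b.
    have nb : \forall k \near \oo, V (y (sigma k).+1) /\ g_value (sigma k) < b.
      have Vk : \forall k \near \oo, V (y (sigma k).+1) := yp _ pV.
      have bk : \forall k \near \oo, g_value (sigma k) < b by apply: (cvgr_lt G).
      exact: filterI Vk bk.
    by have [k] := filter_ex nb; exists k.
  by have := gV _ Vk; rewrite g_iterate lte_fin; lra.
have [G1 gpy] : exists G1, g py = G1%:E.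
  have [gNy _] := g_proper; have := gNy py.
  by case: (g py) g_le => [b| |] // _ _; exists b.
have GE : G1 = G.
  apply/eqP; rewrite eq_le -lee_fin -gpy g_le /=.
  have := g_model _ _ gpy; rewrite subrr !ip0r normr0 expr0n /= /G; lra.
exists py, pv, G; split; first by rewrite pzE puE.
split => //; [by rewrite gpy GE|by rewrite /G; lra|].
move=> w; have [gNy _] := g_proper; have := gNy w; have := g_model w.
case: (g w) => [b| |] //; last by rewrite leey.
move=> /(_ b erefl) h _; rewrite lee_fin !ipDl !ipNl /G; lra.
Qed.

Let L := lagrangian ip f g hbar hlow gamma theta eta.

Let prox_const_ge0 : 0 <= (2 * theta * gamma)^-1.
Proof. by rewrite invr_ge0 !mulr_ge0 // ltW. Qed.

Lemma critical_point_lagrangian vlim pt pv G : critical_data vlim pt pv G ->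
  let p := (pt, pt, pt + gamma *: grad_f pt, grad_hbar pt, pv) in
  L p = vlim%:E /\ dom_subdiff (ip5 ip) L p.
Proof.
move=> [gpt vE subv gprox] p; split.
  rewrite /L /p (lagrangian_finite _ _ _ gpt subv) vE.
  by congr EFin; rewrite /coupling subrr !ip0r normr0; ring.
eexists; apply: regular_limiting_subdiff.
exact (lagrangian_regular_subdiff ip_norm kappa_ge0 l_ge0 f_grad f_lip hbar_grad
    hbar_lip gamma_gt0 _ _ _ gpt prox_const_ge0 gprox subv).
Qed.

Let Csub : R := (`|2 * c - gamma^-1 * (1 + eta)|
    + `|gamma^-1 * eta - (theta * gamma)^-1 - 2 * c| + gamma^-1 + 1) * r0 + (1 + r0).

Let Csub_gt0 : 0 < Csub.
Proof.
rewrite ltr_wpDl // ?ltr_wpDr // mulr_ge0 // !addr_ge0 // invr_ge0 ltW //.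
Qed.

Lemma iterate_subgradient_step n : exists2 u, limiting_subdiff (ip5 ip) L (iterate n.+1) u &
  ipnorm (ip5 ip) (0 - u) <= Csub * (step n.+1 + step n).
Proof.
have [u Lu u_le] := iterate_subgradient n.+1; exists u => //.
apply: le_trans u_le _; rewrite /Csub [leRHS]mulrDl; apply: lerD; last exact: y_step_le.
rewrite -[leRHS]mulrA; apply: ler_pM => //.
  by rewrite !addr_ge0 // invr_ge0 ltW.
apply: le_trans (y_minus_x_le n.+1) _.
by rewrite ler_wpM2l // lerDl step_ge0.
Qed.

Lemma iterate_compact : exists2 A : set (H * H * H * H * H), compact A &
  forall n, A (iterate n).
Proof.
have [M hM] := iterate_bounded.
have B := @compact_closed_ball0 _ _ _ ip_norm M.
exists ([set x : H | `|x| <= M] `*` [set x : H | `|x| <= M] `*` [set x : H | `|x| <= M]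
    `*` [set x : H | `|x| <= M] `*` [set x : H | `|x| <= M]).
  by do 4!apply: compact_setX => //.
by move=> n; have [h1 h2 h3 h4 h5] := hM n.
Qed.

Lemma cluster_critical vlim : ell @ \oo --> vlim -> forall p,
  cluster (iterate @ \oo) p -> L p = vlim%:E /\ dom_subdiff (ip5 ip) L p.
Proof.
move=> ell_v p /(cluster_iterate ell_v)[pt [pv [G [-> cd]]]].
exact: critical_point_lagrangian cd.
Qed.

Lemma steps_summable : KL_function (ip5 ip) L ->
  exists M : R, forall m, \sum_(k < m) step k <= M.
Proof.
move=> L_KL; have [vlim ell_v] := ell_is_cvg; have [A A_comp A_it] := iterate_compact.
exact: (KL_finite_length (ipnorm5_le ip_norm) delta_gt0 Csub_gt0 step_ge0
  lagrangian_iterate ell_decrease ell_v iterate_subgradient_step A_comp A_it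
  (cluster_critical ell_v) L_KL).
Qed.

(** The remaining length [T] of the path of [x] dominates the steps and the distances
    to the limit, and it inherits every bound on the partial sums of the steps. *)
Lemma steps_limit : KL_function (ip5 ip) L ->
  exists (vlim : R) (pt pv : H) (G : R) (T : nat -> R),
    [/\ ell @ \oo --> vlim, critical_data vlim pt pv G, T @ \oo --> 0,
        (forall n B, (forall m, \sum_(k < m) step (n + k)%N <= B) -> T n <= B)
      & forall n, [/\ step n <= T n, T n.+1 <= T n & `|x n.+1 - pt| <= T n]].
Proof.
move=> L_KL; have [vlim ell_v] := ell_is_cvg; have [A A_comp A_it] := iterate_compact.
have [M hM] := steps_summable L_KL.
have A_near : (iterate @ \oo) A by exists 0%N => // n _; exact: A_it.
have [p [_ wp]] := A_comp (iterate @ \oo) _ A_near.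
have [pt [pv [G [pE cd]]]] := cluster_iterate ell_v wp.
have [sigma sigma_ge sigma_p] := cluster_subsequence wp.
have xsigma : x (sigma k).+1 @[k --> \oo] --> pt.
  move: sigma_p; rewrite pE => h; have [/= h1 _] := cvg_proj _ h.
  have [/= h2 _] := cvg_proj _ h1; have [/= h3 _] := cvg_proj _ h2.
  by have [/= h4 _] := cvg_proj _ h3.
pose S m := \sum_(k < m) step k.
have S_nd : nondecreasing_seq S.
  by apply/nondecreasing_seqP => n; rewrite /S big_ord_recr /= lerDl step_ge0.
have S_cvg : S @ \oo --> limn S.
  by apply: nondecreasing_is_cvgn => //; exists M => _ [n _ <-]; exact: hM.
(* [T n] is the sum of the steps from the index [n] on. *)
pose T n := limn S - S n.
have S_le n : S n <= limn S.
  by apply: nondecreasing_cvgn_le => //; apply/cvg_ex; exists (limn S).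
have S_split n m : S (n + m)%N - S n = \sum_(k < m) step (n + k)%N.
  by rewrite /S big_split_ord /= addrAC subrr add0r.
have tail_le n B : (forall m, \sum_(k < m) step (n + k)%N <= B) -> T n <= B.
  move=> hB; rewrite lerBlDr; apply: (@limr_le _ _ _ _ _ _ _ _).
    by apply/cvg_ex; exists (limn S).
  exists n => // m /= /subnKC nm; rewrite -nm -lerBlDr S_split; exact: hB.
have dist_le n m : `|x (n + m).+1 - x n.+1| <= S (n + m)%N - S n.
  rewrite S_split; elim: m => [|m IH]; first by rewrite addn0 subrr normr0 big_ord0.
  rewrite big_ord_recr /= addnS.
  rewrite (subr_split _ (x (n + m).+1)); apply: le_trans (ler_normD _ _) _.
  exact: lerD.
exists vlim, pt, pv, G, T; split => //.
  by rewrite /T -(subrr (limn S)); apply: cvgB S_cvg; exact: cvg_cst.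
move=> n; split.
- have := S_le n.+1; rewrite /S big_ord_recr /= -/(S n) /T; lra.
- by rewrite lerB // S_nd.
- have lim_d : `|x (sigma k).+1 - x n.+1| @[k --> \oo] --> `|pt - x n.+1|.
    by apply: cvg_norm; apply: cvgB => //; exact: cvg_cst.
  rewrite distrC; apply: (ler_cvg_to lim_d (cvg_cst (T n))).
  exists n => // k /= nk; have /subnKC <- := leq_trans nk (sigma_ge k).
  by apply: le_trans (dist_le _ _) _; rewrite lerB.
Unshelve. all: by [].
Qed.

Definition dist_const : R := 1 + (r0 + 1) + (1 + gamma * kappa).

Lemma dist_const_ge1 : 1 <= dist_const.
Proof.
have := r0_ge0; have : 0 <= gamma * kappa by rewrite mulr_ge0 // ltW.
by rewrite /dist_const; lra.
Qed.

Lemma iterates_step_le n :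
  ipnorm (ip3 ip) ((x n.+2, y n.+2, z n.+2) - (x n.+1, y n.+1, z n.+1))
    <= dist_const * (step n.+1 + step n).
Proof.
apply: le_trans (ipnorm3_le_sum ip_norm _) _ => /=.
have := y_step_le n; have := z_step_le n.+1; have s0 := step_ge0 n; have s1 := step_ge0 n.+1.
have : 0 <= gamma * kappa * step n by rewrite !mulr_ge0 // ltW.
rewrite -[`|x n.+2 - x n.+1|]/(step n) /dist_const; lra.
Qed.

Lemma iterates_finite_length : KL_function (ip5 ip) L ->
  (\sum_(1 <= n <oo) (ipnorm (ip3 ip)
     ((x n.+1, y n.+1, z n.+1) - (x n, y n, z n)))%:E < +oo)%E.
Proof.
move=> L_KL; have [M hM] := steps_summable L_KL.
have D0 : 0 <= dist_const by have := dist_const_ge1; lra.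
apply: (@le_lt_trans _ _ (dist_const * (M + M))%:E); last exact: ltry.
apply: lime_le.
  by apply: is_cvg_nneseries => n _ _; rewrite lee_fin sqrtr_ge0.
apply: nearW => -[|n]; first by rewrite big_geq // lee_fin mulr_ge0 // addr_ge0 //
  (le_trans _ (hM 0%N)) // big_ord0.
rewrite sumEFin lee_fin big_add1 /= big_mkord.
apply: (@le_trans _ _ (\sum_(k < n) dist_const * (step k.+1 + step k))).
  by apply: ler_sum => k _; exact: iterates_step_le.
rewrite -mulr_sumr ler_wpM2l // big_split /= lerD // ?hM //.
by apply: le_trans (hM n.+1); rewrite [leRHS]big_ord_recl /= lerDr step_ge0.
Qed.

Section Distances.
Context {vlim G : R} {pt pv : H} {T : nat -> R}.
Hypotheses (ell_v : ell @ \oo --> vlim) (cd : critical_data vlim pt pv G).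
Hypothesis T_P : forall n, [/\ step n <= T n, T n.+1 <= T n & `|x n.+1 - pt| <= T n].

Lemma y_dist_le n : `|y n.+1 - pt| <= (r0 + 1) * T n.
Proof.
have [sT _ xT] := T_P n.
rewrite (subr_split _ (x n.+1)) addrC; apply: le_trans (ler_normD _ _) _.
rewrite mulrDl mul1r; apply: lerD => //; apply: le_trans (y_minus_x_le n) _.
by rewrite ler_wpM2l.
Qed.

Lemma z_dist_le n : `|z n.+1 - (pt + gamma *: grad_f pt)| <= (1 + gamma * kappa) * T n.
Proof.
have [_ TT _] := T_P n; have [_ _ xT] := T_P n.+1.
rewrite z_iterate; apply: le_trans (resolvent_lip _ _) _.
rewrite ler_wpM2l ?addr_ge0 ?mulr_ge0 // ?(ltW gamma_gt0) //.
exact: le_trans xT TT.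
Qed.

Lemma iterates_dist_le n :
  ipnorm (ip3 ip) ((x n.+1, y n.+1, z n.+1) - (pt, pt, pt + gamma *: grad_f pt))
    <= dist_const * T n.
Proof.
apply: le_trans (ipnorm3_le_sum ip_norm _) _ => /=.
have [_ _ xT] := T_P n; have := y_dist_le n; have := z_dist_le n.
rewrite /dist_const; lra.
Qed.

Lemma F_limit : F pt = vlim%:E.
Proof.
by have [gpt -> _ _] := cd; rewrite F_def gpt -!EFinD; congr EFin; ring.
Qed.

Lemma ell_ge_lim n : vlim <= ell n.
Proof.
by have := gap_ge0 delta_gt0 ell_decrease ell_v n; rewrite subr_ge0.
Qed.

Definition value_const : R :=
  1 + (kappa / 2 + l / 2 + (2 * theta * gamma)^-1) * (r0 + 1) ^+ 2.

(** [F] at [y n.+1] lies between two consecutive values of [ell], up to the quadratic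
    error of the model. *)
Lemma F_dist_le n : (`|F (y n.+1) - F pt| <=
  ((ell n - vlim) + value_const * T n ^+ 2)%:E)%E.
Proof.
rewrite F_iterate F_limit -EFinB /= lee_fin.
have [sT _ _] := T_P n; have T0 : 0 <= T n := le_trans (step_ge0 n) sT.
have up := F_le_ell n; have lo := F_ge_ell n; have v1 := ell_ge_lim n.+1.
have v0 := ell_ge_lim n.
have yx : `|y n.+1 - x n.+2| <= (r0 + 1) * T n.
  rewrite (subr_split _ (x n.+1)) -(opprB (x n.+2)) addrC.
  apply: le_trans (ler_normB _ _) _; rewrite mulrDl mul1r.
  apply: lerD => //; apply: le_trans (y_minus_x_le n) _.
  by rewrite ler_wpM2l.
have q0 : 0 <= kappa / 2 + l / 2 + (2 * theta * gamma)^-1.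
  by rewrite !addr_ge0 // divr_ge0.
have sq : `|y n.+1 - x n.+2| ^+ 2 <= (r0 + 1) ^+ 2 * T n ^+ 2.
  by rewrite -exprMn ler_pXn2r ?nnegrE ?mulr_ge0 ?addr_ge0.
have := ler_wpM2l q0 sq; rewrite [leRHS]mulrA => h.
have T2 := sqr_ge0 (T n).
have V0 : 0 <= (kappa / 2 + l / 2 + (2 * theta * gamma)^-1) * (r0 + 1) ^+ 2 * T n ^+ 2.
  by rewrite mulr_ge0 ?sqr_ge0 // mulr_ge0 ?sqr_ge0.
rewrite ler_norml /value_const; apply/andP; split; lra.
Qed.

(** From some index on [T <= 1], so that the quadratic error of [F_dist_le] is
    dominated by [T] itself. *)
Lemma decay_rate (r : nat -> R) (Gr : R) (N : nat) : 0 < Gr -> T @ \oo --> 0 ->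
  (forall n B, (forall m, \sum_(k < m) step (n + k)%N <= B) -> T n <= B) ->
  (forall n, (N <= n)%N -> (0 < n)%N -> ell n - vlim <= Gr * r n /\
    forall m, \sum_(k < m) step (n + k)%N <= Gr * r n) ->
  exists (Gamma : R) (N' : nat), 0 < Gamma /\ forall n, (N' <= n)%N -> (0 < n)%N ->
    ipnorm (ip3 ip) ((x n.+1, y n.+1, z n.+1) - (pt, pt, pt + gamma *: grad_f pt))
      <= Gamma * r n /\
    (`|F (y n.+1) - F pt| <= (Gamma * r n)%:E)%E.
Proof.
move=> Gr0 T_cvg T_tail decay.
have [N1 _ T1] : \forall n \near \oo, T n < 1 by apply: (cvgr_lt 0).
have V0 : 0 <= value_const.
  by rewrite addr_ge0 // mulr_ge0 ?sqr_ge0 // !addr_ge0 // divr_ge0.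
have D0 : 0 <= dist_const by have := dist_const_ge1; lra.
exists ((dist_const + 1 + value_const) * Gr), (maxn N N1).
split; first by rewrite mulr_gt0 // ltr_wpDr // ltr_wpDl.
move=> n; rewrite geq_max => /andP[Nn N1n] n0.
have [sn tail] := decay n Nn n0; have Tn := T_tail n _ tail.
have [sT _ _] := T_P n; have T0 : 0 <= T n := le_trans (step_ge0 n) sT.
have Tlt1 : T n < 1 by exact: T1.
have T2 : T n ^+ 2 <= T n by rewrite expr2 ler_piMl // ltW.
have Gn : 0 <= Gr * r n := le_trans T0 Tn.
have DT := ler_wpM2l D0 Tn; have VT := ler_wpM2l V0 (le_trans T2 Tn).
have DG := mulr_ge0 D0 Gn; have VG := mulr_ge0 V0 Gn.
split; first by apply: le_trans (iterates_dist_le n) _; lra.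
by apply: le_trans (F_dist_le n) _; rewrite lee_fin; lra.
Qed.

Lemma iterates_cvg : T @ \oo --> 0 ->
  (x n, y n, z n) @[n --> \oo] --> (pt, pt, pt + gamma *: grad_f pt).
Proof.
move=> T_cvg.
have cx : x @ \oo --> pt.
  rewrite -(cvg_shiftS x); apply: (cvg_dominated (C := 1)) T_cvg => n.
  by rewrite mul1r; have [] := T_P n.
have cy : y @ \oo --> pt.
  by rewrite -(cvg_shiftS y); apply: cvg_dominated T_cvg => n; exact: y_dist_le.
have cz : z @ \oo --> pt + gamma *: grad_f pt.
  by rewrite -(cvg_shiftS z); apply: cvg_dominated T_cvg => n; exact: z_dist_le.
exact (cvg_pair (cvg_pair cx cy) cz).
Qed.

(** [pv] belongs to both subdifferentials: the paraboloid below [g] and the quadratic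
    minorants of [f] and [hbar] add up to one of [f + g + hbar] with slope [pv]. *)
Lemma limit_stationary :
  [set a - b | a in limiting_subdiff ip
                      (fun t => ((f t)%:E + g t + (hbar t)%:E)%E) pt
             & b in convex_subdiff ip hlow pt] 0.
Proof.
have [gpt _ subv gprox] := cd.
exists pv; last by exists pv; rewrite ?subrr.
pose C : R := kappa / 2 + l / 2 + (2 * theta * gamma)^-1.
apply: regular_limiting_subdiff.
apply: (@proximal_regular_subdiff _ _ _ 1 C _ _ _ (f pt + G + hbar pt)) => //.
- by rewrite /C !addr_ge0 // divr_ge0.
- by move=> v; rewrite (ipnormE ip_norm) mul1r.
- by rewrite gpt -!EFinD.
move=> w; rewrite (ipnormE ip_norm).
have /andP[hf _] := f_taylor pt w; have /andP[hh _] := hbar_taylor pt w.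
have [gNy _] := g_proper; move: (gprox w) (gNy w).
case: (g w) => [b| |] //; last by move=> _ _; rewrite addey // addye // leey.
rewrite -!EFinD !lee_fin !ipDl !ipNl /C => h _; lra.
Qed.

(** The bounds of [decay_rate] concern the iterates of index [n.+1]; the hypothesis on
    [C] pays for the shift. *)
Lemma iterates_rate (r : nat -> R) (C Gr : R) (N : nat) :
  (forall n, (0 < n)%N -> 0 < r n) -> 0 <= C ->
  (forall n, (0 < n)%N -> r n <= C * r n.+1) -> 0 < Gr -> T @ \oo --> 0 ->
  (forall n B, (forall m, \sum_(k < m) step (n + k)%N <= B) -> T n <= B) ->
  (forall n, (N <= n)%N -> (0 < n)%N -> ell n - vlim <= Gr * r n /\
    forall m, \sum_(k < m) step (n + k)%N <= Gr * r n) ->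
  exists2 Gamma : R, 0 < Gamma &
    rate_bound (ipnorm (ip3 ip)) (fun n => (x n, y n, z n))
      (pt, pt, pt + gamma *: grad_f pt) (F \o y) (F pt) (fun n => Gamma * r n).
Proof.
move=> r_gt0 C0 r_shift Gr0 T_cvg T_tail decay.
have [G1 [N1 [G10 bound]]] := decay_rate Gr0 T_cvg T_tail decay.
pose e1 n := ipnorm (ip3 ip) ((x n, y n, z n) - (pt, pt, pt + gamma *: grad_f pt)).
pose e2 n := `|fine (F (y n)) - vlim|.
have e2E n : (`|F (y n.+1) - F pt| = (e2 n.+1)%:E)%E.
  by rewrite /e2 F_iterate F_limit.
have [] := @rate_extend _ (fun n => Num.max (e1 n) (e2 n)) r (G1 * C) N1.+2 r_gt0.
  move=> [//|n] /= N1n _; have n0 : (0 < n)%N by exact: leq_ltn_trans (leq0n N1) N1n.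
  have [b1 b2] := bound n (ltnW N1n) n0.
  have h : G1 * r n <= G1 * C * r n.+1 by rewrite -mulrA ler_pM2l // r_shift.
  rewrite ge_max (le_trans b1 h) /=; apply: le_trans h.
  by rewrite -lee_fin -e2E.
move=> Gamma Gamma0 h; exists Gamma => // -[//|n] _.
have := h n.+1 isT; rewrite ge_max => /andP[h1 h2]; split => //.
by rewrite /= e2E lee_fin.
Qed.

Lemma iterates_finite_steps (N : nat) :
  (forall n B, (forall m, \sum_(k < m) step (n + k)%N <= B) -> T n <= B) ->
  (forall n, (N <= n)%N -> step n = 0) ->
  forall n, (N.+1 <= n)%N -> (x n, y n, z n) = (pt, pt, pt + gamma *: grad_f pt).
Proof.
move=> T_tail step0 [//|n] Nn.
have T0 : T n <= 0.
  apply: T_tail => m; rewrite big1 // => k _.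
  by rewrite step0 // (leq_trans _ (leq_addr _ _)).
have Teq : T n = 0.
  by apply/eqP; rewrite eq_le T0; have [sT _ _] := T_P n; rewrite (le_trans (step_ge0 n)).
have [_ _ xT] := T_P n; have yT := y_dist_le n; have zT := z_dist_le n.
move: xT yT zT; rewrite Teq !mulr0 !normr_le0 !subr_eq0.
by move=> /eqP -> /eqP -> /eqP ->.
Qed.

(** Along [q t] the Lagrangian exceeds its critical value by an amount between [t^2]
    and a multiple of [t^2], while it has a subgradient of norm at most [Cu * t]; an
    inequality [c0 * (Cu * t) >= 1] for small [t] is impossible. *)
Lemma exponent0_absurd (e : H) : `|e| = 1 ->
  ~ KL_at_exponent (ip5 ip) 0 L (pt, pt, pt + gamma *: grad_f pt, grad_hbar pt, pv).
Proof.
move=> e1 [c0 c0_gt0 [eps [del [eps0 del0 _ KLp]]]].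
have [gpt vE subv gprox] := cd.
set p := (_, _, _, _, pv) in KLp.
have [Lp _] := critical_point_lagrangian cd.
have ee : ip e e = 1 by rewrite ip_norm e1 expr1n.
(* The summand [kappa / 2 + l / 2] absorbs the Taylor errors of [f] and [hbar],
   [c - gamma^-1] cancels the coupling terms, and [1] leaves the lower bound [t ^+ 2]. *)
pose K := kappa / 2 + l / 2 - gamma^-1 + c + 1.
pose zeta := pv - grad_f pt - grad_hbar pt.
pose q (t : R) := (pt + t *: e, pt, pt + gamma *: grad_f pt,
  grad_hbar pt - (K * t) *: e, pv).
pose u (t : R) := lagrangian_subgradient (grad_f := grad_f) (grad_hbar := grad_hbar)
  (gamma := gamma) (theta := theta) (eta := eta) (pt + t *: e) pt
  (pt + gamma *: grad_f pt) (grad_hbar pt - (K * t) *: e) pv pt zeta.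
have yx (t : R) : pt - (pt + t *: e) = - (t *: e) by rewrite opprD addrA subrr add0r.
have zx (t : R) : pt + gamma *: grad_f pt - (pt + t *: e) = gamma *: grad_f pt - t *: e.
  by rewrite opprD addrACA subrr add0r.
have nte (t : R) : 0 < t -> `|t *: e| = t by move=> t0; rewrite normrZ e1 mulr1 gtr0_norm.
have Lq (t : R) : 0 < t -> exists D : R,
    [/\ L (q t) = (vlim + D)%:E, t ^+ 2 <= D & D <= t ^+ 2 * (1 + kappa + l)].
  move=> t0.
  have /andP[f1 f2] := f_taylor pt (pt + t *: e).
  have /andP[h1 h2] := hbar_taylor pt (pt + t *: e).
  move: f1 f2 h1 h2; rewrite addrAC subrr add0r nte // !ipZr => f1 f2 h1 h2.
  exists (f (pt + t *: e) - f pt - t * ip (grad_f pt) e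
    + (hbar (pt + t *: e) - hbar pt - t * ip (grad_hbar pt) e)
    + t ^+ 2 * (K + gamma^-1 - c)); split; last 2 first.
  - by rewrite /K; lra.
  - by rewrite /K; lra.
  rewrite /L /q (lagrangian_finite _ _ _ gpt subv) /coupling -/c yx zx normrN nte //.
  congr EFin; rewrite vE !ipE ee.
  by field; rewrite gt_eqF.
have uq (t : R) : limiting_subdiff (ip5 ip) L (q t) (u t).
  apply: regular_limiting_subdiff.
  exact (lagrangian_regular_subdiff ip_norm kappa_ge0 l_ge0 f_grad f_lip hbar_grad
    hbar_lip gamma_gt0 _ _ _ gpt prox_const_ge0 gprox subv).
pose Cu := kappa + l + `|K + 2 * gamma^-1 - 2 * c| + `|- K - gamma^-1 + 2 * c|
  + gamma^-1 + 1.
have u_le (t : R) : 0 < t -> ipnorm (ip5 ip) (0 - u t) <= Cu * t.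
  move=> t0; rewrite /u /lagrangian_subgradient -/c yx zx.
  have -> : grad_f (pt + t *: e) + grad_hbar (pt + t *: e) + (- (grad_hbar pt - (K * t) *: e)
      - gamma^-1 *: - (t *: e) - gamma^-1 *: (gamma *: grad_f pt - t *: e)
      + (2 * c) *: - (t *: e)) =
    (grad_f (pt + t *: e) - grad_f pt) + (grad_hbar (pt + t *: e) - grad_hbar pt)
      + (K + 2 * gamma^-1 - 2 * c) *: (t *: e).
    by apply: (ip_ext ip_norm) => w; rewrite !ipE; field; rewrite gt_eqF.
  have -> : zeta + (grad_hbar pt - (K * t) *: e - pv
      + gamma^-1 *: (gamma *: grad_f pt - t *: e) - (2 * c) *: - (t *: e)) =
    (- K - gamma^-1 + 2 * c) *: (t *: e).
    by apply: (ip_ext ip_norm) => w; rewrite /zeta !ipE; field; rewrite gt_eqF.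
  apply: le_trans (ipnorm5_le_sum ip_norm _) _ => /=.
  rewrite !sub0r !normrN subrr normr0 addr0.
  rewrite [`|_ *: - (t *: e)|]normrZ normrN [`|(- K - _ + _) *: _|]normrZ nte //.
  have hf := grad_f_lip (pt + t *: e) pt; have hh := grad_hbar_lip (pt + t *: e) pt.
  move: hf hh; rewrite addrAC subrr add0r nte // => hf hh.
  set a1 := grad_f _ - _ in hf *; set a2 := grad_hbar _ - _ in hh *.
  have := ler_normD (a1 + a2) ((K + 2 * gamma^-1 - 2 * c) *: (t *: e)).
  rewrite [`|(K + _ - _) *: _|]normrZ nte //.
  have := ler_normD a1 a2.
  rewrite (gtr0_norm (x := gamma^-1)) ?invr_gt0 // /Cu; lra.
have [d [d0 d_le]] : exists d : R, 0 < d /\ (d%:E <= del)%E.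
  case: del del0 {KLp} => [d| |] // h; first by exists d.
  by exists 1; rewrite leey.
(* [M] bounds the three constants that multiply [t] below: those of the distance
   to [p], of the value and of the subgradient. *)
pose M := (1 + `|K|) + (1 + kappa + l) + c0 * Cu + 1.
have Cu0 : 0 <= Cu by rewrite !addr_ge0 // invr_ge0 ltW.
have cCu := mulr_ge0 (ltW c0_gt0) Cu0; have nK := normr_ge0 K.
have k0 := kappa_ge0; have l0 := l_ge0.
have M1 : 1 <= M by rewrite /M; lra.
pose b := Num.min eps (Num.min d 1).
have b0 : 0 < b by rewrite !lt_min eps0 d0 ltr01.
have [b_eps b_d b_1] : [/\ b <= eps, b <= d & b <= 1].
  by rewrite /b !ge_min !lexx !orbT.
pose t := b / (2 * M).
have t0 : 0 < t by rewrite divr_gt0 // mulr_gt0 //; lra.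
have tM : t * M < b.
  have -> : t * M = b / 2 by rewrite /t; field; rewrite gt_eqF //; lra.
  by lra.
have t_le k : 0 <= k -> k <= M -> t * k < b.
  by move=> _ kM; apply: le_lt_trans tM; rewrite ler_pM2l.
have t1 : t <= 1 by have := t_le 1 ler01 M1; lra.
have [D [LqE D_lo D_up]] := Lq t t0.
have D0 : 0 < D by apply: lt_le_trans D_lo; rewrite exprn_gt0.
have D_del : (D%:E < del)%E.
  apply: lt_le_trans d_le; rewrite lte_fin.
  have h := t_le (1 + kappa + l) _ _.
  apply: le_lt_trans D_up _; apply: lt_le_trans b_d.
  apply: le_lt_trans (h _ _); rewrite ?/M; [|lra|lra].
  by rewrite ler_wpM2r //; [lra|rewrite expr2 ler_piMl // ltW].
have q_eps : ipnorm (ip5 ip) (q t - p) <= eps.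
  apply: le_trans (ipnorm5_le_sum ip_norm _) _ => /=.
  rewrite !subrr !normr0 [pt + _ - pt]addrAC subrr add0r nte // addr0.
  rewrite [grad_hbar pt - _ - _]addrAC subrr sub0r normrN -scalerA normrZ nte //.
  have := t_le (1 + `|K|) _ _; rewrite /M => h; have := h _ _; lra.
have := KLp (q t) q_eps; rewrite Lp LqE lte_fin ltrDl D0.
have -> : ((vlim + D)%:E < vlim%:E + del)%E.
  by rewrite EFinD lteD2lE.
move=> /(_ isT isT); rewrite -EFinB /= addrAC subrr add0r derive1_scaled_powR //.
rewrite subr0 mul1r oppr0 powRr0 mulr1 => one_le.
have : (1 <= (c0 * (Cu * t))%:E)%E.
  apply: le_trans one_le _; rewrite EFinM.
  apply: lee_wpmul2l; first by rewrite lee_fin ltW.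
  apply: ge_ereal_inf; exists (ipnorm (ip5 ip) (0 - u t))%:E; first by exists (u t).
  by rewrite lee_fin u_le.
rewrite lee_fin; have := t_le (c0 * Cu) _ _; rewrite /M => h; have := h _ _; lra.
Qed.

Lemma exponent_convergence lambda : 0 <= lambda < 1 -> T @ \oo --> 0 ->
  (forall n B, (forall m, \sum_(k < m) step (n + k)%N <= B) -> T n <= B) ->
  KL_function_exponent (ip5 ip) lambda L ->
  let w n := (x n, y n, z n) in
  let wt := (pt, pt, pt + gamma *: grad_f pt) in
  [\/ finite_convergence w wt lambda,
      linear_convergence (ipnorm (ip3 ip)) w wt (F \o y) (F pt) lambda
    | sublinear_convergence (ipnorm (ip3 ip)) w wt (F \o y) (F pt) lambda].
Proof.
move=> /andP[l_ge0' l_lt1] T_cvg T_tail KLl w wt.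
have [A A_comp A_it] := iterate_compact; have crit := cluster_critical ell_v.
have ipK := ipnorm5_le ip_norm.
have [l_eq0|l_neq0] := eqVneq lambda 0.
  have [N stepN] := KL_finite ipK delta_gt0 Csub_gt0 step_ge0 lagrangian_iterate
    ell_decrease ell_v iterate_subgradient_step A_comp A_it crit l_ge0' l_lt1 l_eq0 KLl.
  by constructor 1; split => //; exists N.+1; exact: iterates_finite_steps.
have l_gt0 : 0 < lambda by rewrite lt_def l_neq0.
have [l_le|l_gt] := leP lambda (1 / 2).
  have [G1 [rho [N [G0 /andP[rho0 rho1] decay]]]] := KL_linear ipK delta_gt0 Csub_gt0
    step_ge0 lagrangian_iterate ell_decrease ell_v iterate_subgradient_step A_comp A_it
    crit l_ge0' l_lt1 l_gt0 l_le KLl.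
  have shift n : rho `^ (n%:R / 2) <= rho `^ (- (1 / 2)) * rho `^ (n.+1%:R / 2).
    rewrite -powRD; last by apply/implyP => _; rewrite gt_eqF.
    by rewrite -natr1 (_ : - (1 / 2) + _ = n%:R / 2) //; ring.
  have [Gamma Gamma0 bound] := iterates_rate (fun n _ => powR_gt0 _ rho0)
    (powR_ge0 _ _) (fun n _ => shift n) G0 T_cvg T_tail (fun n Nn _ => decay n Nn).
  by constructor 2; split => //; exists Gamma, rho; rewrite rho0.
have [G1 [N [G0 decay]]] := KL_sublinear ipK delta_gt0 Csub_gt0 step_ge0
  lagrangian_iterate ell_decrease ell_v iterate_subgradient_step A_comp A_it
  crit l_ge0' l_lt1 l_gt KLl.
set s := (1 - lambda) / (2 * lambda - 1) in decay.
have s0 : 0 <= s by rewrite divr_ge0; lra.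
have shift n : (0 < n)%N -> n%:R `^ (- s) <= 2 `^ s * n.+1%:R `^ (- s) :> R.
  move=> n0; rewrite !powRN ler_pdivlMr ?powR_gt0 ?ltr0n // mulrC.
  rewrite ler_pdivrMr ?powR_gt0 ?ltr0n // -powRM // ge0_ler_powR ?nnegrE //.
  by rewrite -natrM ler_nat mul2n -addnn -addn1 leq_add2l.
have r_gt0 n : (0 < n)%N -> 0 < n%:R `^ (- s) :> R.
  by move=> n0; rewrite powR_gt0 // ltr0n.
have [Gamma Gamma0 bound] := iterates_rate r_gt0 (powR_ge0 _ _) shift G0 T_cvg T_tail decay.
by constructor 3; split => //; exists Gamma.
Qed.

End Distances.

End Algorithm.

(** * Convergence and rates *)

Theorem theorem3p10 (R : realType) (H : normedVectType R)
  (ip : {dot H for idfun}) (ip_norm : forall x, ip x x = `|x| ^+ 2)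
  (alpha kappa l : R) (kappa_ge0 : 0 <= kappa) (l_ge0 : 0 <= l)
  (f : H -> R) (grad_f : H -> H) (g : H -> \bar R)
  (hbar : H -> R) (grad_hbar : H -> H) (hlow : H -> R)
  (f_grad : is_gradient ip f grad_f)
  (f_convex : alpha_convex alpha (EFin \o f))
  (f_lip : kappa.-lipschitz grad_f)
  (alpha_ge : - kappa <= alpha)
  (g_proper : proper_function g) (g_lsc : lower_semicontinuous g)
  (hbar_grad : is_gradient ip hbar grad_hbar)
  (hbar_lip : l.-lipschitz grad_hbar)
  (hlow_cont : continuous hlow) (hlow_convex : convex_function setT hlow)
  (F : H -> \bar R)
  (F_def : forall x, F x = ((f x)%:E + g x + (hbar x - hlow x)%:E)%E)
  (F_coercive : coercive F)
  (gamma theta eta : R) (gamma_gt0 : 0 < gamma) (theta_in : 0 < theta <= 1)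
  (eta_gt0 : 0 < eta)
  (x y z ys : nat -> H)
  (algo : DRFDR ip (EFin \o f) g grad_hbar hlow gamma theta eta x y z ys)
  (params : [\/ condition_a alpha kappa l theta eta gamma,
                condition_b alpha kappa l theta eta gamma
              | condition_c kappa l theta eta gamma])
  (L : H * H * H * H * H -> \bar R)
  (L_def : L = lagrangian ip f g hbar hlow gamma theta eta)
  (L_KL : KL_function (ip5 ip) L) :
  (\sum_(1 <= n <oo)
     (ipnorm (ip3 ip) ((x n.+1, y n.+1, z n.+1) - (x n, y n, z n)))%:E < +oo)%E
  /\
  exists xt yt zt : H,
    [/\ (x n, y n, z n) @[n --> \oo] --> (xt, yt, zt),
        xt = yt,
        [set a - b | a in limiting_subdiff ip
                            (fun t => ((f t)%:E + g t + (hbar t)%:E)%E) yt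
                   & b in convex_subdiff ip hlow yt] 0
      & forall lambda : R, 0 <= lambda < 1 ->
        KL_function_exponent (ip5 ip) lambda L ->
        let w := fun n => (x n, y n, z n) in
        let wt := (xt, yt, zt) in
        let nrm := ipnorm (ip3 ip) in
        let i := finite_convergence w wt lambda in
        let ii := linear_convergence nrm w wt (F \o y) (F yt) lambda in
        let iii := sublinear_convergence nrm w wt (F \o y) (F yt) lambda in
        [/\ [\/ i, ii | iii],
            ~ (i /\ iii), ~ (ii /\ iii)
          & (0 < \dim {:H})%N -> ~ (i /\ ii)]].
Proof.
have steps := steps_limit ip_norm kappa_ge0 l_ge0 f_grad f_convex f_lip g_proper
  hbar_grad hbar_lip gamma_gt0 theta_in eta_gt0 algo alpha_ge params g_lsc hlow_cont
  F_def F_coercive.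
rewrite {}L_def in L_KL *; have [vlim [pt [pv [G [T [ell_v cd T_cvg T_tail T_P]]]]]] := steps L_KL.
split.
  exact: (iterates_finite_length ip_norm kappa_ge0 l_ge0 f_grad f_convex f_lip g_proper
    hbar_grad hbar_lip gamma_gt0 theta_in eta_gt0 algo alpha_ge params g_lsc hlow_cont
    F_def F_coercive L_KL).
exists pt, pt, (pt + gamma *: grad_f pt); split => //.
- exact: (iterates_cvg ip_norm kappa_ge0 f_grad f_lip gamma_gt0 eta_gt0 algo T_P T_cvg).
- exact: (limit_stationary ip_norm kappa_ge0 l_ge0 f_grad f_lip g_proper hbar_grad
    hbar_lip gamma_gt0 theta_in cd).
move=> lambda lambda_in KLl w wt nrm i ii iii; split.
- exact: (exponent_convergence ip_norm kappa_ge0 l_ge0 f_grad f_convex f_lip g_proper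
    hbar_grad hbar_lip gamma_gt0 theta_in eta_gt0 algo alpha_ge params g_lsc hlow_cont
    F_def F_coercive ell_v cd T_P lambda_in T_cvg T_tail KLl).
- by move=> [[l0 _] [h _]]; lra.
- by move=> [[h _] [h' _]]; lra.
move=> dim_gt0 [[lambda0 _] _].
have [v v_neq0] : exists v : H, v != 0.
  exists (vpick {:H}); rewrite vpick0; apply: contraTneq dim_gt0 => ->.
  by rewrite dimv0.
have [_ dom_p] := critical_point_lagrangian ip_norm kappa_ge0 l_ge0 f_grad f_lip hbar_grad
  hbar_lip (eta := eta) gamma_gt0 theta_in cd.
have e1 : `| `|v|^-1 *: v | = 1.
  by rewrite normrZ normfV normr_id mulVf // normr_eq0.
apply: (exponent0_absurd ip_norm kappa_ge0 l_ge0 f_grad f_lip hbar_grad hbar_lip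
  (eta := eta) gamma_gt0 theta_in cd e1).
by rewrite -lambda0; exact: KLl.2.
Qed.
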